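(* With the notation of the context, fix a framing $f$ of $\Lambda_{prim}$. The functions $\Gamma_{a,b}$ and $\Delta_a=\Delta_{a,f}$ are meromorphic on $V_a\cap V_b$ and (for each $g\in G$) on $V_a$ respectively, so that they form a cochain $$s=(\Gamma,\Delta)\in C^{0,1}_G(\mathcal U,\mathcal M^\times)\oplus C^{1,0}_G(\mathcal U,\mathcal M^\times)=C^1_G(\mathcal U,\mathcal M^\times),$$ whose component for the planes $H(e_1),H(e_2)$ is the elliptic gamma function: $\Gamma_{e_1,e_2}(w,x)=\Gamma\left(\frac{w}{x_3},\frac{x_1}{x_3},\frac{x_2}{x_3}\right)$. Moreover $s$ is a meromorphic section of an equivariant holomorphic gerbe on $X$ given by a 2-cocycle $\phi\in C_G^2(\mathcal U,\mathcal O^\times)$, i.e. $Ds=\phi$ with $\phi$ consisting of nowhere vanishing holomorphic functions. Explicitly: there are nowhere vanishing holomorphic functions $\phi_{a,b,c}$ on $V_a\cap V_b\cap V_c$, $\phi_{a,b}(g;\cdot)$ on $V_a\cap V_b$ and $\phi_a(g,h;\cdot)$ on $V_a$, such that for all $a,b,c\in\Lambda_{prim}$ and $g,h\in G$ $$\Gamma_{a,b}(y)\Gamma_{b,a}(y)=1,\qquad y\in V_a\cap V_b,$$ $$\phi_{a,b,c}(y)\Gamma_{a,c}(y)=\Gamma_{a,b}(y)\Gamma_{b,c}(y),\qquad y\in V_a\cap V_b\cap V_c,$$ $$\phi_{a,b}(g;y)\,\Gamma_{g^{-1}a,g^{-1}b}(g^{-1}y)\,\Delta_b(g;y)=\Delta_a(g;y)\,\Gamma_{a,b}(y),\qquad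 y\in V_a\cap V_b,$$ $$\phi_a(g,h;y)\,\Delta_a(gh;y)=\Delta_a(g;y)\,\Delta_{g^{-1}a}(h;g^{-1}y),\qquad y\in V_a.$$
   Context: Lattice and planes. $\Lambda=\mathbb Z^3\subset V=\mathbb Q^3$, $V_{\mathbb C}=\mathbb C^3$, $\Lambda^\vee=\mathrm{Hom}_{\mathbb Z}(\Lambda,\mathbb Z)\subset V^*$; $\det$ denotes the standard determinant forms on $V$ and on $V^*$; linear forms are extended $\mathbb C$-linearly to $V_{\mathbb C}$. $e_1,e_2,e_3$ is the standard basis. $\Lambda_{prim}$ is the set of primitive vectors of $\Lambda$. For $a\in\Lambda_{prim}$ let $\Lambda^\vee_+(a)=\{\delta\in\Lambda^\vee:\delta(a)>0\}$, $\Lambda^\vee_-(a)=\{\delta\in\Lambda^\vee:\delta(a)\le 0\}$, and let $H(a)=\{\alpha\in V^*:\alpha(a)=0\}$, oriented so that an ordered basis $(\alpha,\beta)$ of $H(a)$ is oriented iff $\det(\alpha,\beta,\delta)>0$ whenever $\delta(a)>0$. Thus $\Lambda_{prim}$ indexes the oriented planes through $0$ in $V^*$. Let $U_a^+$ be the open set of $x\in V_{\mathbb C}$ with $\mathrm{Im}(\alpha(x)\overline{\beta(x)})>0$ for some (equivalently every) oriented basis $(\alpha,\beta)$ of $H(a)$. Gamma functions. For linearly independent $a,b\in\Lambda_{prim}$ the direction vector $\gamma=\gamma_{a,b}$ is the unique primitive element of $\Lambda^\vee$ with $\det(a,b,\cdot)=s\gamma$ for a positive integer $s$. Put $C_{+-}(a,b)=\Lambda^\vee_+(a)\cap\Lambda^\vee_-(b)$,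 $C_{-+}(a,b)=\Lambda^\vee_-(a)\cap\Lambda^\vee_+(b)$; $\mathbb Z\gamma$ acts on these by translation. For $w\in\mathbb C$, $x\in U_a^+\cap U_b^+$, $$\Gamma_{a,b}(w,x)=\frac{\prod_{\delta\in C_{+-}(a,b)/\mathbb Z\gamma}(1-e^{-2\pi i(\delta(x)-w)/\gamma(x)})}{\prod_{\delta\in C_{-+}(a,b)/\mathbb Z\gamma}(1-e^{2\pi i(\delta(x)-w)/\gamma(x)})},\qquad \Gamma_{a,a}=1.$$ (For $b=-a$ the set $U_a^+\cap U_b^+$ is empty.) The ordinary elliptic gamma function is, for $\mathrm{Im}\,\tau,\mathrm{Im}\,\sigma>0$, $\Gamma(z,\tau,\sigma)=\prod_{j,k\ge0}\frac{1-e^{2\pi i((j+1)\tau+(k+1)\sigma-z)}}{1-e^{2\pi i(j\tau+k\sigma+z)}}$, extended to $\mathrm{Im}\,\tau,\mathrm{Im}\,\sigma\neq0$ by $\Gamma(z,\tau,\sigma)=\Gamma(z-\tau,-\tau,\sigma)^{-1}=\Gamma(z-\sigma,\tau,-\sigma)^{-1}$. Framings and $\Delta$. $\theta_0(z,\tau)=\prod_{j\ge0}(1-e^{2\pi i((j+1)\tau-z)})(1-e^{2\pi i(j\tau+z)})$ for $\mathrm{Im}\,\tau>0$. A framing $f$ assigns to each $a\in\Lambda_{prim}$ an oriented $\mathbb Z$-basis $f(a)=(\alpha_1,\alpha_2,\alpha_3)$ of $\Lambda^\vee$ with $\alpha_1(a)=1$, $\alpha_2,\alpha_3\in H(a)$.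 For $\mu\in\Lambda^\vee$, $w\in\mathbb C$, $x\in U_a^+$ put $\Delta_a(\mu;w,x)=\prod_{j=0}^{\mu(a)-1}\theta_0\left(\frac{w+j\alpha_1(x)}{\alpha_3(x)},\frac{\alpha_2(x)}{\alpha_3(x)}\right)$, where the product means $\prod_{-N\le j<\mu(a)}/\prod_{-N\le j<0}$ for $N$ large (so it is defined also for $\mu(a)\le 0$). Space, group, covering. $X$ is the total space of the restriction of the dual tautological bundle $O(1)\to\mathbb CP^2$ to $\mathbb CP^2-\mathbb RP^2$, i.e. $X=\{(w,x)\in\mathbb C\times(\mathbb C^3-\mathbb C\cdot\mathbb R^3)\}/\mathbb C^\times$ with $(w,x)\sim(\lambda w,\lambda x)$. $G=ISL_3(\mathbb Z)=SL_3(\mathbb Z)\ltimes\Lambda^\vee$ acts by $(g,\mu)\cdot(w,x)=(w-\mu(x),gx)$. For $a\in\Lambda_{prim}$, $V_a=\{(w,x):x\in U_a^+\}/\mathbb C^\times$; $\mathcal U=(V_a)$ is an invariant open covering with $(g,\mu)V_a=V_{ga}$ (elements of $G$ act on $\Lambda_{prim}$ through $SL_3(\mathbb Z)$). The functions $\Gamma_{a,b},\Delta_a(\mu;\cdot)$ are homogeneous of degree $0$ in $(w,x)$, hence are functions on $V_a\cap V_b$, $V_a$. Extend $\Delta_a$ to $G$ by $\Delta_a((g,\mu);w,x)=\Delta_a(\mu\circ g^{-1};w,x)$. Complex. $\mathcal O^\times$, $\mathcal M^\times$ are the sheaves of nowhere vanishing holomorphic and of non-zero meromorphic functions. For a $G$-equivariant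 sheaf $\mathcal F$ of abelian groups, $C_G^{p,q}(\mathcal U,\mathcal F)=C^p(G,\check C^q(\mathcal U,\mathcal F))$ is the double complex of group cochains with values in Čech cochains, with total differential $D=\delta+(-1)^p\check\delta$, where (additively) $\check\delta\phi_{a_0,\dots,a_{q+1}}=\sum_i(-1)^i\phi_{a_0,\dots,\widehat{a_i},\dots,a_{q+1}}$ and $\delta c(g_1,\dots,g_{p+1})=(-1)^{p+1}g_1\cdot c(g_2,\dots)+\sum_{j=1}^p(-1)^{p+1-j}c(\dots,g_jg_{j+1},\dots)+c(g_1,\dots,g_p)$. An equivariant holomorphic gerbe on $X$ is given by a 2-cocycle $\phi\in C^2_G(\mathcal U,\mathcal O^\times)$, and a meromorphic section of it is $s\in C^1_G(\mathcal U,\mathcal M^\times)$ with $Ds=\phi$. *)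

(* Defs.v *)
From HB Require Import structures.
From mathcomp Require Import all_boot all_order all_algebra.
From mathcomp Require Import complex finmap.
From mathcomp Require Import all_classical all_reals all_analysis.
From mathcomp.analysis.showcase Require summability.

Set Implicit Arguments.
Unset Strict Implicit.
Unset Printing Implicit Defensive.

Import Order.TTheory GRing.Theory Num.Theory.
Import numFieldNormedType.Exports.

Local Open Scope classical_set_scope.
Local Open Scope ring_scope.

(* The library only puts its standard topology and norm on carriers of abstract
   number fields; the concrete type R[i] gets them through the alias R[i]^o. *)
HB.instance Definition _ (R : realType) :=
  GRing.ComAlgebra.copy R[i] (R[i])^o.
HB.instance Definition _ (R : realType) := Vector.copy R[i] (R[i])^o.
HB.instance Definition _ (R : realType) := NormedModule.copy R[i] (R[i])^o.

(* Lambda is 'cV[int]_3 and its dual is 'rV[int]_3; similarly V_C is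
   'cV[R[i]]_3 and V^* is 'rV[rat]_3. *)

Definition ev (K : pzRingType) (d : 'rV[K]_3) (x : 'cV[K]_3) : K :=
  (d *m x) 0 0.

Definition rows3 (K : pzRingType) (u v w : 'rV[K]_3) : 'M[K]_3 :=
  \matrix_(i < 3) nth 0 [:: u; v; w] i.

(* This excludes v = 0, because 0 = 2 *: 0. *)
Definition primitive m n (v : 'M[int]_(m, n)) : Prop :=
  forall (k : int) (u : 'M[int]_(m, n)), v = k *: u -> `|k| = 1.

Definition Lprim := {a : 'cV[int]_3 | primitive a}.

Lemma primitive_delta (i : 'I_3) :
  primitive (delta_mx i 0 : 'cV[int]_3).
Proof.
move=> k u /(congr1 (fun M : 'cV[int]_3 => M i 0)).
rewrite !mxE !eqxx /= => /esym ku1.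
have : `|k| * `|u i 0| = 1 by rewrite -normrM ku1 normr1.
move/eqP; rewrite -!abszE -PoszM eqz_nat muln_eq1 => /andP[/eqP -> _].
by [].
Qed.

Definition e1 : Lprim := exist _ _ (@primitive_delta 0).
Definition e2 : Lprim := exist _ _ (@primitive_delta 1).

Definition Lplus (a : 'cV[int]_3) : set 'rV[int]_3 := [set d | 0 < ev d a].
Definition Lminus (a : 'cV[int]_3) : set 'rV[int]_3 := [set d | ev d a <= 0].

Definition oriented_basis (a : 'cV[int]_3) (al be : 'rV[rat]_3) : Prop :=
  let aQ : 'cV[rat]_3 := map_mx intr a in
  [/\ ev al aQ = 0, ev be aQ = 0, row_free (col_mx al be)
    & forall d : 'rV[rat]_3, 0 < ev d aQ -> 0 < \det (rows3 al be d)].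

Definition is_direction (a b : 'cV[int]_3) (ga : 'rV[int]_3) : Prop :=
  primitive ga /\
  exists2 s : int, 0 < s
    & forall c : 'cV[int]_3, \det (rows3 a^T b^T c^T) = s * ev ga c.

Definition direction (a b : 'cV[int]_3) : 'rV[int]_3 :=
  xget 0 [set ga | is_direction a b ga].

Definition Zorbit (ga d : 'rV[int]_3) : set 'rV[int]_3 :=
  [set d + k *: ga | k in [set: int]].

Definition Zquotient (ga : 'rV[int]_3) (C : set 'rV[int]_3) :
    set (set 'rV[int]_3) :=
  [set Zorbit ga d | d in C].

(* Rows 0, 1, 2 of f a are alpha_1, alpha_2, alpha_3. *)
Definition framing (f : Lprim -> 'M[int]_3) : Prop :=
  forall a, [/\ f a \in unitmx, 0 < \det (f a),
    ev (row 0 (f a)) (sval a) = 1,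
    ev (row 1 (f a)) (sval a) = 0 & ev (row 2 (f a)) (sval a) = 0].

(* The product of G is forced by (g, mu).(w, x) = (w - mu(x), g x) being a left
   action: (g, mu)(h, nu) = (gh, mu o h + nu). *)
Definition ISL3 := {p : 'M[int]_3 * 'rV[int]_3 | \det p.1 == 1}.
HB.instance Definition _ := Choice.on ISL3.

Definition lin (g : ISL3) : 'M[int]_3 := (sval g).1.
Definition tra (g : ISL3) : 'rV[int]_3 := (sval g).2.

Lemma det_lin (g : ISL3) : \det (lin g) = 1.
Proof. exact/eqP/(svalP g). Qed.

Lemma unit_lin (g : ISL3) : lin g \in unitmx.
Proof. by rewrite unitmxE det_lin unitr1. Qed.

Fact isl_one_subproof : \det ((1%:M, 0) : 'M[int]_3 * 'rV[int]_3).1 == 1.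
Proof. by rewrite det1. Qed.
Definition isl_one : ISL3 := exist _ (1%:M, 0) isl_one_subproof.

Fact isl_mul_subproof (g h : ISL3) :
  \det (lin g *m lin h, tra g *m lin h + tra h).1 == 1.
Proof. by rewrite det_mulmx !det_lin mulr1. Qed.
Definition isl_mul (g h : ISL3) : ISL3 :=
  exist _ (lin g *m lin h, tra g *m lin h + tra h) (isl_mul_subproof g h).

Fact isl_inv_subproof (g : ISL3) :
  \det (invmx (lin g), - (tra g *m invmx (lin g))).1 == 1.
Proof. by rewrite det_inv det_lin invr1. Qed.
Definition isl_inv (g : ISL3) : ISL3 :=
  exist _ (invmx (lin g), - (tra g *m invmx (lin g))) (isl_inv_subproof g).

Fact isl_mulA : associative isl_mul.
Proof.
move=> g h k; apply: val_inj => /=; rewrite /lin /tra /=; congr (_, _).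
  by rewrite mulmxA.
by rewrite mulmxDl addrA mulmxA.
Qed.

Fact isl_mul1g : left_id isl_one isl_mul.
Proof.
case=> -[A u] p; apply: val_inj; rewrite /= /lin /tra /=.
by rewrite mul1mx mul0mx add0r.
Qed.

Fact isl_mulg1 : right_id isl_one isl_mul.
Proof.
case=> -[A u] p; apply: val_inj; rewrite /= /lin /tra /=.
by rewrite !mulmx1 addr0.
Qed.

Fact isl_mulVg : left_inverse isl_one isl_inv isl_mul.
Proof.
move=> g; have := unit_lin g; case: g => -[A u] p uA.
apply: val_inj; rewrite /= /lin /tra /=.
by rewrite mulVmx// mulNmx -mulmxA mulVmx// mulmx1 addNr.
Qed.

Fact isl_mulgV : right_inverse isl_one isl_inv isl_mul.
Proof.
move=> g; have := unit_lin g; case: g => -[A u] p uA.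
apply: val_inj; rewrite /= /lin /tra /=.
by rewrite mulmxV// addrN.
Qed.

HB.instance Definition _ := isGroup.Build ISL3
  isl_mulA isl_mul1g isl_mulg1 isl_mulVg isl_mulgV.

Fact act_prim_subproof (g : ISL3) (a : Lprim) : primitive (lin g *m sval a).
Proof.
move=> k u gak; apply: (svalP a k (invmx (lin g) *m u)).
by rewrite scalemxAr -gak mulKmx ?unit_lin.
Qed.
Definition act_prim (g : ISL3) (a : Lprim) : Lprim :=
  exist _ _ (@act_prim_subproof g a).

Section Functions.
Context {R : realType}.
Local Notation C := R[i].
Implicit Types (a b : 'cV[int]_3) (w z tau sigma : C) (x : 'cV[C]_3).

Definition evZ (d : 'rV[int]_3) x : C := ev (map_mx intr d) x.
Definition evQ (al : 'rV[rat]_3) x : C := ev (map_mx ratr al) x.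

Definition Uplus a : set 'cV[C]_3 :=
  [set x | exists al be, oriented_basis a al be /\
             0 < complex.Im (evQ al x * conjc (evQ be x))].

Definition cexp z : C :=
  Complex (expR (complex.Re z) * cos (complex.Im z))
          (expR (complex.Re z) * sin (complex.Im z)).

(* e^{2 pi i z} *)
Definition e2pi z : C := cexp (Complex 0 (2 * pi) * z).

(* Infinite products are unconditional: limits along the directed set of all
   finite sets of indices. *)
Definition finprod (I : choiceType) (S : set I) (F : I -> C) (B : {fset I}) :
    C :=
  \prod_(i <- B | i \in S) F i.

Definition infprod (I : choiceType) (S : set I) (F : I -> C) : C :=
  lim (finprod S F @ summability.totally).

Definition infprod_cvg (I : choiceType) (S : set I) (F : I -> C) : Prop :=
  cvg (finprod S F @ summability.totally).

(* xget 0 K is a representative of the class K; the factor does not depend on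
   it, as delta(x) / gamma(x) is well defined modulo Z. *)
Definition Gamma_num_factor a b w x (K : set 'rV[int]_3) : C :=
  1 - e2pi (- ((evZ (xget 0 K) x - w) / evZ (direction a b) x)).

Definition Gamma_den_factor a b w x (K : set 'rV[int]_3) : C :=
  1 - e2pi ((evZ (xget 0 K) x - w) / evZ (direction a b) x).

Definition Cpm a b := Zquotient (direction a b) (Lplus a `&` Lminus b).
Definition Cmp a b := Zquotient (direction a b) (Lminus a `&` Lplus b).

(* For b = - a the value is irrelevant: Uplus a and Uplus b are disjoint. *)
Definition Gamma (a b : Lprim) (y : C * 'cV[C]_3) : C :=
  if sval a == sval b then 1 else
  infprod (Cpm (sval a) (sval b))
          (Gamma_num_factor (sval a) (sval b) y.1 y.2) /
  infprod (Cmp (sval a) (sval b))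
          (Gamma_den_factor (sval a) (sval b) y.1 y.2).

Definition egamma_factor z tau sigma (jk : nat * nat) : C :=
  (1 - e2pi (jk.1.+1%:R * tau + jk.2.+1%:R * sigma - z)) /
  (1 - e2pi (jk.1%:R * tau + jk.2%:R * sigma + z)).

Definition egamma_pos z tau sigma : C :=
  infprod [set: nat * nat] (egamma_factor z tau sigma).

Definition egamma z tau sigma : C :=
  if 0 < complex.Im tau then
    if 0 < complex.Im sigma then egamma_pos z tau sigma
    else (egamma_pos (z - sigma) tau (- sigma))^-1
  else
    if 0 < complex.Im sigma then (egamma_pos (z - tau) (- tau) sigma)^-1
    else egamma_pos (z - tau - sigma) (- tau) (- sigma).

Definition theta0_factor z tau (j : nat) : C :=
  (1 - e2pi (j.+1%:R * tau - z)) * (1 - e2pi (j%:R * tau + z)).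

Definition theta0 z tau : C := infprod [set: nat] (theta0_factor z tau).

(* The product over 0 <= j < m, read as the quotient of the product over
   -N <= j < m by the product over -N <= j < 0 when m < 0. *)
Definition prodz (m : int) (F : int -> C) : C :=
  match m with
  | Posz n => \prod_(j < n) F j%:Z
  | Negz n => (\prod_(j < n.+1) F (- (j.+1)%:Z))^-1
  end.

Definition Delta_dual (f : Lprim -> 'M[int]_3) (a : Lprim) (mu : 'rV[int]_3)
    (y : C * 'cV[C]_3) : C :=
  let al1 := evZ (row 0 (f a)) y.2 in
  let al2 := evZ (row 1 (f a)) y.2 in
  let al3 := evZ (row 2 (f a)) y.2 in
  prodz (ev mu (sval a))
    (fun j => theta0 ((y.1 + j%:~R * al1) / al3) (al2 / al3)).

Definition Delta (f : Lprim -> 'M[int]_3) (a : Lprim) (g : ISL3) :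
    C * 'cV[C]_3 -> C :=
  Delta_dual f a (tra g *m invmx (lin g)).

End Functions.

Section DoubleComplex.
Context {R : realType}.
Local Notation C := R[i].

(* Y is the total space C x C^3; X is the quotient of Xcone by C^x. Since
   Xcone -> X is a principal C^x-bundle, an open subset of X is the same as an
   open C^x-invariant subset of Xcone, and a holomorphic (meromorphic) function
   on it is the same as a C^x-invariant one on its preimage. Subsets of X and
   functions on them are represented in this way. *)
Local Notation Y := (R[i] * 'cV[R[i]]_3)%type.

Definition Xcone : set Y :=
  [set y | ~ exists (l : C) (r : 'cV[R]_3),
             y.2 = l *: map_mx (real_complex R) r].

Definition V (a : Lprim) : set Y := [set y | Xcone y /\ Uplus (sval a) y.2].

Definition act_pt (g : ISL3) (y : Y) : Y :=
  (y.1 - evZ (tra g) y.2, map_mx intr (lin g) *m y.2).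

Lemma act_pt1 (y : Y) : act_pt 1%g y = y.
Proof.
case: y => w x; rewrite /act_pt /evZ /ev /tra /lin /=.
by rewrite map_mx0 mul0mx mxE subr0 map_mx1 mul1mx.
Qed.

Lemma act_ptM (g h : ISL3) (y : Y) :
  act_pt (g * h)%g y = act_pt g (act_pt h y).
Proof.
case: y => w x; rewrite /act_pt /evZ /ev /=; congr (_, _).
  rewrite {1}/tra /= map_mxD map_mxM mulmxDl mxE opprD addrA mulmxA.
  by rewrite addrAC.
by rewrite {1}/lin /= map_mxM mulmxA.
Qed.

Definition invariant_on (W : set Y) (F : Y -> C) : Prop :=
  forall (l : C) (y : Y), l != 0 -> W y -> F (l * y.1, l *: y.2) = F y.

(* Differentiability is over the field C. *)
Definition holomorphic_on (W : set Y) (F : Y -> C) : Prop :=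
  forall y : Y, W y -> differentiable F y.

Definition nowhere_null_on (W : set Y) (F : Y -> C) : Prop :=
  forall O : set Y, open O -> O `<=` W -> O !=set0 ->
    exists2 y, O y & F y != 0.

(* Sections of O^x. *)
Definition Ox (W : set Y) (F : Y -> C) : Prop :=
  [/\ invariant_on W F, holomorphic_on W F & forall y, W y -> F y != 0].

(* Sections of M^x: locally quotients of holomorphic functions which do not
   vanish identically on any nonempty open set. F is total; its values at
   zeros of the denominator are unconstrained. *)
Definition Mx (W : set Y) (F : Y -> C) : Prop :=
  invariant_on W F /\
  forall y, W y -> exists O (P Q : Y -> C),
    [/\ open O, O y, O `<=` W, holomorphic_on O P & holomorphic_on O Q] /\
    [/\ nowhere_null_on O P, nowhere_null_on O Q
      & forall y', O y' -> Q y' != 0 -> F y' = P y' / Q y'].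

(* Equality of meromorphic functions on W: equality on a dense open subset. *)
Definition meq (W : set Y) (F F' : Y -> C) : Prop :=
  forall O : set Y, open O -> O `<=` W -> O !=set0 ->
    exists O' : set Y, [/\ open O', O' `<=` O, O' !=set0
      & forall y, O' y -> F y = F' y].

(* C^p(G, Cech^q) before requiring the values to be sections of a sheaf,
   written multiplicatively. *)
Definition cochain (p q : nat) :=
  p.-tuple ISL3 -> q.+1.-tuple Lprim -> Y -> C.

Definition Vs q (aa : q.+1.-tuple Lprim) : set Y :=
  [set y | forall i, V (tnth aa i) y].

Definition sgnpow (n : nat) (z : C) : C := if odd n then z^-1 else z.

Definition merge_at p (j : 'I_p) (gg : p.+1.-tuple ISL3) : p.-tuple ISL3 :=
  [tuple if (i < j)%N then tnth gg (widen_ord (leqnSn p) i)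
         else if i == j
         then (tnth gg (widen_ord (leqnSn p) i) * tnth gg (lift ord0 i))%g
         else tnth gg (lift ord0 i) | i < p].

Definition group_cob p q (c : cochain p q) : cochain p.+1 q :=
  fun gg aa y =>
    let g1 := thead gg in
    sgnpow p.+1 (c (behead_tuple gg) (map_tuple (act_prim g1^-1%g) aa)
                   (act_pt g1^-1%g y))
    * \prod_(j < p) sgnpow (p - j) (c (merge_at j gg) aa y)
    * c [tuple tnth gg (widen_ord (leqnSn p) i) | i < p] aa y.

Definition cech_cob p q (c : cochain p q) : cochain p q.+1 :=
  fun gg aa y =>
    \prod_(i < q.+2) sgnpow i (c gg [tuple tnth aa (lift i j) | j < q.+1] y).

Definition total_cochain := forall p q, cochain p q.

Definition one_cochain p q : cochain p q := fun _ _ _ => 1.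

Definition Dtot (c : total_cochain) : total_cochain := fun p q gg aa y =>
  match p return cochain p q with
  | 0 => @one_cochain 0 q
  | p'.+1 => group_cob (c p' q)
  end gg aa y *
  sgnpow p
    (match q return cochain p q with
     | 0 => @one_cochain p 0
     | q'.+1 => cech_cob (c p q')
     end gg aa y).

(* c lies in C^n_G(U, F). *)
Definition in_degree (n : nat) (F : set Y -> (Y -> C) -> Prop) (c : total_cochain) :
    Prop :=
  forall p q, if (p + q == n)%N then forall gg aa, F (Vs aa) (c p q gg aa)
              else c p q = @one_cochain p q.

Definition eqO (c c' : total_cochain) : Prop :=
  forall p q gg aa y, Vs aa y -> c p q gg aa y = c' p q gg aa y.

Definition eqM (c c' : total_cochain) : Prop :=
  forall p q gg aa, meq (Vs aa) (c p q gg aa) (c' p q gg aa).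

Definition pair_cochain (Ga : Lprim -> Lprim -> Y -> C)
    (De : Lprim -> ISL3 -> Y -> C) : total_cochain := fun p q =>
  match p, q return cochain p q with
  | 0, 1 => fun _ aa => Ga (tnth aa 0) (tnth aa 1)
  | 1, 0 => fun gg aa => De (thead aa) (thead gg)
  | p', q' => @one_cochain p' q'
  end.

(* phi is a 2-cocycle defining an equivariant holomorphic gerbe. *)
Definition gerbe_cocycle (phi : total_cochain) : Prop :=
  in_degree 2 Ox phi /\ eqO (Dtot phi) one_cochain.

(* s is a meromorphic section of the gerbe defined by phi. *)
Definition gerbe_section (phi s : total_cochain) : Prop :=
  in_degree 1 Mx s /\ eqM (Dtot s) phi.

End DoubleComplex.

Arguments total_cochain R : clear implicits.

(* Main.v *)
(* All zeros and poles of Gamma_{a,b} and Delta_a lie on the hyperplanes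
   H_delta = {w = delta(x)}, for delta in the dual lattice. With pos_a(delta) = 1
   if delta(a) > 0 and 0 otherwise, the order of Gamma_{a,b} along H_delta is
   pos_a(delta) - pos_b(delta): each class of C_{+-}/Z gamma contributes one
   factor, whose simple zeros are exactly the H_delta with delta in that class.
   The zeros of theta_0 telescope in the same way, so that the order of
   Delta_a(g; -) is pos_{g^-1 a}(delta o g) - pos_a(delta), where delta o g is the
   pullback of H_delta under g. Hence the divisor of (Gamma, Delta) is the
   coboundary of a 0-cochain with values in divisors, and all components of Ds
   have divisor zero. They therefore extend to nowhere vanishing holomorphic
   functions phi, and D phi = 1 holds because D(Ds) = 1 holds off the hyperplanes
   and both sides are continuous.

   An infinite product is holomorphic because its factors satisfy summable
   pointwise Lipschitz bounds, and the partial products then converge in the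
   corresponding norm, in which differentiable maps are closed. *)

Require Import Defs.
From HB Require Import structures.
From mathcomp Require Import all_boot all_order all_algebra.
From mathcomp Require Import complex finmap.
From mathcomp Require Import all_classical all_reals all_analysis.
From mathcomp.analysis.showcase Require summability.
From mathcomp Require Import ring lra zify.
Set Implicit Arguments.
Unset Strict Implicit.
Unset Printing Implicit Defensive.
Import Order.TTheory GRing.Theory Num.Theory.
Import numFieldNormedType.Exports.
Local Open Scope classical_set_scope.
Local Open Scope ring_scope.

(* [Gamma] and [Delta] are total functions, and where a denominator vanishes the convention
   [x / 0 = 0] makes their values meaningless. Multiplicative identities between them may therefore
   fail pointwise on their zeros and poles. This dictates the two notions on which the argument
   rests: [gnear], validity near a point off finitely many hyperplanes, and [hasdiv], generic
   equality with a unit times integral powers of the forms [hyp d]. The divisor is thus part of a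
   local factorization; when all exponents are zero, the factorization itself displays the
   extension, whose value is forced because complements of finitely many hyperplanes are dense.

   The geometry reduces to signs. The cross product of an oriented basis of H(a) is a positive
   multiple of a, hence x lies in U_a^+ exactly when det(a, Im x, Re x) > 0. This makes V_a open and
   equivariant, shows that gamma(x) is nonzero on V_a, and bounds the exponentials governing the
   products by 1 in modulus, so that each product is dominated by a geometric series in one or two
   variables. *)
#[local] Existing Instance summability.totally_filter.

(** * Real-valued norms and complex limits *)

Section ComplexNorm.
Context {R : realType}.
Local Notation C := R[i].

(** The norm of a normed module over C takes values in C, where the order is partial. Its real part
    lives in a totally ordered field, where [lra] applies. *)
Definition nrm (V : normedModType C) (h : V) : R := complex.Re `|h|.

Section NormedModule.
Context {V : normedModType C}.
Implicit Types h k : V.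

Lemma nrmE h : `|h| = (nrm h)%:C%C.
Proof. by rewrite /nrm RRe_real. Qed.

Lemma nrm_ge0 h : 0 <= nrm h.
Proof. by rewrite -ler0c -nrmE. Qed.

Lemma nrm0 : nrm (0 : V) = 0.
Proof. by rewrite /nrm normr0. Qed.

Lemma nrm_le_add h k : nrm (h + k) <= nrm h + nrm k.
Proof. by rewrite -lecR rmorphD /= -!nrmE ler_normD. Qed.

Lemma nrmN h : nrm (- h) = nrm h.
Proof. by rewrite /nrm normrN. Qed.

Lemma nrmBC h k : nrm (h - k) = nrm (k - h).
Proof. by rewrite -nrmN opprB. Qed.

Lemma nrm_le_sub h k : nrm (h - k) <= nrm h + nrm k.
Proof. by rewrite -(nrmN k) nrm_le_add. Qed.

Lemma nrm_eq0 h : (nrm h == 0) = (h == 0).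
Proof. by rewrite -[RHS]normr_eq0 nrmE eq_complex /= eqxx andbT. Qed.

Lemma nrm_gt0 h : (0 < nrm h) = (h != 0).
Proof. by rewrite lt_def nrm_ge0 andbT nrm_eq0. Qed.

Lemma nrmZ (z : C) h : nrm (z *: h) = nrm z * nrm h.
Proof.
apply: complexI; rewrite rmorphM /= -[LHS]nrmE normrZ.
by rewrite (nrmE h); congr (_ * _); rewrite /nrm RRe_real.
Qed.

Lemma nrm_dist_triangle h k l : nrm (h - l) <= nrm (h - k) + nrm (k - l).
Proof. by rewrite -{1}(subrK k h) -addrA nrm_le_add. Qed.

End NormedModule.

Lemma nrmM (z w : C) : nrm (z * w) = nrm z * nrm w.
Proof. by apply: complexI; rewrite rmorphM /= -!nrmE normrM. Qed.

Lemma nrm_leD (z w : C) : nrm (z + w) <= nrm z + nrm w.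
Proof. exact: nrm_le_add. Qed.

Lemma nrm_leB (z w : C) : nrm (z - w) <= nrm z + nrm w.
Proof. exact: nrm_le_sub. Qed.

Lemma nrm_subC (z w : C) : nrm (z - w) = nrm (w - z).
Proof. exact: nrmBC. Qed.

Lemma nrm1 : nrm (1 : C) = 1.
Proof. by rewrite /nrm normr1. Qed.

Lemma nrmX (z : C) n : nrm (z ^+ n) = nrm z ^+ n.
Proof. by elim: n => [|n IH]; rewrite ?expr0 ?nrm1 // !exprS nrmM IH. Qed.

Lemma nrm_real (r : R) : nrm r%:C%C = `|r|.
Proof. by rewrite /nrm normc_def /= expr0n /= addr0 sqrtr_sqr. Qed.

Lemma nrm_sqr (z : C) : nrm z ^+ 2 = complex.Re z ^+ 2 + complex.Im z ^+ 2.
Proof. by rewrite /nrm normc_def /= sqr_sqrtr // addr_ge0 ?sqr_ge0. Qed.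

Lemma Re_le_nrm (z : C) : `|complex.Re z| <= nrm z.
Proof. by rewrite -lecR -nrmE normc_ge_Re. Qed.

Lemma Im_le_nrm (z : C) : `|complex.Im z| <= nrm z.
Proof.
by rewrite -(ler_pXn2r (n := 2)) ?nnegrE ?nrm_ge0 // nrm_sqr real_normK ?num_real //
  lerDr sqr_ge0.
Qed.

Lemma nrm_le_ReIm (z : C) : nrm z <= `|complex.Re z| + `|complex.Im z|.
Proof.
rewrite -(ler_pXn2r (n := 2)) ?nnegrE ?nrm_ge0 ?addr_ge0 // nrm_sqr sqrrD.
rewrite !real_normK ?num_real // -subr_ge0.
by have -> : forall a b c : R, a + c + b - (a + b) = c by move=> *; ring.
Qed.

Lemma nbhs_nrmP (V : normedModType C) (y : V) (P : set V) :
  nbhs y P <-> exists2 e : R, 0 < e & forall h, nrm h <= e -> P (y + h).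
Proof.
split.
  move=> /nbhs_normP [e /= e0 sub]; exists (complex.Re e / 2).
    by move: e0; rewrite ltcE /= => /andP[_ ?]; rewrite divr_gt0.
  move=> h hle; apply: sub => /=; rewrite opprD addNKr normrN nrmE.
  move: e0; rewrite !ltcE /= => /andP[/eqP -> e0]; rewrite eqxx /=.
  by apply: (le_lt_trans hle); lra.
move=> [e e0 sub]; apply/nbhs_normP; exists (e%:C)%C => /=; first by rewrite ltcR.
move=> z /=; rewrite distrC nrmE ltcR => /ltW /sub.
by rewrite addrC subrK.
Qed.

Lemma cvg_nrmP (V : normedModType C) T (F : set_system T) (FF : Filter F)
    (f : T -> V) (l : V) :
  f @ F --> l <-> forall e : R, 0 < e -> F [set t | nrm (f t - l) <= e].
Proof.
split=> [/cvgrPdistC_le H e e0|H].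
  have /H : 0 < e%:C%C :> C by rewrite ltcR.
  by apply: filterS => t /=; rewrite nrmE lecR.
apply/cvgrPdistC_le => e e0.
have Re0 : 0 < complex.Re e by move: e0; rewrite ltcE => /andP[].
have e_real : e = (complex.Re e)%:C%C.
  by apply/eqP; rewrite eq_complex /= eqxx /=; move: e0; rewrite ltcE => /andP[].
apply: filterS (H _ Re0) => t /=.
by rewrite e_real nrmE lecR.
Qed.

(** Real and imaginary part are 1-Lipschitz, so each inherits the Cauchy condition and converges in
    the complete space R. *)
Lemma complex_cauchy_cvg T (F : set_system T) (FF : ProperFilter F) (f : T -> C) :
  (forall e : R, 0 < e -> exists z : C, F [set t | nrm (f t - z) <= e]) ->
  cvg (f @ F).
Proof.
move=> H.
have part (g : C -> R) : (forall z w, `|g z - g w| <= nrm (z - w)) -> cvg ((g \o f) @ F).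
  move=> g_lip; apply/cauchy_cvgP/cauchy_exP => e e0.
  have [|z Fz] := H (e / 2); first by rewrite divr_gt0.
  exists (g z); suff : F [set t | ball (g z) e (g (f t))] by [].
  apply: filterS Fz => t /= tz.
  rewrite -ball_normE /= distrC; apply: (le_lt_trans (g_lip (f t) z)).
  by apply: (le_lt_trans tz); lra.
have /cvg_ex[a Ha] : cvg ((@complex.Re R \o f) @ F).
  apply: part => z w; rewrite (_ : _ - _ = complex.Re (z - w)) ?Re_le_nrm //.
  by case: z w => ? ? [].
have /cvg_ex[b Hb] : cvg ((@complex.Im R \o f) @ F).
  apply: part => z w; rewrite (_ : _ - _ = complex.Im (z - w)) ?Im_le_nrm //.
  by case: z w => ? ? [].
apply/cvg_ex; exists (Complex a b); apply/cvg_nrmP => e e0.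
have e20 : 0 < e / 2 by rewrite divr_gt0.
move/cvgrPdistC_le: Ha => /(_ _ e20) Ha; move/cvgrPdistC_le: Hb => /(_ _ e20) Hb.
apply: filterS2 Ha Hb => t /= at_ bt.
apply: le_trans (nrm_le_ReIm _) _; rewrite [leRHS]splitr lerD //.
  by move: at_; case: (f t).
by move: bt; case: (f t).
Qed.

End ComplexNorm.

(** * Pointwise Lipschitz limits of differentiable maps *)

Section Differentiability.
Context {R : realType}.
Local Notation C := R[i].
Context {V : normedModType C}.
Implicit Types (f g : V -> C) (y h : V).

(** Differentiability at one point as explicit estimates. The Lipschitz bound stands in for
    continuity of [L], which linearity alone does not give on a general normed module. *)
Lemma nrm_differentiableP f y :
  differentiable f y <->
  exists L : V -> C, [/\ linear L, exists K : R, forall h, nrm (L h) <= K * nrm h &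
    forall eta : R, 0 < eta -> exists2 e : R, 0 < e &
      forall h, nrm h <= e -> nrm (f (y + h) - f y - L h) <= eta * nrm h].
Proof.
split.
  move=> df; exists ('d f y); split; first exact: linearP.
    have [k k0 kP] := linear_lipschitz (diff_continuous df).
    exists (complex.Re k) => h; have := kP h; rewrite (nrmE h) (nrmE (_ : C)).
    by move: k0 {kP} => /gtr0_real/RRe_real <-; rewrite -rmorphM lecR.
  move=> eta eta0; move/diff_locally: df => /eqaddoP /(_ (eta%:C)%C).
  rewrite ltcR => /(_ eta0) /nbhs_nrmP [e e0 He]; exists e => // h /He /=.
  rewrite add0r (nrmE h) (nrmE (_ : C)) -rmorphM lecR !fctE /= /shift.
  by rewrite [h + y]addrC opprD addrA.
move=> [L [linL [K KP] LP]].
pose lin_mixin := GRing.isLinear.Build C V C _ L linL.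
pose L' : {linear V -> C} := HB.pack L lin_mixin.
have L'c : continuous L'.
  move=> x; apply/cvg_nrmP => e e0; apply/nbhs_nrmP.
  have K0 : 0 < 1 + `|K| by rewrite ltr_pwDl.
  exists (e / (1 + `|K|)); first by rewrite divr_gt0.
  move=> h hle /=; rewrite -[L _ - L _]/(L' (x + h) - L' x) raddfD addrAC subrr add0r.
  apply: (le_trans (KP h)); apply: (@le_trans _ _ ((1 + `|K|) * nrm h)).
    rewrite ler_wpM2r ?nrm_ge0 // (le_trans (ler_norm K)) //; lra.
  by rewrite -ler_pdivlMl // mulrC.
have fL : f \o shift y = cst (f y) + L' +o_ 0 id.
  apply/eqaddoP => eta eta0.
  have Re0 : 0 < complex.Re eta by move: eta0; rewrite ltcE => /andP[].
  have [e e0 He] := LP _ Re0; apply/nbhs_nrmP; exists e => // h /He /=.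
  rewrite add0r (nrmE h) (nrmE (_ : C)) -(RRe_real (gtr0_real eta0)).
  by rewrite -rmorphM lecR !fctE /= /shift [h + y]addrC opprD addrA.
have dE := diff_unique L'c fL.
apply/diff_locallyP; split; first by rewrite dE.
by rewrite dE.
Qed.

(* A bounded set of linear maps is complete, so approximation in the pointwise
   Lipschitz sense at [y] preserves differentiability at [y]. *)
Lemma differentiable_approx f y (e : R) : 0 < e ->
  (forall eta : R, 0 < eta -> exists2 g, differentiable g y &
     forall h, nrm h <= e -> nrm (f (y + h) - f y - (g (y + h) - g y)) <= eta * nrm h) ->
  differentiable f y.
Proof.
move=> e0 approx.
have eta_gt0 n : 0 < n.+1%:R^-1 :> R by rewrite invr_gt0.
have [g gP] : {g : nat -> V -> C & forall n, differentiable (g n) y /\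
    forall h, nrm h <= e ->
      nrm (f (y + h) - f y - (g n (y + h) - g n y)) <= n.+1%:R^-1 * nrm h}.
  apply: (@choice _ _ (fun n gn => differentiable gn y /\ forall h, nrm h <= e ->
      nrm (f (y + h) - f y - (gn (y + h) - gn y)) <= n.+1%:R^-1 * nrm h)) => n.
  by have [gn ? ?] := approx _ (eta_gt0 n); exists gn.
have [L LP] := @choice _ _ (fun n L => [/\ linear L,
    exists K : R, forall h, nrm (L h) <= K * nrm h &
    forall eta : R, 0 < eta -> exists2 e : R, 0 < e &
      forall h, nrm h <= e -> nrm (g n (y + h) - g n y - L h) <= eta * nrm h])
    (fun n => (nrm_differentiableP (g n) y).1 (gP n).1).
have linB n : linear (L n) by have [] := LP n.
have L00 n : L n 0 = 0.
  by apply: (addrI (L n 0)); have := linB n 1 0 0; rewrite !scale1r !addr0.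
have LZ n t h : L n (t *: h) = t *: L n h.
  by have := linB n t h 0; rewrite L00 !addr0.
(* Both derivatives approximate the increment of [f] on a small ball; by homogeneity the estimate
   there holds for every [h]. *)
have LLle n m h : nrm (L n h - L m h) <= 2 * (n.+1%:R^-1 + m.+1%:R^-1) * nrm h.
  have [_ _ /(_ _ (eta_gt0 n)) [d1 d10 d1P]] := LP n.
  have [_ _ /(_ _ (eta_gt0 m)) [d2 d20 d2P]] := LP m.
  pose d := Num.min e (Num.min d1 d2).
  have d0 : 0 < d by rewrite !lt_min e0 d10.
  have local k : nrm k <= d ->
      nrm (L n k - L m k) <= 2 * (n.+1%:R^-1 + m.+1%:R^-1) * nrm k.
    rewrite !le_min => /and3P[ke k1 k2].
    have -> : L n k - L m k =
        (g m (y + k) - g m y - L m k) - (g n (y + k) - g n y - L n k)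
        + ((f (y + k) - f y - (g m (y + k) - g m y))
           - (f (y + k) - f y - (g n (y + k) - g n y))) by ring.
    apply: le_trans (nrm_leD _ _) _.
    have := nrm_leB (g m (y + k) - g m y - L m k) (g n (y + k) - g n y - L n k).
    have := nrm_leB (f (y + k) - f y - (g m (y + k) - g m y))
                      (f (y + k) - f y - (g n (y + k) - g n y)).
    have := d1P _ k1; have := d2P _ k2; have := (gP n).2 _ ke; have := (gP m).2 _ ke.
    move: (n.+1%:R^-1) (m.+1%:R^-1) => a b.
    by lra.
  have [->|h0] := eqVneq h 0.
    have -> : (0 : V) = 0 *: 0 by rewrite scale0r.
    by rewrite !LZ !scale0r subrr !nrm0 mulr0.
  have nh0 : 0 < nrm h by rewrite nrm_gt0.
  pose t : C := ((d / nrm h)%:C)%C.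
  have nt : nrm t = d / nrm h by rewrite nrm_real ger0_norm // ltW // divr_gt0.
  have := local (t *: h); rewrite nrmZ nt divfK ?gt_eqF // => /(_ (lexx _)).
  rewrite !LZ -scalerBr nrmZ nt mulrC -ler_pdivlMr ?divr_gt0 //.
  move=> /le_trans; apply; rewrite le_eqVlt; apply/orP; left; apply/eqP.
  by field; rewrite !gt_eqF.
have small (r : R) : 0 < r -> exists n, n.+1%:R^-1 <= r.
  move=> r0; have [n] := ltr_add_invr r0.
  by rewrite add0r => /ltW ?; exists n.
have inv_mono n m : (n <= m)%N -> m.+1%:R^-1 <= n.+1%:R^-1 :> R.
  by move=> nm; rewrite lef_pV2 ?posrE // ler_nat ltnS.
have cvgL h : cvg (L n h @[n --> \oo]).
  apply: complex_cauchy_cvg => r r0.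
  have [|n nP] := small (r / (4 * (nrm h + 1))).
    by rewrite divr_gt0 // mulr_gt0 // ltr_wpDl ?nrm_ge0.
  have nh := nrm_ge0 h.
  exists (L n h); exists n => // m /= nm.
  apply: (le_trans (LLle _ _ _)).
  apply: (@le_trans _ _ (4 * (r / (4 * (nrm h + 1))) * (nrm h + 1))).
    have := inv_mono _ _ nm; have := eta_gt0 m.
    move: nP; move: (n.+1%:R^-1) (m.+1%:R^-1) (r / _) => a b c nP b0 ba.
    apply: (@le_trans _ _ (4 * c * nrm h)); first by rewrite ler_wpM2r //; lra.
    by rewrite ler_wpM2l ?lerDl //; lra.
  rewrite le_eqVlt; apply/orP; left; apply/eqP; field.
  by rewrite gt_eqF // ltr_wpDl ?nrm_ge0.
pose L0 h := lim (L n h @[n --> \oo]).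
have L0P h r : 0 < r -> \forall n \near \oo, nrm (L n h - L0 h) <= r.
  by move=> r0; move: r r0; apply/cvg_nrmP; exact: cvgL.
(* The constant 3 is 1/2 for passing from [L0] to [L m], plus 2 * (1 + 1/4) from [LLle] with [m] so
   large that its term is at most a quarter of that of [n]. *)
have L0le n h : nrm (L0 h - L n h) <= 3 * n.+1%:R^-1 * nrm h.
  have [->|h0] := eqVneq h 0.
    rewrite /L0 L00 (_ : (fun m => L m 0) = cst 0) ?lim_cst //; last exact/funext.
    by rewrite subrr !nrm0 mulr0.
  have nh0 : 0 < nrm h by rewrite nrm_gt0.
  have r0 : 0 < 2^-1 * n.+1%:R^-1 * nrm h by rewrite !mulr_gt0.
  have [N _ NP] := L0P h _ r0.
  have [|m1 m1P] := small (4^-1 * n.+1%:R^-1); first by rewrite mulr_gt0.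
  pose m := maxn N m1.
  have := NP m (leq_maxl _ _); rewrite /= nrmBC => H1.
  have H2 := LLle m n h.
  apply: (le_trans (nrm_dist_triangle _ (L m h) _)).
  have := inv_mono _ _ (leq_maxr N m1); rewrite -/m => H3.
  have H4 : m.+1%:R^-1 * nrm h <= 4^-1 * n.+1%:R^-1 * nrm h.
    by rewrite ler_wpM2r ?nrm_ge0 // (le_trans H3).
  move: H1 H2 H3 H4; move: (n.+1%:R^-1) (m.+1%:R^-1) => a b *.
  by lra.
apply/nrm_differentiableP; exists L0; split.
- move=> a u v; apply/eqP; rewrite -subr_eq0 -nrm_eq0 eq_le nrm_ge0 andbT.
  apply/ler_addgt0Pl => r r0; rewrite addr0.
  pose M := 1 + nrm a.
  have M0 : 0 < M by rewrite ltr_pwDl // nrm_ge0.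
  have r3 : 0 < r / 3 / M by rewrite !divr_gt0.
  have [n [[nu nv] nuv]] : exists n, (nrm (L n u - L0 u) <= r / 3 / M /\
      nrm (L n v - L0 v) <= r / 3 / M) /\ nrm (L n (a *: u + v) - L0 (a *: u + v)) <= r / 3 / M.
    have [N1 _ N1P] := L0P u _ r3; have [N2 _ N2P] := L0P v _ r3.
    have [N3 _ N3P] := L0P (a *: u + v) _ r3.
    exists (maxn N1 (maxn N2 N3)); split; [split|].
    + by apply: N1P; rewrite /= leq_maxl.
    + by apply: N2P; rewrite /= leq_max leq_maxl orbT.
    + by apply: N3P; rewrite /= !leq_max leqnn !orbT.
  have -> : L0 (a *: u + v) - (a *: L0 u + L0 v) =
      a * (L n u - L0 u) + (L n v - L0 v) - (L n (a *: u + v) - L0 (a *: u + v)).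
    by rewrite linB -[a *: L0 u]/(a * L0 u) -[a *: L n u]/(a * L n u); ring.
  apply: (le_trans (nrm_leB _ _)).
  have := nrm_leD (a * (L n u - L0 u)) (L n v - L0 v); rewrite nrmM => H.
  have rM : r / 3 / M * M = r / 3 by rewrite divfK // gt_eqF.
  have na := nrm_ge0 a.
  have H5 : nrm a * nrm (L n u - L0 u) <= nrm a * (r / 3 / M) by rewrite ler_wpM2l.
  have H6 : r / 3 / M <= r / 3 by rewrite -[leRHS]rM /M; nra.
  by move: rM H5; rewrite /M => *; nra.
- have [_ [K KP] _] := LP 0%N; exists (K + 3) => h.
  rewrite -(subrK (L 0%N h) (L0 h)); apply: (le_trans (nrm_leD _ _)).
  by have := KP h; have := L0le 0%N h; rewrite invr1; lra.
- move=> eta eta0.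
  (* In units of [n.+1%:R^-1 * nrm h] the errors are 1 for replacing [f] by [g n], 1 for the
     differentiability of [g n], and 3 for replacing [L n] by [L0]. *)
  have [|n nP] := small (eta / 5); first by rewrite divr_gt0.
  have [_ _ /(_ _ (eta_gt0 n)) [d d0 dP]] := LP n.
  exists (Num.min e d); first by rewrite lt_min e0.
  move=> h; rewrite le_min => /andP[he hd].
  have -> : f (y + h) - f y - L0 h = (f (y + h) - f y - (g n (y + h) - g n y))
     + (g n (y + h) - g n y - L n h) - (L0 h - L n h) by ring.
  apply: (le_trans (nrm_leB _ _)).
  have := nrm_leD (f (y + h) - f y - (g n (y + h) - g n y)) (g n (y + h) - g n y - L n h).
  have := (gP n).2 _ he; have := dP _ hd; have := L0le n h.
  have : n.+1%:R^-1 * nrm h <= eta / 5 * nrm h by rewrite ler_wpM2r ?nrm_ge0.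
  by move: (n.+1%:R^-1) => a *; lra.
Qed.

End Differentiability.

(** * The pointwise Lipschitz norm *)

Section PointwiseLipschitz.
Context {R : realType}.
Local Notation C := R[i].
Context {V : normedModType C} (y : V) (e : R) (e_gt0 : 0 < e).
Implicit Types (f g : V -> C) (h : V) (M N : R).

(* [lipn f M] says that |f y| + e Lip_y(f) <= M, where Lip_y is the pointwise
   Lipschitz constant at [y] on the ball of radius [e]; the left-hand side is a
   submultiplicative norm. *)
Definition lipn f M :=
  nrm (f y) <= M /\ forall h, nrm h <= e -> e * nrm (f (y + h) - f y) <= (M - nrm (f y)) * nrm h.

Lemma lipn_ge0 f M : lipn f M -> 0 <= M.
Proof. by move=> [fM _]; apply: le_trans fM; apply: nrm_ge0. Qed.

Lemma lipn_bound f M h : lipn f M -> nrm h <= e -> nrm (f (y + h)) <= M.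
Proof.
move=> [fM fL] he; rewrite -(ler_pM2l e_gt0).
have H1 : nrm (f (y + h)) <= nrm (f (y + h) - f y) + nrm (f y).
  by rewrite -{1}(subrK (f y) (f (y + h))) nrm_leD.
have H2 := fL _ he; have nh := nrm_ge0 h; have e0 := e_gt0.
have : (M - nrm (f y)) * nrm h <= (M - nrm (f y)) * e by rewrite ler_wpM2l // subr_ge0.
have : e * nrm (f (y + h)) <= e * (nrm (f (y + h) - f y) + nrm (f y)) by rewrite ler_wpM2l // ltW.
by lra.
Qed.

Lemma lipn_mono f M N : M <= N -> lipn f M -> lipn f N.
Proof.
move=> MN [fM fL]; split; first exact: le_trans MN.
move=> h he; apply: le_trans (fL h he) _.
by rewrite ler_wpM2r ?nrm_ge0 // lerB.
Qed.

Lemma lipn_cst c : lipn (cst c) (nrm c).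
Proof. by split=> // h _; rewrite /= !subrr nrm0 mulr0 mul0r. Qed.

Lemma lipnD f g M N : lipn f M -> lipn g N -> lipn (fun z => f z + g z) (M + N).
Proof.
move=> [fM fL] [gM gL].
split; first by apply: le_trans (nrm_leD _ _) _; rewrite lerD.
move=> h he; have -> : f (y + h) + g (y + h) - (f y + g y) =
  (f (y + h) - f y) + (g (y + h) - g y) by ring.
have nh := nrm_ge0 h.
have : e * nrm (f (y + h) - f y + (g (y + h) - g y)) <=
    e * (nrm (f (y + h) - f y) + nrm (g (y + h) - g y)).
  by rewrite ler_wpM2l ?nrm_leD // ltW.
have : nrm (f y + g y) * nrm h <= (nrm (f y) + nrm (g y)) * nrm h.
  by rewrite ler_wpM2r ?nrm_leD.
have := fL h he; have := gL h he.
by clear fM gM; lra.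
Qed.

Lemma lipnN f M : lipn f M -> lipn (fun z => - f z) M.
Proof.
move=> [fM fL]; split; first by rewrite -mulN1r nrmM nrmN nrm1 mul1r.
move=> h he; have -> : - f (y + h) - - f y = -1 * (f (y + h) - f y) by ring.
have -> : nrm (- f y) = nrm (f y) by exact: nrmN.
by rewrite nrmM nrmN nrm1 mul1r fL.
Qed.

(** The product of the two increments is quadratic in [h]. Since [nrm h <= e], one factor [nrm h] is
    absorbed by [e], and the bounds multiply with constant 1. *)
Lemma lipnM f g M N : lipn f M -> lipn g N -> lipn (fun z => f z * g z) (M * N).
Proof.
move=> [fM fL] [gM gL].
have f0 := nrm_ge0 (f y); have g0 := nrm_ge0 (g y).
split; first by rewrite nrmM ler_pM.
move=> h he; have -> : f (y + h) * g (y + h) - f y * g y =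
  f y * (g (y + h) - g y) + (g y * (f (y + h) - f y)
  + (f (y + h) - f y) * (g (y + h) - g y)) by ring.
have nh := nrm_ge0 h.
have H1 := nrm_leD (f y * (g (y + h) - g y)) (g y * (f (y + h) - f y)
  + (f (y + h) - f y) * (g (y + h) - g y)).
have H2 := nrm_leD (g y * (f (y + h) - f y)) ((f (y + h) - f y) * (g (y + h) - g y)).
rewrite nrmM; move: H1 H2; rewrite !nrmM.
move: (fL h he) (gL h he) (nrm_ge0 (f (y + h) - f y)) (nrm_ge0 (g (y + h) - g y)).
move: fM gM f0 g0 nh he e_gt0.
move: (nrm (f y)) (nrm (g y)) (nrm h) (nrm (f (y + h) - f y)) (nrm (g (y + h) - g y)).
move: (nrm _) (nrm _) => v u a b t p q aM bN a0 b0 t0 te e0 pM qN p0 q0 uv vl.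
have pqe : e * (p * q) <= (M - a) * ((N - b) * t).
  have : (e * p) * (e * q) <= ((M - a) * t) * ((N - b) * t).
    by rewrite ler_pM // mulr_ge0 // ltW.
  have : ((M - a) * (N - b)) * t * t <= ((M - a) * (N - b)) * t * e.
    by rewrite ler_wpM2l // !mulr_ge0 // subr_ge0.
  move=> H1 H2; rewrite -(ler_pM2l e0); lra.
have aq : a * (e * q) <= a * ((N - b) * t) by rewrite ler_wpM2l.
have bp : b * (e * p) <= b * ((M - a) * t) by rewrite ler_wpM2l.
have eu : e * u <= e * (a * q + (b * p + p * q)).
  by rewrite (ler_pM2l e0); lra.
by lra.
Qed.

Lemma lipnX f M n : lipn f M -> lipn (fun z => f z ^+ n) (M ^+ n).
Proof.
move=> fM; elim: n => [|n IH].
  by have := lipn_cst 1; rewrite nrm1.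
rewrite exprS (_ : (fun z => _) = (fun z => f z * f z ^+ n)); first exact: lipnM.
by apply/funext => z; rewrite exprS.
Qed.

(** Each inequality in [lipn] is a closed condition on the values at [y] and [y + h], hence survives
    pointwise limits on the ball. *)
Lemma lipn_lim T (F : set_system T) (FF : ProperFilter F) (G : T -> V -> C) f M :
  (\forall t \near F, lipn (G t) M) ->
  (forall h, nrm h <= e -> G t (y + h) @[t --> F] --> f (y + h)) ->
  lipn f M.
Proof.
move=> GM Gf.
have Gf' h r : nrm h <= e -> 0 < r -> \forall t \near F, nrm (G t (y + h) - f (y + h)) <= r.
  by move=> he r0; move: r r0; apply/cvg_nrmP; exact: Gf.
have e0 := e_gt0.
have close (r : R) h : 0 < r -> nrm h <= e -> exists t, [/\ lipn (G t) M,
    nrm (G t y - f y) <= r & nrm (G t (y + h) - f (y + h)) <= r].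
  move=> r0 he; have := Gf' h r he r0.
  have /(_ r _ r0) := Gf' 0; rewrite nrm0 addr0 => /(_ (ltW e0)) near0 nearh.
  by apply: (@filter_ex _ F FF); apply: filterS3 GM near0 nearh.
split.
  apply/ler_addgt0Pl => r r0.
  have [|t [[tM _] t1 _]] := @close r 0 r0; first by rewrite nrm0 ltW.
  have := nrm_leB (G t y) (G t y - f y).
  by rewrite (_ : _ - (_ - _) = f y); [lra|ring].
move=> h he; apply/ler_addgt0Pl => r r0.
have nh := nrm_ge0 h.
(* Replacing [f] by [G t] costs at most [2 * e * r'] on the left and [r' * nrm h <= e * r'] on the
   right. *)
pose r' := r / (3 * e).
have r'0 : 0 < r' by rewrite divr_gt0 // mulr_gt0.
have [t [[tM tL] t1 t2]] := close _ _ r'0 he.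
have H1 := tL _ he.
have H2 : nrm (f (y + h) - f y) <= nrm (G t (y + h) - G t y) + (r' + r').
  have -> : f (y + h) - f y = (G t (y + h) - G t y)
      - ((G t (y + h) - f (y + h)) - (G t y - f y)) by ring.
  apply: le_trans (nrm_leB _ _) _; rewrite lerD2l.
  by apply: le_trans (nrm_leB _ _) _; rewrite lerD.
have H3 : nrm (f y) <= nrm (G t y) + r'.
  by rewrite -{1}(subKr (G t y) (f y)); apply: le_trans (nrm_leB _ _) _; rewrite lerD2l.
have er : e * r' = r / 3 by rewrite /r'; field; rewrite gt_eqF.
have H4 : e * nrm (f (y + h) - f y) <= e * (nrm (G t (y + h) - G t y) + (r' + r')).
  by rewrite ler_wpM2l // ltW.
have H5 : nrm (f y) * nrm h <= (nrm (G t y) + r') * nrm h by rewrite ler_wpM2r.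
have H6 : r' * nrm h <= r' * e by rewrite ler_wpM2l // ltW.
by lra.
Qed.

End PointwiseLipschitz.

(** The Lipschitz term tends to 0 with the radius, so any number above [nrm (f y)] becomes a bound.
    This keeps the ratio of a geometric series below 1 on a whole ball. *)
Lemma lipn_small (R : realType) (V : normedModType R[i]) (f : V -> R[i]) (y : V) (c : R) :
  differentiable f y -> nrm (f y) < c ->
  exists2 e0 : R, 0 < e0 & forall e, 0 < e -> e <= e0 -> lipn y e f c.
Proof.
move=> /nrm_differentiableP[L [_ [K KP] /(_ 1 ltr01)[d d0 dP]]] fc.
(* [K] bounds the derivative, and the 1 is the error allowed by the choice [eta = 1] above. *)
pose K' := `|K| + 1; have K'0 : 0 < K' by rewrite ltr_wpDl.
exists (Num.min d ((c - nrm (f y)) / K')).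
  by rewrite lt_min d0 divr_gt0 // subr_gt0.
move=> e e0; rewrite le_min ler_pdivlMr // => /andP[ed eK]; split; first exact: ltW.
move=> h he; have := dP h (le_trans he ed).
have : nrm (f (y + h) - f y) <= nrm (f (y + h) - f y - L h) + nrm (L h).
  by rewrite -{1}(subrK (L h) (f (y + h) - f y)) nrm_leD.
have := KP h; have := ler_norm K; have nh := nrm_ge0 h.
rewrite -/K' => K1 Lh H1 H2.
apply: (@le_trans _ _ (e * (K' * nrm h))); last first.
  by rewrite mulrA ler_wpM2r.
rewrite (ler_pM2l e0).
have : K * nrm h <= `|K| * nrm h by rewrite ler_wpM2r.
by rewrite /K'; lra.
Qed.

(** * Unconditional sums and products *)

Section BoundedSums.
Context {R : realType} {I : choiceType}.
Implicit Types (S : set I) (M : I -> R) (A B : {fset I}).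

(** For nonnegative [M] this is unconditional summability, expressed without limits. *)
Definition sumb S M := exists K : R, forall B, \sum_(i <- B | i \in S) M i <= K.

Lemma big_fsetD_split (T : Type) (idx : T) (op : Monoid.com_law idx) A B
    (P : pred I) (F : I -> T) : (A `<=` B)%fset ->
  \big[op/idx]_(i <- B | P i) F i =
  op (\big[op/idx]_(i <- A | P i) F i) (\big[op/idx]_(i <- (B `\` A)%fset | P i) F i).
Proof.
move=> AB; rewrite (big_fsetIDcond op (mem A)); congr (op _ _); apply: eq_fbigl_cond.
  move=> i; rewrite !inE /=; case: (boolP (i \in A)) => [iA|]; last by rewrite andbF.
  by rewrite (fsubsetP AB).
move=> i; rewrite !inE /=.
by congr (_ && _); rewrite andbC.
Qed.

(** Take [A] with partial sum within [eta] of the supremum: indices outside [A] can add at most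
    [eta]. *)
Lemma sumb_tail S M (eta : R) : (forall i, S i -> 0 <= M i) -> sumb S M -> 0 < eta ->
  exists A, forall B, \sum_(i <- B | i \in S `\` [set` A]) M i <= eta.
Proof.
move=> M0 [K KP] eta0.
pose sums := [set s | exists B, s = \sum_(i <- B | i \in S) M i].
have hs : has_sup sums.
  split; first by exists (\sum_(i <- fset0 | i \in S) M i), fset0.
  by exists K => _ [B ->].
have [_ [A ->] Asup] := sup_adherent eta0 hs.
exists A => B.
have : \sum_(i <- (A `|` B)%fset | i \in S) M i <= sup sums.
  by apply: ub_le_sup; [case: hs|exists (A `|` B)%fset].
rewrite (big_fsetD_split _ _ _ (fsubsetUl A B)) /=.
suff -> : \sum_(i <- B | i \in S `\` [set` A]) M i =
    \sum_(i <- ((A `|` B) `\` A)%fset | i \in S) M i by lra.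
apply: eq_fbigl_cond => i; rewrite !inE /= in_setD (_ : (i \in [set` A]) = (i \in A)).
  by case: (i \in A); case: (i \in B); case: (i \in S).
by apply/idP/idP; rewrite inE.
Qed.

Lemma sumbS S S' M : S' `<=` S -> (forall i, S i -> 0 <= M i) -> sumb S M -> sumb S' M.
Proof.
move=> S'S M0 [K KP]; exists K => B; apply: le_trans (KP B).
rewrite [leRHS]big_mkcond [leLHS]big_mkcond /=; apply: ler_sum => i _.
case: ifPn => [|_]; first by rewrite !inE => /S'S iS; rewrite mem_set.
by case: ifPn => //; rewrite inE => /M0.
Qed.

Lemma sumb_le S M N : (forall i, S i -> M i <= N i) -> sumb S N -> sumb S M.
Proof.
move=> MN [K KP]; exists K => B; apply: le_trans (KP B).
by apply: ler_sum => i; rewrite inE => /MN.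
Qed.

Lemma sumbZ S M (c : R) : 0 <= c -> sumb S M -> sumb S (fun i => c * M i).
Proof.
by move=> c0 [K KP]; exists (c * K) => B; rewrite -mulr_sumr ler_wpM2l.
Qed.

End BoundedSums.

Lemma sum_geometric_le (R : realType) (rho : R) n : 0 <= rho < 1 ->
  \sum_(i < n) rho ^+ i <= (1 - rho)^-1.
Proof.
move=> /andP[r0 r1]; have r10 : 0 < 1 - rho by rewrite subr_gt0.
rewrite -(ler_pM2l r10) mulfV ?gt_eqF //.
have : 0 <= rho ^+ n by rewrite exprn_ge0.
have := subrX1 rho n.
by move: (\sum_(i < n) rho ^+ i) (rho ^+ n) => s t *; lra.
Qed.

(** An injective degree embeds any finite part of [S] into a square in N x N, where the double
    geometric sum factors. *)
Lemma sumb_geometric2 (R : realType) (I : choiceType) (S : set I) (deg : I -> nat * nat)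
    (rho sigma : R) : 0 <= rho < 1 -> 0 <= sigma < 1 ->
  (forall i j, S i -> S j -> deg i = deg j -> i = j) ->
  sumb S (fun i => rho ^+ (deg i).1 * sigma ^+ (deg i).2).
Proof.
move=> r01 s01 inj; exists ((1 - rho)^-1 * (1 - sigma)^-1) => B.
pose term (d : nat * nat) := rho ^+ d.1 * sigma ^+ d.2.
have term0 d : 0 <= term d.
  by case/andP: r01 => ? _; case/andP: s01 => ? _; rewrite mulr_ge0 ?exprn_ge0.
pose N := (\max_(i <- B) maxn (deg i).1 (deg i).2).+1.
have NP i : i \in B -> ((deg i).1 < N)%N /\ ((deg i).2 < N)%N.
  move=> iB; have := @leq_bigmax_seq _ (enum_fset B) xpredT
    (fun i => maxn (deg i).1 (deg i).2) i iB isT.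
  by rewrite geq_max => /andP[? ?]; rewrite !ltnS.
pose D := [seq deg i | i <- enum_fset B & i \in S].
have Du : uniq D.
  rewrite map_inj_in_uniq ?filter_uniq ?fset_uniq //.
  move=> i j; rewrite !mem_filter => /andP[iS _] /andP[jS _].
  by apply: inj; exact: set_mem.
pose box := [seq (a, b) | a <- iota 0 N, b <- iota 0 N].
have Dbox : {subset D <= box}.
  apply/allP; rewrite all_map; apply/allP => i; rewrite mem_filter => /andP[_ iB] /=.
  have [? ?] := NP _ iB.
  by apply/allpairsP; exists (deg i); rewrite !mem_iota /= !add0n; split=> //; case: (deg i).
have -> : \sum_(i <- B | i \in S) rho ^+ (deg i).1 * sigma ^+ (deg i).2 = \sum_(d <- D) term d.
  by rewrite big_map big_filter.
apply: (@le_trans _ _ (\sum_(d <- box) term d)).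
  have box_u : uniq box by apply: allpairs_uniq; rewrite ?iota_uniq // => -[? ?] [].
  rewrite [leRHS](bigID (mem D)) /= -[X in X <= _]addr0 lerD ?sumr_ge0 //.
  rewrite le_eqVlt; apply/orP; left; apply/eqP; rewrite -[RHS]big_filter; apply: perm_big.
  apply: uniq_perm => //; first by rewrite filter_uniq.
  by move=> d; rewrite mem_filter andb_idr // => /Dbox.
rewrite big_allpairs_dep /=.
have -> : \sum_(a <- iota 0 N) \sum_(b <- iota 0 N) term (a, b) =
    (\sum_(a < N) rho ^+ a) * (\sum_(b < N) sigma ^+ b).
  have iotaE (G : nat -> R) : \sum_(a <- iota 0 N) G a = \sum_(a < N) G a.
    by rewrite -[in LHS](subn0 N) -/(index_iota 0 N) big_mkord.
  rewrite iotaE mulr_suml; apply: eq_bigr => a _.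
  by rewrite iotaE mulr_sumr.
by apply: ler_pM; rewrite ?sum_geometric_le // sumr_ge0 // => i _; rewrite exprn_ge0 //;
  [case/andP: r01|case/andP: s01].
Qed.

Lemma sumb_geometric (R : realType) (I : choiceType) (S : set I) (deg : I -> nat) (rho : R) :
  0 <= rho < 1 -> (forall i j, S i -> S j -> deg i = deg j -> i = j) ->
  sumb S (fun i => rho ^+ deg i).
Proof.
move=> r01 inj.
(* The second ratio and the second degree are 0, and [0 ^+ 0 = 1]. *)
have := @sumb_geometric2 R I S (fun i => (deg i, 0%N)) rho 0 r01.
rewrite lexx ltr01 => /(_ isT) H.
have [K KP] := H (fun i j Si Sj e => inj i j Si Sj (congr1 fst e)).
by exists K => B; under eq_bigr do rewrite -[rho ^+ _]mulr1 -(expr0 0).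
Qed.

(** * Unconditional infinite products *)

Section InfiniteProducts.
Context {R : realType}.
Local Notation C := R[i].
Context {I : choiceType}.
Implicit Types (S : set I) (A B : {fset I}) (M : I -> R).

Lemma finprod_split S (F : I -> C) A B : (A `<=` B)%fset ->
  finprod S F B = finprod S F A * finprod (S `\` [set` A]) F B.
Proof.
move=> AB; rewrite /finprod (big_fsetD_split _ _ _ AB); congr (_ * _).
apply: eq_fbigl_cond => i; rewrite !inE /= in_setD (_ : (i \in [set` A]) = (i \in A)).
  by case: (i \in A); case: (i \in B); case: (i \in S).
by apply/idP/idP; rewrite inE.
Qed.

Lemma infprodP S (F : I -> C) : infprod_cvg S F ->
  finprod S F @ summability.totally --> infprod S F.
Proof. by []. Qed.

Lemma infprodE S (F : I -> C) (l : C) :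
  finprod S F @ summability.totally --> l -> infprod S F = l.
Proof. by move=> H; apply: cvg_lim H; exact: norm_hausdorff. Qed.

Lemma near_totally (P : {fset I} -> Prop) A :
  (forall B, (A `<=` B)%fset -> P B) -> \forall B \near summability.totally, P B.
Proof. by move=> AP; exists A. Qed.

Lemma totallyP (P : {fset I} -> Prop) : (\forall B \near summability.totally, P B) ->
  exists A, forall B, (A `<=` B)%fset -> P B.
Proof. by move=> [A _ AP]; exists A. Qed.

Section Lipschitz.
Context {V : normedModType C} (y : V) (e : R) (e_gt0 : 0 < e).
Implicit Types (F : I -> V -> C).

(** Induction through FG - 1 = (F - 1)(G - 1) + (F - 1) + (G - 1), closed by 1 + M <= exp M. *)
Lemma lipn_finprod S F M B : (forall i, S i -> lipn y e (fun z => F i z - 1) (M i)) ->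
  lipn y e (fun z => finprod S (F^~ z) B - 1) (expR (\sum_(i <- B | i \in S) M i) - 1).
Proof.
move=> FM; rewrite /finprod.
elim: (enum_fset B) => [|i s IH].
  rewrite big_nil expR0 subrr.
  by have := lipn_cst y e (0 : C); rewrite nrm0; congr lipn; apply/funext => z;
    rewrite big_nil subrr.
rewrite big_cons; case: ifPn => [iS|iS]; last first.
  by move: IH; congr lipn; apply/funext => z; rewrite big_cons (negbTE iS).
have Mi := FM i (set_mem iS).
have M0 := lipn_ge0 Mi.
set P := fun z => \prod_(j <- s | j \in S) F j z - 1 in IH.
have -> : (fun z => \prod_(j <- i :: s | j \in S) F j z - 1) =
    (fun z => (F i z - 1) * P z + ((F i z - 1) + P z)).
  by apply/funext => z; rewrite big_cons iS /P; ring.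
have := lipnD e_gt0 (lipnM e_gt0 Mi IH) (lipnD e_gt0 Mi IH).
apply: lipn_mono; rewrite expRD.
have := expR_ge1Dx (M i); have := expR_gt0 (\sum_(j <- s | j \in S) M j).
by move: (expR _) (expR _) => a b *; nra.
Qed.

End Lipschitz.

(** Constant functions turn the estimate in the Lipschitz norm into one for numbers. *)
Lemma finprod_sub1_le S (c : I -> C) B :
  nrm (finprod S c B - 1) <= expR (\sum_(i <- B | i \in S) nrm (c i - 1)) - 1.
Proof.
have := @lipn_finprod C 0 1 ltr01 S (fun i _ => c i) (fun i => nrm (c i - 1)) B.
by move=> [i _|//]; first exact: lipn_cst.
Qed.

Lemma expR_sub1_le (t : R) : 0 <= t -> t <= 2^-1 -> expR t - 1 <= 2 * t.
Proof.
move=> t0 t1; have := expR_ge1Dx (- t); rewrite expRN => H.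
have e0 := expR_gt0 t.
have : (1 - t) * expR t <= 1 by rewrite -ler_pdivlMr // div1r.
by move: (expR t) e0 => a *; nra.
Qed.

(** Cauchy criterion: enlarging [A] multiplies its partial product, which is bounded by [expR K], by
    a factor close to 1. *)
Lemma sumb_infprod_cvg S (c : I -> C) : sumb S (fun i => nrm (c i - 1)) -> infprod_cvg S c.
Proof.
move=> cS; have [K KP] := cS.
have K0 : 0 <= K by have := KP fset0; rewrite big_mkcond big_seq_fset0.
apply: complex_cauchy_cvg => r r0.
have eK := expR_gt0 K.
(* The bound 1/2 allows [expR_sub1_le]; the other one gives [expR K * (2 * eta) <= r]. *)
pose eta := Num.min 2^-1 (r / (2 * expR K)).
have eta0 : 0 < eta by rewrite lt_min invr_gt0 ltr0n divr_gt0 // mulr_gt0.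
have [A AP] := sumb_tail (fun i _ => nrm_ge0 (c i - 1)) cS eta0.
exists (finprod S c A); apply: (@near_totally _ A) => B AB /=.
rewrite (finprod_split _ _ AB) -{2}[finprod S c A]mulr1 -mulrBr nrmM.
have H1 : nrm (finprod S c A) <= expR K.
  have : expR (\sum_(i <- A | i \in S) nrm (c i - 1)) <= expR K by rewrite ler_expR.
  have := finprod_sub1_le S c A.
  have : nrm (finprod S c A) <= nrm (finprod S c A - 1) + 1.
    by rewrite -[in leRHS]nrm1 -{1}(subrK 1 (finprod S c A)) nrm_leD.
  by lra.
have H2 := finprod_sub1_le (S `\` [set` A]) c B.
have H3 : nrm (finprod (S `\` [set` A]) c B - 1) <= 2 * eta.
  apply: le_trans H2 _; have := AP B; set t := \sum_(i <- _ | _) _ => tle.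
  have t0 : 0 <= t by apply: sumr_ge0 => *; exact: nrm_ge0.
  have eta2 : eta <= 2^-1 by rewrite ge_min lexx.
  by apply: le_trans (expR_sub1_le t0 _) _; lra.
apply: (@le_trans _ _ (expR K * (2 * eta))).
  by rewrite ler_pM ?nrm_ge0.
have : eta <= r / (2 * expR K) by rewrite ge_min lexx orbT.
by rewrite ler_pdivlMr ?mulr_gt0 //; lra.
Qed.

Lemma infprod_split S (c : I -> C) A : infprod_cvg (S `\` [set` A]) c ->
  infprod S c = finprod S c A * infprod (S `\` [set` A]) c.
Proof.
move=> H; apply: infprodE; apply/cvg_nrmP => r r0.
have K0 : 0 < nrm (finprod S c A) + 1 by rewrite ltr_wpDl ?nrm_ge0.
have := infprodP H; move/cvg_nrmP => /(_ (r / (nrm (finprod S c A) + 1))).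
rewrite divr_gt0 // => /(_ isT)/totallyP[A' A'P].
apply: (@near_totally _ (A `|` A')%fset) => B /= AB.
rewrite (finprod_split _ _ (fsubset_trans (fsubsetUl _ _) AB)) -mulrBr nrmM.
have := A'P B (fsubset_trans (fsubsetUr _ _) AB) => /= H1.
apply: (@le_trans _ _ ((nrm (finprod S c A) + 1) * (r / (nrm (finprod S c A) + 1)))).
  by rewrite ler_pM ?nrm_ge0 // lerDl.
by rewrite mulrC divfK // gt_eqF.
Qed.

(** Every partial product containing [i] vanishes, so the net is eventually constant. *)
Lemma infprod_eq0 S (c : I -> C) i : S i -> c i = 0 ->
  infprod_cvg S c /\ infprod S c = 0.
Proof.
move=> Si ci0; have H : finprod S c @ summability.totally --> (0 : C).
  apply/cvg_nrmP => r r0; apply: (@near_totally _ [fset i]%fset) => B.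
  rewrite fsub1set => iB /=; rewrite /finprod (big_rem i) //= mem_set // ci0 mul0r subrr.
  by rewrite nrm0 ltW.
by split; [apply/cvg_ex; exists (0 : C)|exact: infprodE].
Qed.

(** The factors in a large finite set are nonzero. Outside it the deviations sum to at most 1/4,
    which puts every partial product of the tail within 1/2 of 1 and keeps its limit away from 0. *)
Lemma infprod_neq0 S (c : I -> C) : sumb S (fun i => nrm (c i - 1)) ->
  (forall i, S i -> c i != 0) -> infprod S c != 0.
Proof.
move=> cS c0.
have e4 : 0 < 4^-1 :> R by rewrite invr_gt0.
have [A AP] := sumb_tail (fun i _ => nrm_ge0 (c i - 1)) cS e4.
have tail_sumb : sumb (S `\` [set` A]) (fun i => nrm (c i - 1)).
  by apply: (sumbS _ _ cS); [move=> i []|move=> i _; exact: nrm_ge0].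
have Tc := sumb_infprod_cvg tail_sumb.
rewrite (infprod_split Tc) mulf_neq0 //.
  rewrite /finprod prodf_seq_neq0; apply/allP => i _; apply/implyP => iS.
  by apply: c0; exact: set_mem.
have H : nrm (infprod (S `\` [set` A]) c - 1) <= 3 / 4.
  apply/ler_addgt0Pl => r r0.
  have := infprodP Tc; move/cvg_nrmP => /(_ r r0)/totallyP[B /(_ _ (fsubset_refl _))] /= H1.
  have H2 : nrm (finprod (S `\` [set` A]) c B - 1) <= 2^-1.
    apply: le_trans (finprod_sub1_le _ _ _) _; have := AP B; set t := \sum_(i <- _ | _) _ => tle.
    have t0 : 0 <= t by apply: sumr_ge0 => *; exact: nrm_ge0.
    by apply: le_trans (expR_sub1_le t0 _) _; lra.
  move: (infprod _ _) (finprod _ _ _) H1 H2 => t p H1 H2.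
  have : nrm (t - 1) <= nrm (p - t) + nrm (p - 1).
    by rewrite (nrm_subC p t); exact: nrm_dist_triangle.
  by lra.
apply/eqP => T0; move: H; rewrite T0 sub0r nrmN nrm1; lra.
Qed.

Lemma infprodM S (c d : I -> C) : infprod_cvg S c -> infprod_cvg S d ->
  infprod_cvg S (fun i => c i * d i) /\
  infprod S (fun i => c i * d i) = infprod S c * infprod S d.
Proof.
move=> cc cd.
have H : finprod S (fun i => c i * d i) @ summability.totally --> infprod S c * infprod S d.
  rewrite (_ : finprod S (fun i => c i * d i) = fun B => finprod S c B * finprod S d B).
    exact: (cvgM (infprodP cc) (infprodP cd)).
  by apply/funext => B; rewrite /finprod big_split.
by split; [apply/cvg_ex; exists (infprod S c * infprod S d)|exact: infprodE].
Qed.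

Lemma infprodV S (c : I -> C) : infprod_cvg S c -> infprod S c != 0 ->
  infprod_cvg S (fun i => (c i)^-1) /\
  infprod S (fun i => (c i)^-1) = (infprod S c)^-1.
Proof.
move=> cc c0.
have H : finprod S (fun i => (c i)^-1) @ summability.totally --> (infprod S c)^-1.
  rewrite (_ : finprod S (fun i => (c i)^-1) = fun B => (finprod S c B)^-1).
    exact: (cvgV c0 (infprodP cc)).
  by apply/funext => B; rewrite /finprod prodfV.
by split; [apply/cvg_ex; exists (infprod S c)^-1|exact: infprodE].
Qed.

Section Holomorphy.
Context {V : normedModType C} (y : V) (e : R) (e_gt0 : 0 < e).
Context (S : set I) (F : I -> V -> C) (M : I -> R).
Hypothesis (FM : forall i, S i -> lipn y e (fun z => F i z - 1) (M i)).
Hypothesis (M_sumb : sumb S M).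

Let M_ge0 i : S i -> 0 <= M i. Proof. by move=> /FM/lipn_ge0. Qed.

Let sumb_at S' h : S' `<=` S -> nrm h <= e -> sumb S' (fun i => nrm (F i (y + h) - 1)).
Proof.
move=> S'S he; apply: (@sumb_le _ _ _ _ M); last exact: sumbS M_sumb.
move=> i /S'S Si; exact: (lipn_bound e_gt0 (FM Si) he).
Qed.

Lemma lipn_infprod_cvg S' h : S' `<=` S -> nrm h <= e -> infprod_cvg S' (F^~ (y + h)).
Proof. by move=> S'S he; apply: sumb_infprod_cvg; exact: sumb_at. Qed.

(** All finite products of the tail obey one common bound by [lipn_finprod], and [lipn_lim] carries
    it to the infinite product. *)
Lemma lipn_tail (eta : R) : 0 < eta -> exists A,
  lipn y e (fun z => infprod (S `\` [set` A]) (F^~ z) - 1) eta.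
Proof.
move=> eta0; pose eta' := Num.min 2^-1 (eta / 2).
have eta'0 : 0 < eta' by rewrite lt_min invr_gt0 ltr0n divr_gt0.
have [A AP] := sumb_tail M_ge0 M_sumb eta'0.
exists A.
apply: (@lipn_lim _ _ _ _ e_gt0 _ _ (summability.totally_filter (I := I))
  (fun B z => finprod (S `\` [set` A]) (F^~ z) B - 1)); last first.
  move=> h he; apply/cvg_nrmP => r r0.
  have := infprodP (@lipn_infprod_cvg (S `\` [set` A]) h (@subDsetl _ _ _) he).
  move/cvg_nrmP => /(_ r r0); apply: filterS => B /=.
  by rewrite opprB addrA subrK.
apply: (@near_totally _ fset0) => B _.
have FM' i : (S `\` [set` A]) i -> lipn y e (fun z => F i z - 1) (M i).
  by move=> [/FM].
apply: lipn_mono (lipn_finprod e_gt0 B FM').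
have := AP B; set t := \sum_(i <- _ | _) _ => tle.
have t0 : 0 <= t by apply: sumr_ge0 => i; rewrite inE => -[/M_ge0].
have : eta' <= 2^-1 by rewrite ge_min lexx.
have : eta' <= eta / 2 by rewrite ge_min lexx orbT.
move=> *; apply: le_trans (expR_sub1_le t0 _) _; lra.
Qed.

(** With P the product over [A] and T the tail, the error PT - P of the approximation is P(T - 1),
    so the bounds for P and T - 1 multiply. *)
Lemma differentiable_infprod : (forall i, S i -> differentiable (F i) y) ->
  differentiable (fun z => infprod S (F^~ z)) y.
Proof.
move=> Fd; apply: (differentiable_approx e_gt0) => eta eta0.
have [K KP] := M_sumb.
have eK := expR_gt0 K.
(* P is bounded by [expR K], and the factor [e] matches the one on the left-hand side of [lipn]. *)
have [|A AP] := @lipn_tail (eta * e / expR K).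
  by rewrite divr_gt0 // mulr_gt0.
exists (fun z => finprod S (F^~ z) A).
  rewrite /finprod; elim: (enum_fset A) => [|i s IH].
    rewrite (_ : (fun z => _) = cst 1); first exact: differentiable_cst.
    by apply/funext => z; rewrite big_nil.
  case: (boolP (i \in S)) => iS.
    rewrite (_ : (fun z => _) = (fun z => F i z * \prod_(j <- s | j \in S) F j z)).
      by apply: differentiableM => //; apply: Fd; exact: set_mem.
    by apply/funext => z; rewrite big_cons iS.
  rewrite (_ : (fun z => _) = (fun z => \prod_(j <- s | j \in S) F j z)) //.
  by apply/funext => z; rewrite big_cons (negbTE iS).
move=> h he.
have PA : lipn y e (fun z => finprod S (F^~ z) A) (expR K).
  have := lipnD e_gt0 (lipn_finprod e_gt0 A FM) (lipn_cst y e 1).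
  rewrite nrm1 (_ : (fun z => _) = fun z => finprod S (F^~ z) A).
    by apply: lipn_mono; rewrite subrK ler_expR.
  by apply/funext => z; rewrite /= subrK.
have [_ /(_ h he)] := lipnM e_gt0 PA AP.
set T := fun z => infprod (S `\` [set` A]) (F^~ z).
have PT k : nrm k <= e -> infprod S (F^~ (y + k)) = finprod S (F^~ (y + k)) A * T (y + k).
  by move=> ke; apply: infprod_split; apply: lipn_infprod_cvg => // i [].
have PT0 : infprod S (F^~ y) = finprod S (F^~ y) A * T y.
  by have := PT 0; rewrite addr0 nrm0 => /(_ (ltW e_gt0)).
rewrite PT // PT0.
set P := fun z => finprod S (F^~ z) A.
rewrite -/(P (y + h)) -/(P y) -/(T _) -/(T _).
have -> : P (y + h) * (T (y + h) - 1) - P y * (T y - 1) =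
  P (y + h) * T (y + h) - P y * T y - (P (y + h) - P y) by ring.
rewrite (_ : expR K * (eta * e / expR K) = eta * e); last first.
  by field; rewrite gt_eqF.
have Uh : 0 <= nrm (P y * (T y - 1)) * nrm h by rewrite mulr_ge0 ?nrm_ge0.
move=> H; rewrite -(ler_pM2l e_gt0); move: Uh H.
by move: (nrm (P y * (T y - 1))) (nrm (P (y + h) * _ - _ - _)) (nrm h) => *; lra.
Qed.

End Holomorphy.
End InfiniteProducts.

(** * The complex exponential *)

Section RealTaylor.
Context {R : realType}.

(** By the mean value theorem, integration raises the order of a bound by one and keeps its
    constant. Iterated, this yields the Taylor remainders below. *)
Lemma le_pow_of_derive (f df : R -> R) (K : R) (n : nat) :
  (forall x : R, is_derive x 1 f (df x)) -> f 0 = 0 ->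
  (forall x, `|x| <= 1 -> `|df x| <= K * `|x| ^+ n) ->
  forall x, `|x| <= 1 -> `|f x| <= K * `|x| ^+ n.+1.
Proof.
move=> fD f0 dfK x x1.
have fc : continuous f.
  move=> t; apply: differentiable_continuous; apply/derivable1_diffP.
  exact: (@ex_derive _ _ _ _ _ _ _ (fD t)).
have [c cx ->] : exists2 c, `|c| <= `|x| & f x = df c * x.
  have [x0|x0] := leP 0 x.
    have [c] := MVT_segment x0 (fun t _ => fD t) (continuous_subspaceT fc).
    rewrite in_itv /= f0 !subr0 => /andP[c0 cx] E; exists c => //.
    by rewrite !ger0_norm.
  have [c] := MVT_segment (ltW x0) (fun t _ => fD t) (continuous_subspaceT fc).
  rewrite in_itv /= f0 sub0r => /andP[xc c0] /eqP E; exists c.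
    by rewrite !ler0_norm ?lerN2 // ltW.
  by apply/eqP; rewrite -eqr_opp (eqP E) sub0r mulrN.
have c1 := le_trans cx x1.
have K0 : 0 <= K * `|c| ^+ n by apply: le_trans (dfK _ c1).
rewrite normrM exprSr mulrA; apply: (@le_trans _ _ (K * `|c| ^+ n * `|x|)).
  by rewrite ler_wpM2r // dfK.
rewrite ler_wpM2r //.
have [K0'|K0'] := leP 0 K; first by rewrite ler_wpM2l // lerXn2r ?nnegrE.
(* For [K < 0] the bound at [c] forces this power to vanish, and the bound at [x] gives the rest. *)
have : `|c| ^+ n = 0.
  by apply/eqP; rewrite eq_le exprn_ge0 // andbT -(nmulr_rge0 _ K0').
have := dfK x x1; have := normr_ge0 (df x) => /le_trans /[apply].
rewrite nmulr_rge0 // => xn0 c0.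
by rewrite c0 mulr0; apply: le_trans (dfK x x1).
Qed.

Lemma expR_taylor2 : exists2 K : R, 0 <= K & forall x : R, `|x| <= 1 ->
  `|expR x| <= K /\ `|expR x - 1 - x - x ^+ 2 / 2| <= K * `|x| ^+ 3.
Proof.
exists (expR 1); first exact: ltW (expR_gt0 _).
have b0 (x : R) : `|x| <= 1 -> `|expR x| <= expR 1 * `|x| ^+ 0.
  move=> x1; rewrite expr0 mulr1 ger0_norm ?(ltW (expR_gt0 _)) // ler_expR.
  exact: le_trans (ler_norm x) x1.
have b1 : forall x : R, `|x| <= 1 -> `|expR x - 1| <= expR 1 * `|x| ^+ 1.
  apply: (@le_pow_of_derive (fun x => expR x - 1) expR _ 0%N _ _ b0); last by rewrite expR0 subrr.
  by move=> x; apply: is_derive_eq; rewrite subr0.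
have b2 : forall x : R, `|x| <= 1 -> `|expR x - 1 - x| <= expR 1 * `|x| ^+ 2.
  apply: (@le_pow_of_derive (fun x => expR x - 1 - x) (fun x => expR x - 1) _ 1%N _ _ b1);
    last by rewrite expR0 !subrr.
  by move=> x; apply: is_derive_eq; rewrite subr0.
have b3 : forall x : R, `|x| <= 1 -> `|expR x - 1 - x - x ^+ 2 / 2| <= expR 1 * `|x| ^+ 3.
  apply: (@le_pow_of_derive (fun x => expR x - 1 - x - x ^+ 2 / 2)
    (fun x => expR x - 1 - x) _ 2%N _ _ b2);
    last by rewrite expR0 !subrr expr0n /= mul0r subrr.
  move=> x; rewrite (_ : (fun x => _) = fun x => expR x - 1 - x - 2^-1 *: (x ^+ 2)).
    apply: is_derive_eq; rewrite subr0 /GRing.scale /=; lra.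
  by apply/funext => t; rewrite /GRing.scale /= mulrC.
by move=> x x1; split; [have := b0 x x1; rewrite expr0 mulr1|exact: b3].
Qed.

Lemma cos_sin_taylor2 (y : R) : `|y| <= 1 ->
  `|cos y - 1 + y ^+ 2 / 2| <= `|y| ^+ 3 /\ `|sin y - y| <= `|y| ^+ 3.
Proof.
have s1 : forall x : R, `|x| <= 1 -> `|sin x| <= 1 * `|x| ^+ 1.
  apply: (@le_pow_of_derive sin cos _ 0%N); rewrite ?sin0 // => x _.
  by rewrite expr0 mulr1 cos_max.
have c1 : forall x : R, `|x| <= 1 -> `|cos x - 1| <= 1 * `|x| ^+ 2.
  apply: (@le_pow_of_derive (fun x => cos x - 1) (fun x => - sin x) _ 1%N); rewrite ?cos0 ?subrr //.
    by move=> x; apply: is_derive_eq; rewrite subr0.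
  by move=> x x1; rewrite normrN s1.
have s2 : forall x : R, `|x| <= 1 -> `|sin x - x| <= 1 * `|x| ^+ 3.
  apply: (@le_pow_of_derive (fun x => sin x - x) (fun x => cos x - 1) _ 2%N _ _ c1); rewrite ?sin0 ?subrr //.
have c2 : forall x : R, `|x| <= 1 -> `|cos x - 1 + x ^+ 2 / 2| <= 1 * `|x| ^+ 4.
  apply: (@le_pow_of_derive (fun x => cos x - 1 + x ^+ 2 / 2) (fun x => - (sin x - x)) _ 3%N).
  - move=> x; rewrite (_ : (fun x => _) = fun x => cos x - 1 + 2^-1 *: (x ^+ 2)).
      by apply: is_derive_eq; rewrite subr0 /GRing.scale /=; lra.
    by apply/funext => t; rewrite /GRing.scale /= mulrC.
  - by rewrite cos0 subrr add0r expr0n /= mul0r.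
  - by move=> x x1; rewrite normrN s2.
move=> y1; split; last by have := s2 y y1; rewrite mul1r.
apply: le_trans (c2 y y1) _; rewrite mul1r exprS -[leRHS]mul1r.
by rewrite ler_wpM2r // exprn_ge0.
Qed.

End RealTaylor.

Section ComplexExponential.
Context {R : realType}.
Local Notation C := R[i].
Implicit Types (z w : C).

Lemma cexpD z w : cexp (z + w) = cexp z * cexp w.
Proof.
case: z w => [a b] [c d]; apply/eqP; rewrite eq_complex /cexp /= expRD cosD sinD.
by apply/andP; split; apply/eqP; ring.
Qed.

Lemma cexp0 : cexp 0 = 1 :> C.
Proof. by rewrite /cexp /= expR0 cos0 sin0 mulr1 mulr0. Qed.

Lemma nrm_cexp z : nrm (cexp z) = expR (complex.Re z).
Proof.
case: z => a b; rewrite /cexp /=.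
apply/eqP; rewrite -(eqrXn2 (ltn0Sn 1)) ?nrm_ge0 ?(ltW (expR_gt0 _)) // nrm_sqr /=.
by rewrite !exprMn -mulrDr cos2Dsin2 mulr1.
Qed.

(** Order two is what the differentiability of (e^z - 1)/z at 0 requires. *)
Lemma cexp_taylor2 : exists2 K : R, 0 <= K & forall z, nrm z <= 1 ->
  nrm (cexp z - 1 - z - (2^-1)%:C%C * z ^+ 2) <= K * nrm z ^+ 3.
Proof.
have [K K0 KP] := expR_taylor2 (R := R).
(* The estimates below add up to [(2 * K + 9) * N ^+ 3]; the 20 leaves slack. *)
exists (2 * K + 20) => [|z z1]; first by rewrite addr_ge0 // mulr_ge0.
have xN := Re_le_nrm z; have yN := Im_le_nrm z.
case: z z1 xN yN => x y z1 /= xN yN.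
have x1 := le_trans xN z1; have y1 := le_trans yN z1.
have [eK rK] := KP x x1.
have [sK tK] := cos_sin_taylor2 y1.
set N := nrm _ in z1 xN yN *.
have N0 : 0 <= N by exact: nrm_ge0.
have xN3 : `|x| ^+ 3 <= N ^+ 3 by rewrite lerXn2r ?nnegrE.
have yN3 : `|y| ^+ 3 <= N ^+ 3 by rewrite lerXn2r ?nnegrE.
set r := expR x - 1 - x - x ^+ 2 / 2 in rK.
set s := cos y - 1 + y ^+ 2 / 2 in sK.
set t := sin y - y in tK.
have rN : `|r| <= K * N ^+ 3 by apply: le_trans rK _; rewrite ler_wpM2l.
have sN := le_trans sK yN3; have tN := le_trans tK yN3.
apply: le_trans (nrm_le_ReIm _) _.
have P3 : `|1 + x + x ^+ 2 / 2| <= 3.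
  have /andP[? ?] : - 1 <= x <= 1 by rewrite -ler_norml.
  by rewrite ler_norml; apply/andP; split; nra.
(* Substitute exp x = r + (1 + x + x^2/2), cos y = s + 1 - y^2/2 and sin y = t + y; the monomials of
   order at most two cancel. *)
have ReE : complex.Re (cexp (Complex x y) - 1 - Complex x y - (2^-1)%:C%C * Complex x y ^+ 2) =
    r * cos y + ((1 + x + x ^+ 2 / 2) * s - (1 + x / 2) * (x * y ^+ 2 / 2)).
  by rewrite expr2 /cexp /= /r /s; field.
have ImE : complex.Im (cexp (Complex x y) - 1 - Complex x y - (2^-1)%:C%C * Complex x y ^+ 2) =
    r * sin y + ((1 + x + x ^+ 2 / 2) * t + x ^+ 2 * y / 2).
  by rewrite expr2 /cexp /= /r /t; field.
rewrite ReE ImE.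
have xyyN : `|x * y ^+ 2| <= N ^+ 3.
  rewrite normrM normrX (exprS N); apply: ler_pM; rewrite ?exprn_ge0 //.
  by rewrite lerXn2r ?nnegrE.
have xxyN : `|x ^+ 2 * y| <= N ^+ 3.
  rewrite normrM normrX (exprSr N); apply: ler_pM; rewrite ?exprn_ge0 //.
  by rewrite lerXn2r ?nnegrE.
have N30 : 0 <= N ^+ 3 by rewrite exprn_ge0.
have rc : `|r * cos y| <= K * N ^+ 3.
  by rewrite normrM -[leRHS]mulr1 ler_pM // cos_max.
have rs : `|r * sin y| <= K * N ^+ 3.
  by rewrite normrM -[leRHS]mulr1 ler_pM // sin_max.
have Ps : `|(1 + x + x ^+ 2 / 2) * s| <= 3 * N ^+ 3 by rewrite normrM ler_pM.
have Pt : `|(1 + x + x ^+ 2 / 2) * t| <= 3 * N ^+ 3 by rewrite normrM ler_pM.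
have q1 : `|(1 + x / 2) * (x * y ^+ 2 / 2)| <= 2 * N ^+ 3.
  have -> : (1 + x / 2) * (x * y ^+ 2 / 2) = (2^-1 + x / 4) * (x * y ^+ 2) by field.
  rewrite normrM ler_pM //.
  by rewrite ler_norml; move: x1; rewrite ler_norml => /andP[? ?]; apply/andP; split; lra.
have q2 : `|x ^+ 2 * y / 2| <= N ^+ 3.
  by rewrite normrM [X in _ * X]ger0_norm ?invr_ge0 //; move: (normr_ge0 (x ^+ 2 * y)); lra.
have := ler_normD (r * cos y) ((1 + x + x ^+ 2 / 2) * s - (1 + x / 2) * (x * y ^+ 2 / 2)).
have := ler_normB ((1 + x + x ^+ 2 / 2) * s) ((1 + x / 2) * (x * y ^+ 2 / 2)).
have := ler_normD (r * sin y) ((1 + x + x ^+ 2 / 2) * t + x ^+ 2 * y / 2).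
have := ler_normD ((1 + x + x ^+ 2 / 2) * t) (x ^+ 2 * y / 2).
by lra.
Qed.

End ComplexExponential.

Section ComplexExponentialCalculus.
Context {R : realType}.
Local Notation C := R[i].
Implicit Types (z w : C).

Lemma cexp_taylor1 : exists2 K : R, 0 <= K & forall z, nrm z <= 1 ->
  nrm (cexp z - 1 - z) <= K * nrm z ^+ 2.
Proof.
have [K K0 KP] := cexp_taylor2 (R := R); exists (K + 1); first by rewrite addr_ge0.
move=> z z1.
have : nrm (cexp z - 1 - z) <= nrm (cexp z - 1 - z - (2^-1)%:C%C * z ^+ 2)
    + nrm ((2^-1)%:C%C * z ^+ 2).
  by rewrite -{1}(subrK ((2^-1)%:C%C * z ^+ 2) (cexp z - 1 - z)) nrm_leD.
rewrite [nrm (_%:C%C * _)]nrmM nrm_real nrmX.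
have := KP z z1; have N0 := nrm_ge0 z.
have : K * nrm z ^+ 3 <= K * nrm z ^+ 2.
  by rewrite ler_wpM2l // ler_wiXn2l.
have : `|2^-1 : R| * nrm z ^+ 2 <= nrm z ^+ 2.
  have : 0 <= nrm z ^+ 2 by rewrite exprn_ge0.
  by rewrite ger0_norm ?invr_ge0 //; lra.
by lra.
Qed.

Lemma differentiable_cexp z : differentiable (@cexp R) z.
Proof.
apply/nrm_differentiableP; exists (fun h => cexp z * h); split.
- by move=> a u v; rewrite -[a *: _]/(a * _) -[a *: (_ * _)]/(a * _); ring.
- by exists (nrm (cexp z)) => h; rewrite nrmM.
move=> eta eta0; have [K K0 KP] := cexp_taylor1.
pose c := (K + 1) * nrm (cexp z).
have c0 : 0 < c by rewrite mulr_gt0 ?ltr_wpDl // nrm_cexp expR_gt0.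
exists (Num.min 1 (eta / c)); first by rewrite lt_min ltr01 divr_gt0.
move=> h; rewrite le_min => /andP[h1 he].
rewrite cexpD (_ : _ - _ = cexp z * (cexp h - 1 - h)); last by ring.
rewrite nrmM; apply: (@le_trans _ _ (nrm (cexp z) * (K * nrm h ^+ 2))).
  by rewrite ler_wpM2l ?nrm_ge0 ?KP.
rewrite expr2 !mulrA ler_wpM2r ?nrm_ge0 //.
apply: (@le_trans _ _ (c * nrm h)); last by rewrite mulrC -ler_pdivlMr.
rewrite ler_wpM2r ?nrm_ge0 // /c mulrC ler_wpM2r ?nrm_ge0 //; lra.
Qed.

(** The entire function (e^z - 1)/z with its removable singularity filled in. It supplies the unit
    by which 1 - e^z differs from a linear form along its zeros. *)
Definition cexpm1_div z : C := if z == 0 then 1 else (cexp z - 1) / z.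

Lemma cexpm1_divP z : cexp z - 1 = z * cexpm1_div z.
Proof.
rewrite /cexpm1_div; case: eqP => [->|/eqP z0]; first by rewrite cexp0 subrr mul0r.
by rewrite mulrCA mulfV // mulr1.
Qed.

Lemma differentiable_near (V : normedModType C) (f g : V -> C) (y : V) :
  (\forall z \near y, f z = g z) -> differentiable f y -> differentiable g y.
Proof.
move=> /[dup] /nbhs_singleton fgy /nbhs_nrmP[d d0 dP] /nrm_differentiableP[L [linL LK LP]].
apply/nrm_differentiableP; exists L; split=> // eta /LP[e e0 eP].
exists (Num.min d e); first by rewrite lt_min d0.
by move=> h; rewrite le_min => /andP[/dP <- /eP]; rewrite fgy.
Qed.

Lemma differentiable_cexpm1_div z : differentiable cexpm1_div z.
Proof.
have [->|z0] := eqVneq z 0.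
  (* The derivative at 0 is the quadratic coefficient of the exponential. *)
  apply/nrm_differentiableP; exists (fun h => (2^-1)%:C%C * h); split.
  - by move=> a u v; rewrite -[a *: _]/(a * _) -[a *: (_ * _)]/(a * _); ring.
  - by exists (nrm ((2^-1)%:C%C : C)) => h; rewrite nrmM.
  move=> eta eta0; have [K K0 KP] := cexp_taylor2 (R := R).
  exists (Num.min 1 (eta / (K + 1))).
    by rewrite lt_min ltr01 divr_gt0 // ltr_wpDl.
  move=> h; rewrite le_min add0r {2}/cexpm1_div eqxx => /andP[h1 he].
  have [->|h0] := eqVneq h 0.
    by rewrite /cexpm1_div eqxx subrr mulr0 subrr !nrm0 mulr0.
  have nh0 : 0 < nrm h by rewrite nrm_gt0.
  rewrite -(ler_pM2l nh0) -nrmM !mulrBr -cexpm1_divP mulr1 mulrCA -expr2.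
  apply: le_trans (KP h h1) _; rewrite exprS mulrCA ler_wpM2l ?nrm_ge0 // expr2 mulrA.
  rewrite ler_wpM2r ?nrm_ge0 //.
  move: he; rewrite ler_pdivlMr ?ltr_wpDl //; have := nrm_ge0 h; lra.
apply: (@differentiable_near _ (fun u => (cexp u - 1) * u^-1)).
  apply/nbhs_nrmP; exists (nrm z / 2); first by rewrite divr_gt0 // nrm_gt0.
  move=> h hz; rewrite /cexpm1_div ifN //; apply/eqP => zh0.
  have : nrm z = nrm h by rewrite -(nrmN h); congr nrm; apply/eqP; rewrite -addr_eq0 zh0.
  have : 0 < nrm z by rewrite nrm_gt0.
  by move: hz => /[swap]; lra.
apply: differentiableM; last first.
  by apply: differentiableV => //; exact: differentiable_id.
by apply: differentiableB; [exact: differentiable_cexp|exact: differentiable_cst].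
Qed.

Lemma cexp_neq0 z : cexp z != 0.
Proof. by rewrite -nrm_eq0 nrm_cexp gt_eqF ?expR_gt0. Qed.

Lemma e2piD z w : e2pi (z + w) = e2pi z * e2pi w.
Proof. by rewrite /e2pi mulrDr cexpD. Qed.

Lemma e2pi0 : e2pi 0 = 1 :> C.
Proof. by rewrite /e2pi mulr0 cexp0. Qed.

Lemma e2pi_neq0 z : e2pi z != 0.
Proof. exact: cexp_neq0. Qed.

Lemma e2piN z : e2pi (- z) = (e2pi z)^-1.
Proof.
by apply: (mulfI (e2pi_neq0 z)); rewrite -e2piD subrr e2pi0 mulfV ?e2pi_neq0.
Qed.

Lemma e2piMn z n : e2pi (n%:R * z) = e2pi z ^+ n.
Proof.
elim: n => [|n IH]; first by rewrite mul0r e2pi0.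
by rewrite exprS -IH -e2piD -natr1 mulrDl mul1r addrC.
Qed.

Lemma nrm_e2pi z : nrm (e2pi z) = expR (- (2 * pi * complex.Im z)).
Proof. by rewrite nrm_cexp; case: z => a b /=; rewrite mul0r sub0r. Qed.

Lemma nrm_e2pi_real (r : R) : nrm (e2pi r%:C%C) = 1.
Proof. by rewrite nrm_e2pi /= mulr0 oppr0 expR0. Qed.

Lemma nrm_e2pi_lt1 z : 0 < complex.Im z -> nrm (e2pi z) < 1.
Proof.
by move=> z0; rewrite nrm_e2pi -expR0 ltr_expR oppr_lt0 !mulr_gt0 // pi_gt0.
Qed.

Lemma e2pi_int (n : int) : e2pi n%:~R = 1 :> C.
Proof.
have e1 : e2pi 1 = 1 :> C.
  rewrite /e2pi mulr1 /cexp /= expR0 !mul1r.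
  by rewrite mulrC mulr_natr cos2pi sin2pi.
case: n => n; first by rewrite -[_%:~R]mulr1 e2piMn e1 expr1n.
by rewrite NegzE mulrNz e2piN -[_%:~R]mulr1 e2piMn e1 expr1n invr1.
Qed.

(** The modulus forces z to be real, and its floor leaves a remainder r in [0, 1). For 0 < r < 1 the
    sine of 2 pi r is nonzero except at r = 1/2, where the cosine is -1. *)
Lemma e2pi_eq1 z : e2pi z = 1 <-> exists n : int, z = n%:~R.
Proof.
split=> [ez|[n ->]]; last exact: e2pi_int.
have Im0 : complex.Im z = 0.
  have := nrm_e2pi z; rewrite ez nrm1 -expR0 => /expR_inj/esym/eqP.
  by rewrite oppr_eq0 mulf_eq0 gt_eqF ?mulr_gt0 ?pi_gt0 //= => /eqP.
pose n := Num.floor (complex.Re z); exists n.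
pose r := complex.Re z - n%:~R.
have /andP[r0 r1] : 0 <= r < 1.
  rewrite subr_ge0 ltrBlDr addrC -[1]/(1%:~R) -intrD.
  by rewrite Num.Theory.floor_le ?num_real //= Num.Theory.floorD1_gt ?num_real.
have zr : z = n%:~R + r%:C%C.
  rewrite (complexE z) Im0 mulr0 addr0 -(rmorph_int (real_complex R)) -rmorphD /=.
  by rewrite addrC subrK.
have : e2pi r%:C%C = 1 by move: ez; rewrite {1}zr e2piD e2pi_int mul1r.
have cexp_ir t : cexp (Complex 0 t) = Complex (cos t) (sin t) :> C.
  by rewrite /cexp /= expR0 !mul1r.
have -> : e2pi r%:C%C = Complex (cos (2 * pi * r)) (sin (2 * pi * r)).
  by rewrite -cexp_ir /e2pi; congr cexp; apply/eqP; rewrite eq_complex /=;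
    apply/andP; split; apply/eqP; ring.
move=> /eqP; rewrite eq_complex /= => /andP[/eqP cos1 /eqP sin0].
suff r00 : r = 0 by rewrite zr r00 addr0.
apply/eqP; rewrite eq_le r0 andbT leNgt; apply/negP => r_gt0.
have pi0 := pi_gt0 R.
have [rlt|rgt|re] := ltgtP r 2^-1.
- have : 0 < sin (2 * pi * r) by apply: sin_gt0_pi; apply/andP; split; nra.
  by rewrite sin0 ltxx.
- have : 0 < sin (2 * pi * r - pi) by apply: sin_gt0_pi; apply/andP; split; nra.
  by rewrite sinB sin0 cospi sinpi mul0r mulr0 subrr ltxx.
- move: cos1; rewrite re mulrAC mulfV ?mul1r ?cospi //.
  by clear; lra.
Qed.

End ComplexExponentialCalculus.

(** * Lattice geometry *)

Section CrossProduct.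
Context {K : comNzRingType}.
Implicit Types (u v w : 'I_3 -> K).

(** The cross product, on functions ['I_3 -> K] so that rows, columns and their images in other
    rings are treated alike. *)
Definition crs u v : 'I_3 -> K := fun i =>
  nth 0 [:: u 1 * v 2 - u 2 * v 1; u 2 * v 0 - u 0 * v 2; u 0 * v 1 - u 1 * v 0] i.

Definition dot u v : K := u 0 * v 0 + u 1 * v 1 + u 2 * v 2.

Lemma ord3P (P : 'I_3 -> Prop) : P 0 -> P 1 -> P 2 -> forall i, P i.
Proof.
move=> P0 P1 P2 [[|[|[|//]]] ilt].
- by rewrite (_ : Ordinal ilt = 0) //; apply: val_inj.
- by rewrite (_ : Ordinal ilt = 1) //; apply: val_inj.
- by rewrite (_ : Ordinal ilt = 2) //; apply: val_inj.
Qed.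

Lemma sum3 (F : 'I_3 -> K) : \sum_i F i = F 0 + F 1 + F 2.
Proof.
rewrite !big_ord_recl big_ord0 addr0 addrA; congr (F _ + F _ + F _); exact: val_inj.
Qed.

Lemma evE (d : 'rV[K]_3) (x : 'cV[K]_3) : ev d x = dot (d 0) (x^~ 0).
Proof. by rewrite /ev mxE sum3. Qed.

Lemma det3 (M : 'M[K]_3) : \det M = dot (M 0) (crs (M 1) (M 2)).
Proof.
rewrite (expand_det_row _ 0) sum3 /cofactor !(expand_det_row _ 0) !big_ord_recl !big_ord0.
rewrite /cofactor !det_mx11 !mxE /dot /crs /=.
have l01 : lift 0 0 = 1 :> 'I_3 by apply: val_inj.
have l10 : lift 1 0 = 0 :> 'I_3 by apply: val_inj.
have l20 : lift 2 0 = 0 :> 'I_3 by apply: val_inj.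
have l011 : lift 0 (lift 0 0) = 2 :> 'I_3 by apply: val_inj.
have l010 : lift 0 (lift (lift ord0 ord0) 0) = 1 :> 'I_3 by apply: val_inj.
have l110 : lift 1 (lift (lift ord0 ord0) 0) = 0 :> 'I_3 by apply: val_inj.
have l210 : lift 2 (lift (lift ord0 ord0) 0) = 0 :> 'I_3 by apply: val_inj.
have l1' : lift 1 (lift 0 0) = 2 :> 'I_3 by apply: val_inj.
have l2' : lift 2 (lift 0 0) = 1 :> 'I_3 by apply: val_inj.
rewrite l010 l110 l210 !(l011, l1', l2', l01, l10, l20).
rewrite -[(0 + 1 %% 3)%N]/1%N -[(0 + (1 %% 3 + 1 %% 3) %% 3)%N]/2%N /bump /=.
by ring.
Qed.

Lemma dot_crs_perm u v w : dot u (crs v w) = dot v (crs w u).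
Proof. by rewrite /dot /crs /=; ring. Qed.

Lemma dot_crsl u v : dot u (crs u v) = 0.
Proof. by rewrite /dot /crs /=; ring. Qed.

Lemma dot_crsr u v : dot v (crs u v) = 0.
Proof. by rewrite /dot /crs /=; ring. Qed.

Lemma crs_crs u v w : crs (crs u v) w = fun i => v i * dot u w - u i * dot v w.
Proof. by apply/funext; apply: ord3P; rewrite /crs /dot /=; ring. Qed.

Lemma crsN u v : crs u v = fun i => - crs v u i.
Proof. by apply/funext; apply: ord3P; rewrite /crs /=; ring. Qed.

Lemma dotC u v : dot u v = dot v u.
Proof. by rewrite /dot; ring. Qed.

(* If [v] is orthogonal to [u], then [v x (u x w) = u (v . w)]; applied to a
   pair of vectors orthogonal to [w] this shows that their cross product is
   proportional to [w]. *)
Lemma crs_orthogonal u v w i : dot u w = 0 -> dot v w = 0 ->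
  dot w w * crs u v i = dot w (crs u v) * w i.
Proof.
move=> uw vw; have -> : dot w w * crs u v i = dot w (crs u v) * w i +
    (dot u w * crs w v i - dot v w * crs w u i).
  by move: i; apply: ord3P; rewrite /crs /dot /=; ring.
by rewrite uw vw !mul0r subrr addr0.
Qed.

(** Read off from (u x v) x u = (u . u) v - (u . v) u. *)
Lemma crs0_proportional u v i : (forall j, crs u v j = 0) -> dot u u * v i = dot u v * u i.
Proof.
move=> uv0; have -> : dot u u * v i = dot u v * u i + crs (crs u v) u i.
  by move: i; apply: ord3P; rewrite /crs /dot /=; ring.
rewrite [crs (crs u v) u i](_ : _ = 0) ?addr0 //.
by move: i; apply: ord3P; rewrite {1}/crs /= !uv0 !mul0r subrr.
Qed.

End CrossProduct.

Lemma dot_self_eq0 (K : realDomainType) (u : 'I_3 -> K) : dot u u = 0 -> forall i, u i = 0.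
Proof.
rewrite /dot -!expr2 => /eqP; rewrite !paddr_eq0 ?addr_ge0 ?sqr_ge0 //.
by rewrite !sqrf_eq0 => /andP[/andP[/eqP ? /eqP ?] /eqP ?]; apply: ord3P.
Qed.

Lemma dot_self_gt0 (K : realDomainType) (u : 'I_3 -> K) i : u i != 0 -> 0 < dot u u.
Proof.
move=> ui; rewrite lt_def /dot !addr_ge0 -?expr2 ?sqr_ge0 // andbT.
by apply: contra ui => /eqP; rewrite !expr2 => /dot_self_eq0 ->.
Qed.

(** * Primitive vectors and divisibility *)

Section Primitive.

(** Division by the gcd makes the coefficients coprime. Bezout then exhibits [g] as a multiple of
    [N'], and primitivity leaves [N'] = 1 or -1. *)
Lemma primitive_factor_eq m n (N M : int) (d g : 'M[int]_(m, n)) :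
  N != 0 -> primitive g -> N *: d = M *: g -> exists k : int, d = k *: g.
Proof.
move=> N0 gP NdMg.
have [u [v uv]] := Bezoutz N M.
have g0 : gcdz N M != 0 by rewrite gcdz_eq0 (negbTE N0).
pose N' := (N %/ gcdz N M)%Z; pose M' := (M %/ gcdz N M)%Z.
have NE : N = N' * gcdz N M by rewrite divzK // dvdz_gcdl.
have ME : M = M' * gcdz N M by rewrite divzK // dvdz_gcdr.
have uv1 : u * N' + v * M' = 1.
  by apply: (mulIf g0); rewrite mulrDl -!mulrA -NE -ME uv mul1r.
have NdMg' : N' *: d = M' *: g.
  by apply: (scalemx_inj g0); rewrite !scalerA ![_ * N']mulrC ![_ * M']mulrC -NE -ME.
have gE : g = N' *: (u *: g + v *: d).
  rewrite scalerDr !scalerA [N' * v]mulrC -[(v * N') *: d]scalerA NdMg'.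
  by rewrite scalerA -scalerDl [N' * u]mulrC uv1 scale1r.
have N'1 := gP _ _ gE.
exists (N' * M'); rewrite -scalerA -NdMg' scalerA.
(* The square treats both signs at once. *)
have -> : N' * N' = 1 by rewrite -expr2 -real_normK ?num_real // N'1 expr1n.
by rewrite scale1r.
Qed.

(** Descent on the sum of the absolute values of the entries: a nonzero vector that is not primitive
    is r u with |r| > 1, so u is smaller. The sign of r moves into [g]. *)
Lemma exists_primitive_factor n (v : 'rV[int]_n) : v != 0 ->
  exists2 s : int, 0 < s & exists2 g : 'rV[int]_n, primitive g & v = s *: g.
Proof.
pose size_of (u : 'rV[int]_n) := \sum_j `|u (0%R : 'I_1) j|%N.
have [k] := ubnP (size_of v); elim: k v => // k IH v vk v0.
have [vP|] := pselect (primitive v); first by exists 1 => //; exists v; rewrite ?scale1r.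
move=> /existsNP[r /existsNP[u /not_implyP[vE r1]]].
have r0 : r != 0 by apply: contraNneq v0 => r0; rewrite vE r0 scale0r.
have u0 : u != 0 by apply: contraNneq v0 => u0; rewrite vE u0 scaler0.
have size_u : (0 < size_of u)%N.
  rewrite lt0n; apply: contraNneq u0 => /eqP; rewrite sum_nat_eq0 => /forallP uj.
  by apply/eqP/matrixP => i j; rewrite ord1 mxE; have := uj j; rewrite absz_eq0 => /eqP.
have size_v : size_of v = (`|r| * size_of u)%N.
  by rewrite vE /size_of big_distrr; apply: eq_bigr => j _; rewrite mxE abszM.
have r2 : (1 < `|r|)%N by move: r1 r0; lia.
have [|s s0 [g gP uE]] := IH u _ u0.
  by move: vk; rewrite size_v; nia.
have [rneg|rpos] := ltP r 0.
  exists (- r * s); first by rewrite mulr_gt0 // oppr_gt0.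
  exists (- g); last by rewrite vE uE scalerA mulNr scaleNr scalerN opprK.
  by move=> c w gc; apply: (gP c (- w)); rewrite scalerN -gc opprK.
exists (r * s); first by rewrite mulr_gt0 // lt_def r0.
by exists g; rewrite // vE uE scalerA.
Qed.

End Primitive.

(** * Orientation as the sign of a triple product *)

Section Heights.
Context {R : realType}.
Local Notation C := R[i].
Implicit Types (a b : 'cV[int]_3) (d g : 'rV[int]_3) (x : 'cV[C]_3).

Definition rex x : 'I_3 -> R := fun i => complex.Re (x i 0).
Definition imx x : 'I_3 -> R := fun i => complex.Im (x i 0).

(** This is det(c, Im x, Re x). For real forms p, q with cross product c it equals the imaginary
    part of p(x) times the conjugate of q(x), the quantity that defines U_a^+. *)
Definition height (c : 'I_3 -> R) x : R := dot c (crs (imx x) (rex x)).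

Definition rl (c : 'I_3 -> int) : 'I_3 -> R := fun i => (c i)%:~R.

Lemma Im_dot_conj (p q : 'I_3 -> R) x :
  complex.Im (dot (fun i => (p i)%:C%C) (x^~ 0) * conjc (dot (fun i => (q i)%:C%C) (x^~ 0))) =
  height (crs p q) x.
Proof.
rewrite /height /dot /crs /rex /imx /=.
by case: (x 0 0) (x 1 0) (x 2 0) => [x0 y0] [x1 y1] [x2 y2] /=; ring.
Qed.

Lemma evZE d x : evZ d x = dot (fun i => (rl (d 0) i)%:C%C) (x^~ 0).
Proof.
rewrite /evZ evE /rl; congr dot; apply/funext => i.
by rewrite mxE -(rmorph_int (real_complex R)).
Qed.

Lemma evQE (d : 'rV[rat]_3) x : evQ d x = dot (fun i => (ratr (d 0 i))%:C%C) (x^~ 0).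
Proof.
rewrite /evQ evE; congr dot; apply/funext => i.
by rewrite mxE -(fmorph_rat (real_complex R)).
Qed.

Lemma Im_evZ_conj d g x :
  complex.Im (evZ d x * conjc (evZ g x)) = height (rl (crs (d 0) (g 0))) x.
Proof.
rewrite !evZE Im_dot_conj; congr height; apply/funext.
by apply: ord3P; rewrite /crs /rl /= rmorphB !rmorphM.
Qed.

Lemma heightZ (k : R) (c : 'I_3 -> R) x : height (fun i => k * c i) x = k * height c x.
Proof. by rewrite /height /dot; ring. Qed.

Lemma height_mul (M : 'M[int]_3) a x :
  height (rl ((M *m a)^~ 0)) (map_mx intr M *m x) =
  (\det M)%:~R * height (rl (a^~ 0)) x.
Proof.
rewrite /height; have -> : rl ((M *m a)^~ 0) = fun i =>
    dot (rl (M i)) (rl (a^~ 0)).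
  by apply/funext => i; rewrite /rl mxE sum3 !rmorphD !rmorphM.
have E i : (map_mx intr M *m x) i 0 = dot (fun j => (rl (M i) j)%:C%C) (x^~ 0).
  rewrite mxE sum3 /dot !mxE.
  by rewrite -!(rmorph_int (real_complex R)).
have -> : rex (map_mx intr M *m x) = fun i => dot (rl (M i)) (rex x).
  apply/funext => i; rewrite /rex E /dot /=.
  by case: (x 0 0) (x 1 0) (x 2 0) => [x0 y0] [x1 y1] [x2 y2] /=; ring.
have -> : imx (map_mx intr M *m x) = fun i => dot (rl (M i)) (imx x).
  apply/funext => i; rewrite /imx E /dot /=.
  by case: (x 0 0) (x 1 0) (x 2 0) => [x0 y0] [x1 y1] [x2 y2] /=; ring.
rewrite det3 /dot /crs /rl /=.
by rewrite !(rmorphD, rmorphB, rmorphM) /=; ring.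
Qed.

(** The cross product of a basis of H(a) is a multiple of [a], and a positive one when the basis is
    oriented. *)
Lemma UplusP a x : a != 0 -> Uplus a x <-> 0 < height (rl (a^~ 0)) x.
Proof.
move=> a0.
have [i0 ai0] : exists i, a i 0 != 0.
  apply: contrapT => /forallNP H; move/eqP: a0; apply; apply/matrixP => i j.
  by rewrite ord1 mxE; apply/eqP/negP => /negP; exact: H.
pose aQ : 'I_3 -> rat := fun i => (a i 0)%:~R.
have aQ0 : 0 < dot aQ aQ by apply: (@dot_self_gt0 _ _ i0); rewrite intr_eq0.
have evQa (d : 'rV[rat]_3) : ev d (map_mx intr a) = dot (d 0) aQ.
  by rewrite evE; congr dot; apply/funext => i; rewrite mxE.
have detQ (u v w : 'rV[rat]_3) : \det (rows3 u v w) = dot (w 0) (crs (u 0) (v 0)).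
  rewrite det3 dot_crs_perm dot_crs_perm; congr (dot _ (crs _ _));
    by apply/funext => i; rewrite mxE.
have height_basis (al be : 'rV[rat]_3) (l : rat) : (forall i, crs (al 0) (be 0) i = l * aQ i) ->
    complex.Im (evQ al x * conjc (evQ be x)) = ratr l * height (rl (a^~ 0)) x.
  move=> albe; rewrite !evQE Im_dot_conj -heightZ; congr height; apply/funext => i.
  rewrite /rl -(ratr_int _ (a i 0)) -rmorphM /= -albe.
  by move: i; apply: ord3P; rewrite /crs /= rmorphB !rmorphM.
split.
  move=> [al [be [[al0 be0 _ pos] Impos]]].
  rewrite evQa in al0; rewrite evQa in be0.
  pose l := dot aQ (crs (al 0) (be 0)) / dot aQ aQ.
  have l0 : 0 < l.
    (* Orientation is tested on the form with the coordinates of [a], which is positive on [a]. *)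
    rewrite divr_gt0 //; have := pos (\row_i aQ i).
    rewrite evQa detQ (_ : (\row_i aQ i) 0 = aQ); last by apply/funext => i; rewrite mxE.
    by apply.
  have /height_basis E i : crs (al 0) (be 0) i = l * aQ i.
    apply: (mulfI (lt0r_neq0 aQ0)); rewrite crs_orthogonal // /l; field.
    exact: lt0r_neq0.
  by move: Impos; rewrite E pmulr_rgt0 // ltr0q.
move=> hpos.
(* For [e] not parallel to [a], the forms a x e and a x (a x e) are an orthogonal basis of H(a) with
   cross product |a x e|^2 a. *)
have [e ae0] : exists e : 'I_3 -> rat, exists i, crs aQ e i != 0.
  apply: contrapT => /forallNP H.
  have {}H e i : crs aQ e i = 0.
    by apply/eqP/negP => /negP E; apply: (H e); exists i.
  have := H (fun j => (j == 0)%:R) 1; have := H (fun j => (j == 0)%:R) 2.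
  have := H (fun j => (j == 1)%:R) 2.
  rewrite /crs /= !(mulr0, mulr1, subr0, sub0r).
  move=> a00 /eqP; rewrite oppr_eq0 => /eqP a10 a20.
  have : aQ i0 == 0 by move: (i0); apply: ord3P; rewrite ?a00 ?a10 ?a20.
  by rewrite intr_eq0 (negbTE ai0).
have {ae0}[i1 ali1] := ae0.
pose al : 'rV[rat]_3 := \row_i crs aQ e i.
pose be : 'rV[rat]_3 := \row_i crs aQ (crs aQ e) i.
have alE : al 0 = crs aQ e by apply/funext => i; rewrite mxE.
have beE : be 0 = crs aQ (crs aQ e) by apply/funext => i; rewrite mxE.
pose l := dot (crs aQ e) (crs aQ e).
have l0 : 0 < l by exact: dot_self_gt0 ali1.
have albe i : crs (al 0) (be 0) i = l * aQ i.
  rewrite alE beE /l; move: i; apply: ord3P; rewrite /crs /dot /=; ring.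
have be2 : dot (be 0) (be 0) = dot aQ aQ * l.
  by rewrite beE /l /crs /dot /=; ring.
exists al, be; split; last by rewrite (height_basis _ _ l) // mulr_gt0 // ltr0q.
split.
- by rewrite evQa alE dotC dot_crsl.
- by rewrite evQa beE dotC dot_crsl.
- apply/row_freeP.
  exists (row_mx (l^-1 *: al^T) ((dot aQ aQ * l)^-1 *: be^T)).
  rewrite mul_col_row -!scalemxAr.
  have dotM (u v : 'rV[rat]_3) : u *m v^T = (dot (u 0) (v 0))%:M.
    by apply/matrixP => i j; rewrite !ord1 !mxE sum3 /dot !mxE mulr1n.
  rewrite !dotM be2 [dot (al 0) (al 0)](_ : _ = l); last by rewrite alE.
  have -> : dot (al 0) (be 0) = 0 by rewrite alE beE dot_crsr.
  have -> : dot (be 0) (al 0) = 0 by rewrite alE beE dotC dot_crsr.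
  rewrite !scale_scalar_mx !mulr0 !mulVf ?mulf_neq0 ?lt0r_neq0 //.
  by rewrite !raddf0 -scalar_mx_block.
- move=> d; rewrite evQa detQ => da.
  have -> : dot (d 0) (crs (al 0) (be 0)) = l * dot (d 0) aQ.
    by rewrite /dot !albe; ring.
  by rewrite mulr_gt0.
Qed.

Lemma primitive_neq0 m n (v : 'M[int]_(m, n)) : primitive v -> v != 0.
Proof. by move=> vP; apply/eqP => v0; have := vP 0 0; rewrite v0 scaler0 => /(_ erefl). Qed.

(** A positive height already places [y] in [Xcone]: for a complex multiple of a real vector,
    imaginary and real part are parallel. *)
Lemma VP (a : Lprim) (y : C * 'cV[C]_3) : V a y <-> 0 < height (rl ((sval a)^~ 0)) y.2.
Proof.
have aP := UplusP y.2 (primitive_neq0 (svalP a)).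
split=> [[_ /aP] //|h]; split; last exact/aP.
move=> [l [r yE]]; move: h; rewrite yE (_ : height _ _ = 0) ?ltxx //.
rewrite /height; have -> : rex (l *: map_mx (real_complex R) r) = fun i => complex.Re l * r i 0.
  by apply/funext => i; rewrite /rex !mxE; case: l {yE} => ? ? /=; ring.
have -> : imx (l *: map_mx (real_complex R) r) = fun i => complex.Im l * r i 0.
  by apply/funext => i; rewrite /imx !mxE; case: l {yE} => ? ? /=; ring.
by rewrite /dot /crs /=; ring.
Qed.

Lemma V_act (g : ISL3) (a : Lprim) (y : C * 'cV[C]_3) : V (act_prim g a) (act_pt g y) <-> V a y.
Proof. by rewrite !VP /act_pt /= height_mul det_lin mul1r. Qed.

End Heights.

(** * Differentiability of coordinate functions and openness of V_a *)

Section Coordinates.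
Context {R : realType}.
Local Notation C := R[i].
Local Notation Y := (C * 'cV[C]_3)%type.
Implicit Types (a b : 'cV[int]_3) (d g : 'rV[int]_3) (y : Y).

Lemma differentiable_linear (V W : normedModType C) (L : V -> W) (y0 : V) :
  linear L -> continuous L -> differentiable L y0.
Proof.
move=> linL Lc; pose lin_mixin := GRing.isLinear.Build C V W _ L linL.
pose L' : {linear V -> W} := HB.pack L lin_mixin.
exact: (@linear_differentiable _ _ _ L').
Qed.

Lemma differentiable_fst y0 : differentiable (fun y : Y => y.1) y0.
Proof. by apply: differentiable_linear => // y; exact: cvg_fst. Qed.

Lemma differentiable_snd y0 : differentiable (fun y : Y => y.2) y0.
Proof. by apply: differentiable_linear => // y; exact: cvg_snd. Qed.

Lemma differentiable_coord_snd i y0 : differentiable (fun y : Y => y.2 i 0) y0.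
Proof.
apply: (@differentiable_comp _ _ _ _ (fun y : Y => y.2) (fun x : 'cV[C]_3 => x i 0)).
  exact: differentiable_snd.
exact: differentiable_coord.
Qed.

Lemma differentiable_evZ d y0 : differentiable (fun y : Y => evZ d y.2) y0.
Proof.
have -> : (fun y : Y => evZ d y.2) =
    (fun y => (rl (d 0) 0)%:C%C * y.2 0 0 + (rl (d 0) 1)%:C%C * y.2 1 0 + (rl (d 0) 2)%:C%C * y.2 2 0).
  by apply/funext => y; rewrite evZE.
by do !apply: differentiableD; apply: differentiableM;
  (exact: differentiable_cst || exact: differentiable_coord_snd).
Qed.

Lemma differentiable_e2pi (V : normedModType C) (f : V -> C) (y0 : V) :
  differentiable f y0 -> differentiable (fun t => e2pi (f t)) y0.
Proof.
move=> fd; rewrite /e2pi.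
apply: (@differentiable_comp _ _ _ _ (fun t => _ * f t) (@cexp R)).
  by apply: differentiableM => //; exact: differentiable_cst.
exact: differentiable_cexp.
Qed.

Lemma differentiable_mulC (V : normedModType C) (f g : V -> C) (y0 : V) :
  differentiable f y0 -> differentiable g y0 -> differentiable (fun t => f t * g t) y0.
Proof. exact: differentiableM. Qed.

Lemma differentiable_addC (V : normedModType C) (f g : V -> C) (y0 : V) :
  differentiable f y0 -> differentiable g y0 -> differentiable (fun t => f t + g t) y0.
Proof. exact: differentiableD. Qed.

Lemma differentiable_subC (V : normedModType C) (f g : V -> C) (y0 : V) :
  differentiable f y0 -> differentiable g y0 -> differentiable (fun t => f t - g t) y0.
Proof. exact: differentiableB. Qed.

Lemma differentiable_oppC (V : normedModType C) (f : V -> C) (y0 : V) :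
  differentiable f y0 -> differentiable (fun t => - f t) y0.
Proof. exact: differentiableN. Qed.

Lemma differentiable_invC (V : normedModType C) (f : V -> C) (y0 : V) :
  differentiable f y0 -> f y0 != 0 -> differentiable (fun t => (f t)^-1) y0.
Proof. exact: differentiableV. Qed.

Lemma differentiable_cstC (V : normedModType C) (c : C) (y0 : V) :
  differentiable (fun _ : V => c) y0.
Proof. exact: differentiable_cst. Qed.

Lemma differentiable_div (V : normedModType C) (f g : V -> C) (y0 : V) :
  differentiable f y0 -> differentiable g y0 -> g y0 != 0 ->
  differentiable (fun t => f t / g t) y0.
Proof. by move=> fd gd g0; apply: differentiableM => //; exact: differentiableV. Qed.

Lemma differentiable_e2pi_div (V : normedModType C) (f g : V -> C) (y0 : V) :
  differentiable f y0 -> differentiable g y0 -> g y0 != 0 ->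
  differentiable (fun t => e2pi (f t / g t)) y0.
Proof. by move=> fd gd g0; apply: differentiable_e2pi; exact: differentiable_div. Qed.

Lemma differentiable_e2piN_div (V : normedModType C) (f g : V -> C) (y0 : V) :
  differentiable f y0 -> differentiable g y0 -> g y0 != 0 ->
  differentiable (fun t => e2pi (- (f t / g t))) y0.
Proof.
move=> fd gd g0; apply: differentiable_e2pi.
by apply: differentiable_oppC; exact: differentiable_div.
Qed.

Lemma near_neq0 (V : normedModType C) (f : V -> C) (y0 : V) :
  differentiable f y0 -> f y0 != 0 -> \forall t \near y0, f t != 0.
Proof.
by move=> /differentiable_continuous fc f0; exact: (cvgr_neq0 _ fc f0).
Qed.

Lemma continuous_height (c : 'I_3 -> R) : continuous (fun y : Y => height c y.2).
Proof.
have lip_continuous (g : C -> R) : (forall z h, `|g (z + h) - g z| <= nrm h) -> continuous g.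
  move=> g_lip z A /nbhs_ballP[e e0 eA]; apply/nbhs_nrmP.
  exists (e / 2); first by rewrite divr_gt0.
  move=> h he; apply: eA; rewrite -ball_normE /= distrC; apply: (le_lt_trans (g_lip z h)).
  by apply: (le_lt_trans he); move: (e0 : 0 < e); lra.
have Rec : continuous (@complex.Re R).
  apply: lip_continuous => z h; rewrite (_ : _ - _ = complex.Re h) ?Re_le_nrm //.
  by case: z h => ? ? [] ? ? /=; ring.
have Imc : continuous (@complex.Im R).
  apply: lip_continuous => z h; rewrite (_ : _ - _ = complex.Im h) ?Im_le_nrm //.
  by case: z h => ? ? [] ? ? /=; ring.
move=> y.
have cr i : {for y, continuous (fun y : Y => rex y.2 i)}.
  by apply: continuous_comp; [exact: differentiable_continuous (differentiable_coord_snd i y)|exact: Rec].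
have ci i : {for y, continuous (fun y : Y => imx y.2 i)}.
  by apply: continuous_comp; [exact: differentiable_continuous (differentiable_coord_snd i y)|exact: Imc].
have cM (F G : Y -> R) : {for y, continuous F} -> {for y, continuous G} ->
    {for y, continuous (fun t => F t * G t)} by move=> *; exact: continuousM.
have cD (F G : Y -> R) : {for y, continuous F} -> {for y, continuous G} ->
    {for y, continuous (fun t => F t + G t)} by move=> *; exact: continuousD.
have cB (F G : Y -> R) : {for y, continuous F} -> {for y, continuous G} ->
    {for y, continuous (fun t => F t - G t)} by move=> *; exact: continuousB.
have cc (r : R) : {for y, continuous (fun _ : Y => r)} by exact: cst_continuous.
rewrite /height /dot /crs /=.
by apply (cD _ _); [apply (cD _ _)|]; apply (cM _ _); try exact: cc;
  apply (cB _ _); apply (cM _ _); (exact: cr || exact: ci).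
Qed.

Lemma near_V (a : Lprim) y : V a y -> \forall y' \near y, V a y'.
Proof.
move=> /VP h.
have hc : height (rl ((sval a)^~ 0)) y'.2 @[y' --> y] --> height (rl ((sval a)^~ 0)) y.2.
  exact: continuous_height.
have /(_ _ _ h) := cvgr_gt _ hc.
by apply: filterS => y' /VP.
Qed.

End Coordinates.

(** * Direction vectors and classes modulo them *)

Section Directions.
Implicit Types (a b : 'cV[int]_3) (d g : 'rV[int]_3).

Definition independent a b := exists i, crs (a^~ 0) (b^~ 0) i != 0.

Lemma independentC a b : independent a b -> independent b a.
Proof. by move=> [i h]; exists i; rewrite crsN oppr_eq0. Qed.

(** The primitive factor of a x b is a witness for [xget]. The determinant condition, evaluated on
    unit vectors, then gives the coordinates. *)
Lemma directionP a b : independent a b ->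
  primitive (direction a b) /\
  exists2 s : int, 0 < s & forall i, crs (a^~ 0) (b^~ 0) i = s * direction a b 0 i.
Proof.
move=> [i0 i0P].
have detE c : \det (rows3 a^T b^T c^T) = dot (c^~ 0) (crs (a^~ 0) (b^~ 0)).
  rewrite det3 dot_crs_perm dot_crs_perm; congr (dot _ (crs _ _));
    by apply/funext => i; rewrite !mxE /= ?mxE.
have [|s s0 [g gP gE]] := @exists_primitive_factor 3 (\row_i crs (a^~ 0) (b^~ 0) i).
  by apply/eqP => /matrixP/(_ 0 i0)/eqP; rewrite !mxE; apply/negP.
have [dP [t t0 tP]] : is_direction a b (direction a b).
  apply: (@xgetPex _ 0 [set g | is_direction a b g]).
  exists g; split=> //; exists s => // c; rewrite detE evE.
  have crsE i : crs (a^~ 0) (b^~ 0) i = s * g 0 i.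
    by have /matrixP/(_ 0 i) := gE; rewrite !mxE.
  by rewrite /dot !crsE; ring.
split=> //; exists t => // i.
have := tP (delta_mx i 0); rewrite detE evE.
move: i; apply: ord3P; rewrite /dot !mxE /= !(mul0r, mul1r, mulr0, mulr1, add0r, addr0);
  by move=> ->.
Qed.

Section IndependentPair.
Variables (a b : 'cV[int]_3).
Hypothesis ab : independent a b.
Let g := direction a b.

Lemma ev_direction_l : ev g a = 0.
Proof.
have [_ [s s0 sP]] := directionP ab; apply: (mulfI (lt0r_neq0 s0)).
rewrite mulr0 evE -[RHS](dot_crsl (a^~ 0) (b^~ 0)) /dot !sP; ring.
Qed.

Lemma ev_direction_r : ev g b = 0.
Proof.
have [_ [s s0 sP]] := directionP ab; apply: (mulfI (lt0r_neq0 s0)).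
rewrite mulr0 evE -[RHS](dot_crsr (a^~ 0) (b^~ 0)) /dot !sP; ring.
Qed.

(** The product (a x b) x d vanishes, so [d] is proportional to a x b, hence to the direction;
    primitivity makes the ratio an integer. *)
Lemma ev_kernel d : ev d a = 0 -> ev d b = 0 -> exists k : int, d = k *: g.
Proof.
rewrite !evE => da db; have [gP [s s0 sP]] := directionP ab.
have [i0 i0P] := ab; have cc0 := dot_self_gt0 i0P.
pose c := crs (a^~ 0) (b^~ 0).
apply: (@primitive_factor_eq _ _ (dot c c) (dot c (d 0) * s)) => //; first exact: lt0r_neq0.
apply/matrixP => i j; rewrite ord1 !mxE -mulrA -sP.
apply: crs0_proportional => k.
rewrite /c crs_crs (dotC _ (d 0)) da (dotC _ (d 0)) db; ring.
Qed.

(** Both directions are primitive and b x a = -(a x b), so they differ by a unit k, and positivity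
    of the two multipliers leaves k = -1. *)
Lemma direction_swap : direction b a = - g.
Proof.
have [gP [s s0 sP]] := directionP ab.
have [g'P [t t0 tP]] := directionP (independentC ab).
have tg : t *: direction b a = - s *: g.
  by apply/matrixP => i j; rewrite ord1 !mxE -tP crsN sP mulNr.
have [k kE] := primitive_factor_eq (lt0r_neq0 t0) gP tg.
have k1 := g'P _ _ kE.
have [i gi] : exists i, g 0 i != 0.
  by have [j] := ab; rewrite sP mulf_eq0 negb_or => /andP[_ ?]; exists j.
have : t * k = - s.
  apply: (mulIf gi); have /matrixP/(_ 0 i) := tg; rewrite kE !mxE => <-; ring.
move=> tk; have -> : direction b a = (-1) *: g.
  rewrite kE; congr (_ *: _); move: k1 tk s0 t0; clear.
  by case: (ltrgt0P k) => [k0 -> |k0 kk|-> ] *; nia.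
by rewrite scaleN1r.
Qed.

End IndependentPair.

Lemma Zorbit_eq g d d' k : d' = d + k *: g -> Zorbit g d' = Zorbit g d.
Proof.
move=> ->; apply/seteqP; split=> _ [l _ <-].
  by exists (k + l) => //; rewrite scalerDl addrA.
by exists (l - k) => //; rewrite scalerBl -addrA; congr (_ + _); rewrite addrC subrK.
Qed.

(** The direction vanishes on [a] and [b], so both values are constant on a class and the
    representative chosen by [xget] inherits the defining inequalities. *)
Lemma CpmP a b (K : set 'rV[int]_3) : independent a b -> Cpm a b K ->
  [/\ K (xget 0 K), 0 < ev (xget 0 K) a, ev (xget 0 K) b <= 0 &
      K = Zorbit (direction a b) (xget 0 K)].
Proof.
move=> ab [d [/= da db] <-].
have Kd : Zorbit (direction a b) d d by exists 0 => //; rewrite scale0r addr0.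
have [k _ kE] : Zorbit (direction a b) d (xget 0 (Zorbit (direction a b) d)).
  by apply: xgetPex; exists d.
rewrite -kE.
have evk c : ev (direction a b) c = 0 -> ev (d + k *: direction a b) c = ev d c.
  by rewrite !evE /dot !mxE => h; rewrite -[RHS]addr0 -(mulr0 k) -h; ring.
rewrite !evk ?ev_direction_l ?ev_direction_r //; split=> //.
  by exists k.
exact/esym/Zorbit_eq.
Qed.

(** By [ev_kernel] the pair of values on [a] and [b] labels classes injectively, which lets a double
    geometric series dominate a product over classes. *)
Lemma Cpm_inj a b (K K' : set 'rV[int]_3) : independent a b -> Cpm a b K -> Cpm a b K' ->
  ev (xget 0 K) a = ev (xget 0 K') a -> ev (xget 0 K) b = ev (xget 0 K') b -> K = K'.
Proof.
move=> ab /(CpmP ab)[_ _ _ KE] /(CpmP ab)[_ _ _ K'E] ea eb.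
have sub0 c : ev (xget 0 K) c = ev (xget 0 K') c -> ev (xget 0 K - xget 0 K') c = 0.
  by move=> /eqP; rewrite -subr_eq0 !evE /dot !mxE => /eqP <-; ring.
have [k kE] := ev_kernel ab (sub0 _ ea) (sub0 _ eb).
rewrite KE K'E; apply: (@Zorbit_eq _ _ _ k).
by rewrite -kE addrC subrK.
Qed.

Lemma Zorbit_subl a b d d' (K : set 'rV[int]_3) : independent a b -> Cpm a b K -> K d ->
  0 < ev d a /\ ev d b <= 0.
Proof.
move=> ab /(CpmP ab)[_ da db ->] [k _ <-].
have evk c : ev (direction a b) c = 0 -> ev (xget 0 K + k *: direction a b) c = ev (xget 0 K) c.
  by rewrite !evE /dot !mxE => h; rewrite -[RHS]addr0 -(mulr0 k) -h; ring.
by rewrite !evk ?ev_direction_l ?ev_direction_r.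
Qed.

End Directions.

(** * Two planes whose sets V_a and V_b meet *)

Section PairOfPlanes.
Context {R : realType}.
Local Notation C := R[i].
Local Notation Y := (C * 'cV[C]_3)%type.

(** Dependent primitive vectors differ by a sign, and opposite vectors have opposite heights. *)
Lemma V_independent (a b : Lprim) (y : Y) : V a y -> V b y -> sval a != sval b ->
  independent (sval a) (sval b).
Proof.
move=> /VP ha /VP hb; apply: contraNP => /forallNP ab0.
have {}ab0 i : crs ((sval a)^~ 0) ((sval b)^~ 0) i = 0.
  by apply/eqP/negP => /negP; exact: ab0.
have [i ai] : exists i, sval a i 0 != 0.
  apply: contrapT => /forallNP H; have /eqP := primitive_neq0 (svalP a); apply.
  by apply/matrixP => i j; rewrite ord1 mxE; apply/eqP/negP => /negP; exact: H.
have aa0 := @dot_self_gt0 _ ((sval a)^~ 0) i ai.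
have [|k kE] := @primitive_factor_eq _ _ _ (dot ((sval a)^~ 0) ((sval b)^~ 0)) (sval b) (sval a)
  (lt0r_neq0 aa0) (svalP a).
  by apply/matrixP => j l; rewrite ord1 !mxE; exact: crs0_proportional.
have k1 := svalP b _ _ kE.
have : height (rl ((sval b)^~ 0)) y.2 = k%:~R * height (rl ((sval a)^~ 0)) y.2.
  rewrite -heightZ; congr height; apply/funext => j.
  by rewrite /rl kE mxE rmorphM.
move=> hE; move: hb; rewrite hE pmulr_lgt0 // ltr0z => k0.
apply/eqP; rewrite kE (_ : k = 1) ?scale1r //.
by rewrite -k1 gtr0_norm.
Qed.

Lemma Im_div (z w : C) : complex.Im (z / w) = complex.Im (z * conjc w) / nrm w ^+ 2.
Proof. by rewrite nrm_sqr; case: z w => [? ?] [? ?] /=; ring. Qed.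

Lemma evZD d e (x : 'cV[C]_3) : evZ (d + e) x = evZ d x + evZ e x.
Proof. by rewrite !evZE /dot /rl !mxE !rmorphD /=; ring. Qed.

Lemma evZZ (k : int) d (x : 'cV[C]_3) : evZ (k *: d) x = k%:~R * evZ d x.
Proof. by rewrite !evZE /dot /rl !mxE !rmorphM /= -!(rmorph_int (real_complex R)); ring. Qed.

Lemma evZN d (x : 'cV[C]_3) : evZ (- d) x = - evZ d x.
Proof. by rewrite -scaleN1r evZZ mulN1r. Qed.

Lemma evZB d e (x : 'cV[C]_3) : evZ (d - e) x = evZ d x - evZ e x.
Proof. by rewrite evZD evZN. Qed.

(* For [c] in {a, b} and [v] the direction itself, the form [det(c, v, -)]
   generates together with [direction a b] the plane H(c). *)
Lemma Im_edge_div (a b : Lprim) (c : 'cV[int]_3) (y : Y) :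
  independent (sval a) (sval b) -> c = sval a \/ c = sval b ->
  0 < height (rl (c^~ 0)) y.2 ->
  complex.Im (evZ (\row_i crs (c^~ 0) (direction (sval a) (sval b) 0) i) y.2
              / evZ (direction (sval a) (sval b)) y.2) < 0.
Proof.
move=> ab cab hc; set g := direction _ _.
have gc : dot (g 0) (c^~ 0) = 0.
  by rewrite -evE; case: cab => ->; rewrite ?ev_direction_l ?ev_direction_r.
have [i gi] : exists i, g 0 i != 0.
  have [_ [s s0 sP]] := directionP ab; have [j] := ab.
  by rewrite sP mulf_eq0 negb_or => /andP[_ ?]; exists j.
have gg0 := dot_self_gt0 gi.
(* Here (c x g) x g = -|g|^2 c, because c is orthogonal to g. *)
have E : complex.Im (evZ (\row_i crs (c^~ 0) (g 0) i) y.2 * conjc (evZ g y.2)) =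
    - ((dot (g 0) (g 0))%:~R * height (rl (c^~ 0)) y.2).
  rewrite Im_evZ_conj -mulNr -heightZ; congr height; apply/funext => j.
  rewrite /rl -rmorphN -rmorphM; congr (_%:~R).
  rewrite (_ : (\row_i0 _) 0 = crs (c^~ 0) (g 0)); last by apply/funext => k; rewrite mxE.
  by rewrite crs_crs (dotC (c^~ 0)) gc; ring.
have g0 : evZ g y.2 != 0.
  apply/eqP => gy; move: E; rewrite gy conjc0 mulr0 /= => /eqP.
  rewrite eq_sym oppr_eq0 mulf_eq0 intr_eq0.
  by rewrite (gt_eqF gg0) (gt_eqF hc).
rewrite Im_div E pmulr_llt0 ?oppr_lt0 ?mulr_gt0 ?ltr0z //.
by rewrite invr_gt0 exprn_gt0 // nrm_gt0.
Qed.

(** If gamma(x) vanished, the quotient in [Im_edge_div] would be 0 by convention, against the strict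
    sign of its imaginary part. *)
Lemma direction_neq0 (a b : Lprim) (y : Y) : independent (sval a) (sval b) -> V a y ->
  evZ (direction (sval a) (sval b)) y.2 != 0.
Proof.
move=> ab /VP ha; apply/eqP => g0.
have := Im_edge_div ab (or_introl erefl) ha.
by rewrite g0 invr0 mulr0 ltxx.
Qed.

End PairOfPlanes.

(** * Divisors supported on the hyperplanes w = delta(x) *)

Section NumeratorBounds.
Context {R : realType}.
Local Notation C := R[i].
Local Notation Y := (C * 'cV[C]_3)%type.

Lemma lipn_eq_ball (V : normedModType C) (y : V) (e : R) (f g : V -> C) M : 0 < e ->
  (forall h, nrm h <= e -> f (y + h) = g (y + h)) -> lipn y e f M -> lipn y e g M.
Proof.
move=> e0 fg [fM fL].
have fgy : f y = g y by have := fg 0; rewrite addr0 nrm0 => /(_ (ltW e0)).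
by split; rewrite -fgy // => h he; rewrite -fg // fL.
Qed.

Lemma near_ball (V : normedModType C) (y : V) (P : V -> Prop) : (\forall z \near y, P z) ->
  exists2 e0 : R, 0 < e0 & forall e, e <= e0 -> forall h, nrm h <= e -> P (y + h).
Proof.
by move=> /nbhs_nrmP[e e0 eP]; exists e => // e' e'e h he; apply: eP; exact: le_trans e'e.
Qed.

Let midpoint_gt (x : R) : x < 1 -> x < (x + 1) / 2. Proof. lra. Qed.

Let midpoint_itv (x : R) : 0 <= x -> x < 1 -> 0 <= (x + 1) / 2 < 1. Proof. by move=> *; lra. Qed.

Lemma differentiable_num_factor (a b : 'cV[int]_3) (K : set 'rV[int]_3) (y : Y) :
  evZ (direction a b) y.2 != 0 ->
  differentiable (fun z : Y => Gamma_num_factor a b z.1 z.2 K) y.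
Proof.
move=> g0; apply: differentiable_subC; first exact: differentiable_cstC.
apply: (@differentiable_e2piN_div _ _ (fun z : Y => evZ (xget 0 K) z.2 - z.1)
  (fun z : Y => evZ (direction a b) z.2)); [|exact: differentiable_evZ|exact: g0].
exact: differentiable_subC (differentiable_evZ _ _) (differentiable_fst _).
Qed.

Let absz_inj_pos (m n : int) : 0 < m -> 0 < n -> `|m|%N = `|n|%N -> m = n. Proof. lia. Qed.

Let absz_inj_neg (m n : int) : m <= 0 -> n <= 0 -> `|m|%N = `|n|%N -> m = n. Proof. lia. Qed.

Let abszE_pos (m : int) : 0 < m -> m = `|m|%N%:Z. Proof. lia. Qed.

Let abszE_neg (m : int) : m <= 0 -> m = - `|m|%N%:Z. Proof. lia. Qed.

(* If [s' delta = m alpha + n beta + k gamma], the factor attached to [delta] is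
   [e(w/gamma) e(-alpha/(s' gamma))^m e(-beta/(s' gamma))^n] up to a constant of
   modulus 1; both bases have modulus < 1 on [V a `&` V b]. *)
Lemma lipn_num_factor (a b : Lprim) (y0 : Y) : V a y0 -> V b y0 -> sval a != sval b ->
  exists2 e : R, 0 < e & exists2 M : set 'rV[int]_3 -> R, sumb (Cpm (sval a) (sval b)) M &
  forall K, Cpm (sval a) (sval b) K ->
    lipn y0 e (fun y => Gamma_num_factor (sval a) (sval b) y.1 y.2 K - 1) (M K).
Proof.
move=> Va Vb neq.
have ab := V_independent Va Vb neq.
set g := direction (sval a) (sval b).
have g0 : evZ g y0.2 != 0 := direction_neq0 ab Va.
(* [al] vanishes on [b] and [be] on [a]; their remaining values are s' and -s'. Hence s' times any
   form is an integral combination of them modulo the direction. *)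
pose al : 'rV[int]_3 := \row_i crs ((sval b)^~ 0) (g 0) i.
pose be : 'rV[int]_3 := \row_i crs ((sval a)^~ 0) (g 0) i.
have [s s0 sP] := (directionP ab).2.
have [j0 gj0] : exists j, g 0 j != 0.
  by have [j] := ab; rewrite sP mulf_eq0 negb_or => /andP[_ ?]; exists j.
have gg0 := dot_self_gt0 gj0.
pose s' := s * dot (g 0) (g 0).
have s'0 : 0 < s' by rewrite mulr_gt0.
have rowE (c : 'I_3 -> int) : (\row_i c i) 0 = c by apply/funext => k; rewrite mxE.
have al_a : ev al (sval a) = s'.
  by rewrite evE rowE dotC dot_crs_perm dot_crs_perm /s' /dot !sP -/g; ring.
have al_b : ev al (sval b) = 0 by rewrite evE rowE dotC dot_crsl.
have be_a : ev be (sval a) = 0 by rewrite evE rowE dotC dot_crsl.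
have be_b : ev be (sval b) = - s'.
  by rewrite evE rowE dotC dot_crs_perm dot_crs_perm crsN /s' /dot !sP -/g; ring.
pose w1 (y : Y) := e2pi (y.1 / evZ g y.2).
pose q (y : Y) := e2pi (- (evZ al y.2 / (s'%:~R * evZ g y.2))).
pose p (y : Y) := e2pi (- (evZ be y.2 / (s'%:~R * evZ g y.2))).
have s'C : s'%:~R != 0 :> C by rewrite intr_eq0 lt0r_neq0.
have evd d y : differentiable (fun y : Y => evZ d y.2) y by exact: differentiable_evZ.
have edged d : differentiable (fun y : Y => e2pi (- (evZ d y.2 / (s'%:~R * evZ g y.2)))) y0.
  apply: (@differentiable_e2piN_div _ _ (fun y : Y => evZ d y.2)
    (fun y : Y => s'%:~R * evZ g y.2)); [exact: evd| |by rewrite mulf_neq0].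
  exact: differentiable_mulC (differentiable_cstC _ _) (evd _ _).
have w1d : differentiable w1 y0.
  apply: (@differentiable_e2pi_div _ _ (fun y : Y => y.1) (fun y : Y => evZ g y.2)).
  - exact: differentiable_fst.
  - exact: evd.
  - exact: g0.
have edge_lt1 c : c = sval a \/ c = sval b -> 0 < height (rl (c^~ 0)) y0.2 ->
    nrm (e2pi (- (evZ (\row_i crs (c^~ 0) (g 0) i) y0.2 / (s'%:~R * evZ g y0.2)))) < 1.
  move=> cab hc; apply: nrm_e2pi_lt1.
  have := Im_edge_div ab cab hc; rewrite -/g.
  set z := evZ (\row_i _) _; rewrite invfM mulrCA; move: (z / _) => {z}z.
  rewrite -(rmorph_int (real_complex R)) -fmorphV.
  have -> (t : R) (v : C) : complex.Im (- (t%:C%C * v)) = t * - complex.Im v.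
    by case: v => ? ? /=; ring.
  by move=> zlt; rewrite mulr_gt0 ?invr_gt0 ?ltr0z // oppr_gt0.
have q1 := edge_lt1 _ (or_intror erefl) ((VP b y0).1 Vb).
have p1 := edge_lt1 _ (or_introl erefl) ((VP a y0).1 Va).
rewrite -/al -/(q y0) in q1; rewrite -/be -/(p y0) in p1.
(* The midpoints leave room for [lipn_small] while the ratios stay below 1. *)
pose rho := (nrm (q y0) + 1) / 2; pose sigma := (nrm (p y0) + 1) / 2.
have [eq eq0 eqP] := lipn_small (c := rho) (edged al) (midpoint_gt q1).
have [ep ep0 epP] := lipn_small (c := sigma) (edged be) (midpoint_gt p1).
have [ew ew0 ewP] := lipn_small (c := nrm (w1 y0) + 1) w1d (ltr_pwDr ltr01 (lexx _)).
have [eg eg0 egP] := near_ball (near_neq0 (evd g y0) g0).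
pose e := Num.min (Num.min eq ep) (Num.min ew eg).
have e0 : 0 < e by rewrite !lt_min eq0 ep0 ew0.
have [[eeq eep] [eew eeg]] : (e <= eq /\ e <= ep) /\ (e <= ew /\ e <= eg).
  by rewrite /e !ge_min !lexx !orbT.
pose deg (K : set 'rV[int]_3) :=
  (`|(ev (xget 0 K) (sval a))%R|%N, `|(ev (xget 0 K) (sval b))%R|%N).
exists e => //.
exists (fun K => (nrm (w1 y0) + 1) * (rho ^+ (deg K).1 * sigma ^+ (deg K).2)).
  apply: sumbZ; first by rewrite addr_ge0 ?nrm_ge0.
  apply: sumb_geometric2.
  - exact: midpoint_itv (nrm_ge0 _) q1.
  - exact: midpoint_itv (nrm_ge0 _) p1.
  (* On these classes the signs of both values are fixed, so the absolute values determine them. *)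
  - move=> K K' KC K'C [ea eb]; apply: (Cpm_inj ab) => //.
      by have [_ ? _ _] := CpmP ab KC; have [_ ? _ _] := CpmP ab K'C; exact: absz_inj_pos.
    by have [_ _ ? _] := CpmP ab KC; have [_ _ ? _] := CpmP ab K'C; exact: absz_inj_neg.
move=> K KC; have [_ da db _] := CpmP ab KC.
set d := xget 0 K in da db; set m := (deg K).1; set n := (deg K).2.
have mE : ev d (sval a) = m%:Z by exact: abszE_pos.
have nE : ev d (sval b) = - n%:Z by exact: abszE_neg.
have [k kE] : exists k : int, s' *: d - (m%:Z *: al + n%:Z *: be) = k *: g.
  have evl c : ev (s' *: d - (m%:Z *: al + n%:Z *: be)) c =
      s' * ev d c - (m%:Z * ev al c + n%:Z * ev be c).
    by rewrite !evE /dot !mxE; ring.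
  by apply: (ev_kernel ab); rewrite evl ?al_a ?be_a ?al_b ?be_b ?mE ?nE; ring.
pose r : R := - (k%:~R / s'%:~R).
have facE y : evZ g y.2 != 0 ->
   - (w1 y * (q y ^+ m * p y ^+ n) * e2pi r%:C%C) =
   Gamma_num_factor (sval a) (sval b) y.1 y.2 K - 1.
  move=> gy; rewrite /Gamma_num_factor -/g -/d addrAC subrr add0r; congr (- _).
  rewrite -!e2piMn -!e2piD; apply: (congr1 e2pi).
  have := congr1 (fun t => evZ t y.2) kE; rewrite evZB evZD !evZZ => E.
  have rE : r%:C%C = - (k%:~R / s'%:~R) :> C.
    by rewrite /r rmorphN fmorph_div /= !rmorph_int.
  have dE : evZ d y.2 = ((m%:Z%:~R * evZ al y.2 + n%:Z%:~R * evZ be y.2) + k%:~R * evZ g y.2) / s'%:~R.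
    by rewrite -E; field.
  by rewrite rE dE -!pmulrn; field; rewrite gy s'C.
pose f y : C := - (w1 y * (q y ^+ m * p y ^+ n) * e2pi r%:C%C).
apply: (@lipn_eq_ball _ _ e f _ _ e0).
  by move=> h he; apply: facE; exact: egP eeg h he.
rewrite /f.
apply: lipnN.
have Lq := lipnX e0 m (eqP _ e0 eeq); have Lp := lipnX e0 n (epP _ e0 eep).
have := lipnM e0 (lipnM e0 (ewP _ e0 eew) (lipnM e0 Lq Lp)) (lipn_cst y0 e (e2pi r%:C%C)).
by rewrite nrm_e2pi_real mulr1.
Qed.

End NumeratorBounds.

Section Divisors.
Context {R : realType}.
Local Notation C := R[i].
Local Notation Y := (C * 'cV[C]_3)%type.
Implicit Types (d : 'rV[int]_3) (y z : Y) (F G u v : Y -> C) (m n : 'rV[int]_3 -> int).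

Definition hyp d y : C := y.1 - evZ d y.2.

Lemma differentiable_hyp d y : differentiable (hyp d) y.
Proof. exact: differentiable_subC (differentiable_fst _) (differentiable_evZ _ _). Qed.

(** If the point found so far lies on the next hyperplane, a small shift of the coordinate w moves
    it off. *)
Lemma nonvanishing_dense (B : seq 'rV[int]_3) (O : set Y) : open O -> O !=set0 ->
  exists U' : set Y, [/\ open U', U' `<=` O, U' !=set0 &
    forall y, U' y -> forall d, d \in B -> hyp d y != 0].
Proof.
elim: B O => [|d B IH] O Oo O0; first by exists O; split=> // y Oy d; rewrite in_nil.
have [U1 [U1o U1O [y U1y] U1B]] := IH O Oo O0.
pose U2 := U1 `&` [set z | hyp d z != 0].
have U2o : open U2.
  rewrite openE => z [U1z dz]; apply: filterI; first exact: open_nbhs_nbhs.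
  by have := near_neq0 (differentiable_hyp d z) dz; apply: filterS.
exists U2; split=> //.
- by move=> z [/U1O].
- have [dy|dy] := eqVneq (hyp d y) 0; last by exists y.
  have /nbhs_nrmP[e e0 eP] : nbhs y U1 by exact: open_nbhs_nbhs.
  pose k : Y := (1, 0); have k0 : 0 < nrm k + 1 by rewrite ltr_wpDl ?nrm_ge0.
  pose t : C := ((e / (nrm k + 1))%:C)%C.
  have t0 : t != 0 by rewrite -nrm_eq0 nrm_real normr_eq0 gt_eqF // divr_gt0.
  exists (y + t *: k); split.
    apply: eP; rewrite nrmZ nrm_real ger0_norm ?(ltW (divr_gt0 e0 k0)) //.
    by rewrite mulrAC ler_pdivrMr // ler_wpM2l ?lerDl // ltW.
  rewrite /= /hyp /= scaler0 addr0 addrAC -/(hyp d y) dy add0r.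
  by rewrite -[_ *: _]/(t * 1) mulr1.
- move=> z [U1z dz] d'; rewrite inE => /predU1P[->//|]; exact: U1B.
Qed.

Lemma nearT y0 (P : Y -> Prop) : (forall y, P y) -> \forall y \near y0, P y.
Proof. by move=> H; apply/nbhs_nrmP; exists 1. Qed.

(* Generic validity near [y0]: every divisor occurring below is, near a given
   point, a finite union of hyperplanes [hyp d = 0]. *)
Definition gnear y0 (P : Y -> Prop) := exists B : seq 'rV[int]_3,
  \forall y \near y0, (forall d, d \in B -> hyp d y != 0) -> P y.

Lemma gnearW y0 (P : Y -> Prop) : (\forall y \near y0, P y) -> gnear y0 P.
Proof. by move=> H; exists [::]; apply: filterS H. Qed.

Lemma gnear_hyp y0 (B : seq 'rV[int]_3) : gnear y0 (fun y => forall d, d \in B -> hyp d y != 0).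
Proof. by exists B; apply: nearT => y yB d /yB. Qed.

Lemma gnearS y0 (P Q : Y -> Prop) : (forall y, P y -> Q y) -> gnear y0 P -> gnear y0 Q.
Proof. by move=> PQ [B BP]; exists B; apply: filterS BP => y yP /yP /PQ. Qed.

Lemma gnearI y0 (P Q : Y -> Prop) : gnear y0 P -> gnear y0 Q -> gnear y0 (fun y => P y /\ Q y).
Proof.
move=> [B BP] [B' BQ]; exists (B ++ B'); apply: filterS2 BP BQ => y yP yQ yB.
by split; [apply: yP => d dB|apply: yQ => d dB]; apply: yB; rewrite mem_cat dB ?orbT.
Qed.

Lemma gnear_open y0 (P : Y -> Prop) (O : set Y) : gnear y0 P -> open O -> O y0 ->
  exists U' : set Y, [/\ open U', U' `<=` O, U' !=set0 & forall y, U' y -> P y].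
Proof.
move=> [B BP] Oo Oy.
have : nbhs y0 (O `&` [set y | (forall d, d \in B -> hyp d y != 0) -> P y]).
  by apply: filterI => //; exact: open_nbhs_nbhs.
rewrite nbhsE => -[U1 [U1o U1y] U1P].
have [|U2 [U2o U2U1 U20 U2B]] := @nonvanishing_dense B U1 U1o; first by exists y0.
by exists U2; split=> // y U2y; have [? H] := U1P _ (U2U1 _ U2y); [|apply: H; exact: U2B].
Qed.

Lemma gnear_ex y0 (P : Y -> Prop) : gnear y0 P -> exists y, P y.
Proof.
move=> H; have [U [_ _ [y Uy] UP]] := gnear_open H openT I.
by exists y; exact: UP.
Qed.

Lemma gnear_near y0 (P : Y -> Prop) : gnear y0 P -> \forall y \near y0, gnear y P.
Proof.
by move=> [B]; rewrite -nbhs_nearE => /nbhs_interior; apply: filterS => y yP; exists B.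
Qed.

(** Values that differ at [y0] differ on a neighbourhood, which meets the dense complement of the
    exceptional hyperplanes. *)
Lemma eq_germ y0 u v : differentiable u y0 -> differentiable v y0 ->
  gnear y0 (fun y => u y = v y) -> u y0 = v y0.
Proof.
move=> ud vd uv; apply/eqP; rewrite -subr_eq0; apply: contrapT => /negP uv0.
have /gnearW uvn := near_neq0 (differentiable_subC ud vd) uv0.
have [y [uvy]] := gnear_ex (gnearI uv uvn).
by rewrite uvy subrr eqxx.
Qed.

Definition germ_unit u y0 := \forall y \near y0, differentiable u y /\ u y != 0.

Lemma germ_unit_at u y0 : germ_unit u y0 -> differentiable u y0 /\ u y0 != 0.
Proof. exact: nbhs_singleton. Qed.

Lemma germ_unit_near u y0 : germ_unit u y0 -> \forall y \near y0, germ_unit u y.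
Proof. exact: nbhs_interior. Qed.

Lemma germ_unitI u y0 : (\forall y \near y0, differentiable u y) -> u y0 != 0 -> germ_unit u y0.
Proof.
move=> ud u0; have := near_neq0 (nbhs_singleton ud) u0.
by apply: filterS2 ud => y.
Qed.

Lemma germ_unitM u v y0 : germ_unit u y0 -> germ_unit v y0 -> germ_unit (fun y => u y * v y) y0.
Proof.
apply: filterS2 => y [ud u0] [vd v0]; split; first exact: differentiable_mulC.
by rewrite mulf_neq0.
Qed.

Lemma germ_unitV u y0 : germ_unit u y0 -> germ_unit (fun y => (u y)^-1) y0.
Proof.
apply: filterS => y [ud u0]; split; first exact: differentiable_invC.
by rewrite invr_neq0.
Qed.

Lemma germ_unit1 y0 : germ_unit (fun _ => 1) y0.
Proof. by apply: nearT => y; split; [exact: differentiable_cstC|exact: oner_neq0]. Qed.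

(* Near [y0], [F] is a unit times the product of the [hyp d ^ m d] over the [d]
   with [hyp d y0 = 0]; the equality is only required generically, because [F]
   may take junk values on its divisor. *)
Definition hasdiv F m y0 := exists (B : seq 'rV[int]_3) u,
  [/\ uniq B, forall d, d \in B -> hyp d y0 = 0,
      forall d, hyp d y0 = 0 -> d \notin B -> m d = 0, germ_unit u y0 &
      gnear y0 (fun y => F y = u y * \prod_(d <- B) hyp d y ^ m d)].

Lemma hasdiv_eq_gnear F G m y0 : gnear y0 (fun y => F y = G y) -> hasdiv F m y0 -> hasdiv G m y0.
Proof.
move=> FG [B [u [Bu B0 Bm uu uF]]]; exists B, u; split=> //.
by apply: gnearS (gnearI FG uF) => y [<- ->].
Qed.

Lemma hasdiv_eq_mult F m n y0 : (forall d, hyp d y0 = 0 -> m d = n d) ->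
  hasdiv F m y0 -> hasdiv F n y0.
Proof.
move=> mn [B [u [Bu B0 Bm uu uF]]]; exists B, u; split=> //.
  by move=> d d0 dB; rewrite -mn // Bm.
apply: gnearS uF => y ->; congr (_ * _); apply: eq_big_seq => d /B0 d0.
by rewrite mn.
Qed.

Lemma hasdiv_unit u y0 : germ_unit u y0 -> hasdiv u (fun _ => 0) y0.
Proof.
move=> uu; exists [::], u; split=> //; apply: gnearW.
by apply: nearT => y; rewrite big_nil mulr1.
Qed.

(** The hyperplanes added to [B] carry exponent 0; this gives the two factors of a product a common
    list. *)
Lemma hasdiv_enlarge F m y0 (B B' : seq 'rV[int]_3) u :
  (forall d, hyp d y0 = 0 -> d \notin B -> m d = 0) ->
  gnear y0 (fun y => F y = u y * \prod_(d <- B) hyp d y ^ m d) ->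
  uniq B -> uniq B' -> {subset B <= B'} -> (forall d, d \in B' -> hyp d y0 = 0) ->
  gnear y0 (fun y => F y = u y * \prod_(d <- B') hyp d y ^ m d).
Proof.
move=> Bm uF Bu B'u BB' B'0; apply: gnearS uF => y ->; congr (_ * _).
rewrite [RHS](bigID (mem B)) /= [X in _ = _ * X]big_seq_cond [X in _ = _ * X]big1 ?mulr1.
  rewrite -[RHS]big_filter; apply: perm_big; apply: uniq_perm; rewrite ?filter_uniq //.
  by move=> d; rewrite mem_filter /= andb_idr // => /BB'.
by move=> d /andP[/B'0 d0 dB]; rewrite Bm // expr0z.
Qed.

Lemma hasdivM F G m n y0 : hasdiv F m y0 -> hasdiv G n y0 ->
  hasdiv (fun y => F y * G y) (fun d => m d + n d) y0.
Proof.
move=> [B1 [u [B1u B10 B1m uu uF]]] [B2 [v [B2u B20 B2n vv vG]]].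
pose B := undup (B1 ++ B2).
have B1B : {subset B1 <= B} by move=> d dB; rewrite mem_undup mem_cat dB.
have B2B : {subset B2 <= B} by move=> d dB; rewrite mem_undup mem_cat dB orbT.
have B0 d : d \in B -> hyp d y0 = 0.
  by rewrite mem_undup mem_cat => /orP[/B10|/B20].
have {}uF := hasdiv_enlarge B1m uF B1u (undup_uniq _) B1B B0.
have {}vG := hasdiv_enlarge B2n vG B2u (undup_uniq _) B2B B0.
exists B, (fun y => u y * v y); split=> //.
- exact: undup_uniq.
- move=> d d0 dB; rewrite B1m ?B2n ?addr0 //; apply: contra dB; [exact: B2B|exact: B1B].
- exact: germ_unitM.
(* Exponents add only off the hyperplanes: at the base 0 the exponents 1 and -1 give the product 0,
   but their sum gives 1. *)
- apply: gnearS (gnearI (gnear_hyp y0 B) (gnearI uF vG)) => y [yB [-> ->]].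
  rewrite mulrACA -big_split /=; congr (_ * _); apply: eq_big_seq => d dB.
  by rewrite expfzDr // yB.
Qed.

Lemma hasdivV F m y0 : hasdiv F m y0 -> hasdiv (fun y => (F y)^-1) (fun d => - m d) y0.
Proof.
move=> [B [u [Bu B0 Bm uu uF]]]; exists B, (fun y => (u y)^-1); split=> //.
- by move=> d d0 dB; rewrite Bm ?oppr0.
- exact: germ_unitV.
- apply: gnearS uF => y ->; rewrite invfM -prodfV; congr (_ * _).
  by apply: eq_bigr => d _; rewrite invr_expz.
Qed.

Lemma hasdiv_prod (I : Type) (r : seq I) (P : pred I) (F : I -> Y -> C)
    (m : I -> 'rV[int]_3 -> int) y0 : (forall i, P i -> hasdiv (F i) (m i) y0) ->
  hasdiv (fun y => \prod_(i <- r | P i) F i y) (fun d => \sum_(i <- r | P i) m i d) y0.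
Proof.
move=> Fm; elim: r => [|i r IH].
  apply: hasdiv_eq_gnear (hasdiv_eq_mult _ (hasdiv_unit (germ_unit1 y0))).
    by apply: gnearW; apply: nearT => y; rewrite big_nil.
  by move=> d _; rewrite big_nil.
case: (boolP (P i)) => Pi.
  apply: hasdiv_eq_gnear (hasdiv_eq_mult _ (hasdivM (Fm i Pi) IH)).
    by apply: gnearW; apply: nearT => y; rewrite big_cons Pi.
  by move=> d _; rewrite big_cons Pi.
apply: hasdiv_eq_gnear (hasdiv_eq_mult _ IH).
  by apply: gnearW; apply: nearT => y; rewrite big_cons (negbTE Pi).
by move=> d _; rewrite big_cons (negbTE Pi).
Qed.

Lemma hasdiv_gnear_neq0 F m y0 : hasdiv F m y0 -> gnear y0 (fun y => F y != 0).
Proof.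
move=> [B [u [_ _ _ /gnearW uu uF]]].
apply: gnearS (gnearI (gnear_hyp y0 B) (gnearI uu uF)) => y [yB [[_ u0] ->]].
rewrite mulf_neq0 // prodf_seq_neq0; apply/allP => d dB.
by rewrite expfz_neq0 // yB.
Qed.

Lemma hasdiv0_germ F y0 : hasdiv F (fun _ => 0) y0 ->
  exists2 u, germ_unit u y0 & gnear y0 (fun y => F y = u y).
Proof.
move=> [B [u [_ _ _ uu uF]]]; exists u => //; apply: gnearS uF => y ->.
by rewrite big1 ?mulr1 // => d _; rewrite expr0z.
Qed.

End Divisors.

(** * Divisors of infinite products *)

Section DivisorsOfProducts.
Context {R : realType}.
Local Notation C := R[i].
Local Notation Y := (C * 'cV[C]_3)%type.
Implicit Types (d g : 'rV[int]_3) (y z : Y) (F G u v : Y -> C) (m n : 'rV[int]_3 -> int).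

Definition ind (S : set 'rV[int]_3) d : int := if d \in S then 1 else 0.

Lemma near_div_neq0 g y0 : evZ g y0.2 != 0 -> \forall y \near y0, evZ g y.2 != 0.
Proof. by move=> g0; exact: (near_neq0 (differentiable_evZ g y0) g0). Qed.

Lemma hypD_Z d g (k : int) y : hyp (d + k *: g) y = hyp d y - k%:~R * evZ g y.2.
Proof. by rewrite /hyp evZD evZZ opprD addrA. Qed.

(** The factor vanishes where (delta(x) - w)/gamma(x) is an integer n, that is on the hyperplane of
    delta - n gamma, and it does so to first order. *)
Lemma hasdiv_1_sub_e2pi d g y0 : evZ g y0.2 != 0 ->
  hasdiv (fun y => 1 - e2pi ((evZ d y.2 - y.1) / evZ g y.2)) (ind (Zorbit g d)) y0.
Proof.
move=> g0.
have Fd y : evZ g y.2 != 0 -> differentiable (fun y => 1 - e2pi ((evZ d y.2 - y.1) / evZ g y.2)) y.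
  move=> gy; apply: differentiable_subC; first exact: differentiable_cstC.
  apply: (@differentiable_e2pi_div _ _ (fun y : Y => evZ d y.2 - y.1) (fun y : Y => evZ g y.2)).
  - exact: differentiable_subC (differentiable_evZ _ _) (differentiable_fst _).
  - exact: differentiable_evZ.
  - exact: gy.
have gnear0 := near_div_neq0 g0.
have [e1|ne1] := eqVneq (e2pi ((evZ d y0.2 - y0.1) / evZ g y0.2)) 1; last first.
  apply: (@hasdiv_eq_mult _ _ (fun _ => 0)); last first.
    apply: hasdiv_unit; apply: germ_unitI; last by rewrite subr_eq0 eq_sym.
    by apply: filterS gnear0 => y /Fd.
  move=> d'; rewrite /ind; case: ifPn => // /set_mem[k _ <-].
  rewrite hypD_Z => /eqP; rewrite subr_eq0 => /eqP dk.
  case/eqP: ne1; apply/e2pi_eq1; exists (- k).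
  by rewrite -opprB -/(hyp d y0) dk mulNr mulfK // rmorphN.
have [n nE] := (e2pi_eq1 _).1 e1.
(* Since gamma is nonzero at [y0], this is the only form in the orbit whose hyperplane passes
   through [y0]. *)
pose d0 := d - n *: g.
have hd0 y : hyp d0 y = hyp d y + n%:~R * evZ g y.2.
  by rewrite /d0 -scaleNr hypD_Z rmorphN mulNr opprK.
have hypE y : evZ d y.2 - y.1 = - hyp d y by rewrite opprB.
have d00 : hyp d0 y0 = 0.
  by rewrite hd0 -nE divfK // hypE addrN.
pose c : C := Complex 0 (2 * pi).
have c0 : c != 0.
  by rewrite eq_complex /= eqxx /= gt_eqF // mulr_gt0 ?pi_gt0.
(* The factor is 1 - e^t; splitting t off e^t - 1 leaves [cexpm1_div], whose value at t = 0 is 1. *)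
pose t y := - c * (hyp d0 y / evZ g y.2).
pose u y := c * cexpm1_div (t y) / evZ g y.2.
have td y : evZ g y.2 != 0 -> differentiable t y.
  move=> gy; apply: differentiable_mulC; first exact: differentiable_cstC.
  exact: differentiable_div (differentiable_hyp _ _) (differentiable_evZ _ _) gy.
have ud y : evZ g y.2 != 0 -> differentiable u y.
  move=> gy; apply: differentiable_div; [|exact: differentiable_evZ|exact: gy].
  apply: differentiable_mulC; first exact: differentiable_cstC.
  exact: (@differentiable_comp _ _ _ _ t cexpm1_div _ (td _ gy) (differentiable_cexpm1_div _)).
exists [:: d0], u; split.
- by [].
- by move=> d'; rewrite inE => /eqP ->.
- move=> d' d'0; rewrite inE /ind; case: ifPn => // /set_mem[k _ kd'] /eqP; case.
  move: d'0; rewrite -kd' hypD_Z => /eqP; rewrite subr_eq0 => /eqP dk.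
  have : (k + n)%:~R * evZ g y0.2 = 0 by rewrite rmorphD mulrDl -dk -hd0.
  move/eqP; rewrite mulf_eq0 (negbTE g0) orbF intr_eq0 addr_eq0 => /eqP ->.
  by rewrite scaleNr.
- apply: germ_unitI; first by apply: filterS gnear0 => y /ud.
  rewrite /u /t d00 mul0r mulr0 /cexpm1_div eqxx mulr1.
  by rewrite mulf_neq0 // invr_eq0.
- apply: gnearW; apply: filterS gnear0 => y gy.
  rewrite big_seq1 /ind mem_set; last first.
    by exists (- n) => //; rewrite scaleNr.
  rewrite expr1z hypE.
  have -> : - hyp d y / evZ g y.2 = n%:~R + - (hyp d0 y / evZ g y.2).
    by rewrite hd0; field; exact: gy.
  rewrite e2piD e2pi_int mul1r.
  have -> : e2pi (- (hyp d0 y / evZ g y.2)) = cexp (t y) by rewrite /e2pi mulrN -mulNr.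
  rewrite -opprB cexpm1_divP /u /t; field; exact: gy.
Qed.

Lemma Zorbit_opp g d : Zorbit (- g) d = Zorbit g d.
Proof.
by apply/seteqP; split=> _ [k _ <-]; exists (- k) => //; rewrite scaleNr ?scalerN ?opprK.
Qed.

Lemma hasdiv_1_sub_e2piN d g y0 : evZ g y0.2 != 0 ->
  hasdiv (fun y => 1 - e2pi (- ((evZ d y.2 - y.1) / evZ g y.2))) (ind (Zorbit g d)) y0.
Proof.
move=> g0; rewrite -Zorbit_opp.
have := @hasdiv_1_sub_e2pi d (- g) y0; rewrite evZN oppr_eq0 => /(_ g0).
apply: hasdiv_eq_gnear; apply: gnearW; apply: nearT => y.
by rewrite evZN invrN mulrN.
Qed.

(** The radius and the bounds belong to the point [y]; holomorphy on a neighbourhood only asks for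
    this condition at each of its points. *)
Definition lip_summable (I : choiceType) (S : set I) (F : I -> Y -> C) y :=
  (exists2 e : R, 0 < e & exists2 M : I -> R, sumb S M &
     forall i, S i -> lipn y e (fun z => F i z - 1) (M i)) /\
  forall i, S i -> differentiable (F i) y.

Lemma lip_summable_cvg (I : choiceType) (S : set I) (F : I -> Y -> C) y :
  lip_summable S F y -> infprod_cvg S (F^~ y).
Proof.
move=> [[e e0 [M Ms FM]] _].
have n0 : nrm (0 : Y) <= e by rewrite nrm0 ltW.
by have := lipn_infprod_cvg e0 FM Ms (@subset_refl _ S) n0; rewrite addr0.
Qed.

(** The tail outside a suitable finite [A] is a unit, so the factors over [A] carry the divisor. As
    [A] comes from the tail bound, the hypothesis on [m] covers all finite sets containing every
    index whose factor vanishes at [y0]. *)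
Lemma hasdiv_infprod (I : choiceType) (S : set I) (F : I -> Y -> C)
    (D : I -> 'rV[int]_3 -> int) m y0 :
  (\forall y \near y0, lip_summable S F y) ->
  (forall i, S i -> hasdiv (F i) (D i) y0) ->
  (forall A : {fset I}, (forall i, S i -> i \notin A -> F i y0 != 0) ->
     forall d, hyp d y0 = 0 -> m d = \sum_(i <- A | i \in S) D i d) ->
  hasdiv (fun y => infprod S (F^~ y)) m y0.
Proof.
move=> Fs FD mD.
have [[e e0 [M Ms FM]] Fd] := nbhs_singleton Fs.
have half0 : 0 < 2^-1 :> R by rewrite invr_gt0.
have [A AT] := lipn_tail e0 FM Ms half0.
pose S' := S `\` [set` A].
pose T y := infprod S' (F^~ y).
have M0 i : S i -> 0 <= M i by move=> /FM/lipn_ge0.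
have T0 y : nrm (T y - 1) <= 2^-1 -> T y != 0.
  move=> Ty; apply/eqP => Ty0; move: Ty; rewrite Ty0 sub0r nrmN nrm1; lra.
have Td y : lip_summable S F y -> differentiable T y.
  move=> [[e' e'0 [M' M's FM']] Fd'].
  have M'0 i : S i -> 0 <= M' i by move=> /FM'/lipn_ge0.
  apply: (@differentiable_infprod _ _ _ _ e' e'0 S' F M').
  - by move=> i [/FM'].
  - by apply: sumbS M's => // i [].
  - by move=> i [/Fd'].
have Tu : germ_unit T y0.
  apply: germ_unitI; last by apply: T0; have [] := AT.
  by apply: filterS Fs => y /Td.
have Ty0 : T y0 != 0 := (germ_unit_at Tu).2.
(* A vanishing factor outside [A] would annihilate the tail. *)
have notA i : S i -> i \notin A -> F i y0 != 0.
  move=> Si iA; apply: contraNneq Ty0 => Fi0.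
  have S'i : S' i by split=> //=; apply/negP.
  by rewrite /T; have [_ ->] := infprod_eq0 S'i (c := F^~ y0) Fi0.
have split_near : \forall y \near y0,
    infprod S (F^~ y) = \prod_(i <- A | i \in S) F i y * T y.
  apply/nbhs_nrmP; exists e => // h he.
  by apply: infprod_split; apply: (lipn_infprod_cvg e0 FM Ms) => // i [].
apply: (@hasdiv_eq_gnear _ (fun y => \prod_(i <- A | i \in S) F i y * T y)).
  by apply: gnearW; apply: filterS split_near => y ->.
apply: (@hasdiv_eq_mult _ _ (fun d => \sum_(i <- A | i \in S) D i d + 0)).
  by move=> d d0; rewrite addr0 (mD A).
apply: hasdivM (hasdiv_unit Tu).
by apply: hasdiv_prod => i iS; apply: FD; exact: set_mem.
Qed.

End DivisorsOfProducts.

(** * Holomorphic extension and meromorphy from divisors *)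

Section Extension.
Context {R : realType}.
Local Notation C := R[i].
Local Notation Y := (C * 'cV[C]_3)%type.
Implicit Types (d g : 'rV[int]_3) (y z : Y) (F G u v : Y -> C) (m n : 'rV[int]_3 -> int)
  (W : set Y).

(* The value at [y] of the holomorphic extension of [F], when there is one. *)
Definition holext F y : C :=
  xget 1 [set c | exists2 u, germ_unit u y /\ gnear y (fun z => F z = u z) & c = u y].

Lemma holextE F u y : germ_unit u y -> gnear y (fun z => F z = u z) -> holext F y = u y.
Proof.
move=> uu Fu.
have [v [vu Fv] ->] : [set c | exists2 u, germ_unit u y /\ gnear y (fun z => F z = u z)
    & c = u y] (holext F y) by apply: xgetPex; exists (u y), u.
apply: eq_germ (germ_unit_at vu).1 (germ_unit_at uu).1 _.
by apply: gnearS (gnearI Fu Fv) => z [-> ->].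
Qed.

Lemma near_holextE F u y : germ_unit u y -> gnear y (fun z => F z = u z) ->
  \forall z \near y, holext F z = u z.
Proof.
move=> uu Fu; apply: filterS2 (germ_unit_near uu) (gnear_near Fu) => z.
exact: holextE.
Qed.

Lemma germ_unit_holext F y : hasdiv F (fun _ => 0) y -> germ_unit (holext F) y.
Proof.
move=> /hasdiv0_germ[u uu Fu].
have E := near_holextE uu Fu.
have Ey : \forall z \near y, \forall z' \near z, u z' = holext F z'.
  by move: E => /nbhs_interior; apply: filterS => z; apply: filterS => z' ->.
apply: filterS3 uu E Ey => z [ud u0] -> zE; split; last exact: u0.
exact: differentiable_near zE ud.
Qed.

Lemma gnear_holext F y : hasdiv F (fun _ => 0) y -> gnear y (fun z => F z = holext F z).
Proof.
move=> /hasdiv0_germ[u uu Fu].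
by apply: gnearS (gnearI (gnearW (near_holextE uu Fu)) Fu) => z [-> ->].
Qed.

(** The preimage of each exceptional hyperplane lies in one hyperplane, so finitely many still
    suffice. *)
Lemma gnear_pullback (f : Y -> Y) y (P : Y -> Prop) : differentiable f y ->
  (forall d, exists d', forall z, hyp d' z != 0 -> hyp d (f z) != 0) ->
  gnear (f y) P -> gnear y (P \o f).
Proof.
move=> fd fhyp [B BP].
have [t tP] := choice fhyp.
exists [seq t d | d <- B].
have fc := differentiable_continuous fd.
have : \forall z \near y, (forall d, d \in B -> hyp d (f z) != 0) -> P (f z) := fc _ BP.
apply: filterS => z zP zB; apply: zP => d dB; apply: tP; apply: zB.
exact: map_f.
Qed.

Lemma germ_unit_pullback (f : Y -> Y) y u : (forall z, differentiable f z) ->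
  germ_unit u (f y) -> germ_unit (u \o f) y.
Proof.
move=> fd uu; have fc := differentiable_continuous (fd y).
have : \forall z \near y, differentiable u (f z) /\ u (f z) != 0 := fc _ uu.
apply: filterS => z [ud u0]; split; last exact: u0.
exact: differentiable_comp (fd z) ud.
Qed.

Definition scale_pt (l : C) y : Y := (l * y.1, l *: y.2).

Lemma differentiable_scale_pt (l : C) y : differentiable (scale_pt l) y.
Proof.
have -> : scale_pt l = fun z : Y => l *: z by apply/funext => -[].
by apply: differentiable_linear => [a u v|z]; [rewrite scalerDr !scalerA mulrC|exact: scaler_continuous].
Qed.

Lemma hyp_scale_pt (l : C) d y : hyp d (scale_pt l y) = l * hyp d y.
Proof. by rewrite /hyp /scale_pt /= !evZE /dot !mxE; ring. Qed.

Lemma holext_scale F y (l : C) : l != 0 ->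
  (\forall z \near y, F (scale_pt l z) = F z) -> hasdiv F (fun _ => 0) (scale_pt l y) ->
  holext F (scale_pt l y) = holext F y.
Proof.
move=> l0 Finv /hasdiv0_germ[u uu Fu].
rewrite (holextE uu Fu); apply/esym.
have uu' := germ_unit_pullback (differentiable_scale_pt l) uu.
apply: (holextE uu').
have hypl d : exists d', forall z, hyp d' z != 0 -> hyp d (scale_pt l z) != 0.
  by exists d => z dz; rewrite hyp_scale_pt mulf_neq0.
have := gnear_pullback (differentiable_scale_pt l y) hypl Fu.
by move=> /gnearI /(_ (gnearW Finv)); apply: gnearS => z [/= <- ->].
Qed.

Definition cone W := open W /\ forall (l : C) y, l != 0 -> W y -> W (scale_pt l y).

Lemma holext_Ox W F : cone W -> invariant_on W F -> (forall y, W y -> hasdiv F (fun _ => 0) y) ->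
  Ox W (holext F).
Proof.
move=> [Wo Wl] Finv Fd; split.
- move=> l y l0 Wy; apply: holext_scale => //; last by apply: Fd; exact: Wl.
  have : nbhs y W by exact: open_nbhs_nbhs.
  by apply: filterS => z Wz; exact: Finv.
- by move=> y /Fd /germ_unit_holext /germ_unit_at[].
- by move=> y /Fd /germ_unit_holext /germ_unit_at[].
Qed.

Lemma meq_gnear W F G : (forall y, W y -> gnear y (fun z => F z = G z)) -> meq W F G.
Proof.
move=> FG U Uo UW [y Uy].
have [U' [U'o U'U U'0 U'P]] := gnear_open (FG y (UW y Uy)) Uo Uy.
by exists U'.
Qed.

Lemma differentiable_prod (I : Type) (r : seq I) (f : I -> Y -> C) y :
  (forall j, differentiable (f j) y) -> differentiable (fun z => \prod_(j <- r) f j z) y.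
Proof.
move=> fd; elim: r => [|j r IH].
  rewrite (_ : (fun z => _) = (fun _ => 1)); first exact: differentiable_cstC.
  by apply/funext => z; rewrite big_nil.
rewrite (_ : (fun z => _) = (fun z => f j z * \prod_(k <- r) f k z)).
  exact: differentiable_mulC.
by apply/funext => z; rewrite big_cons.
Qed.

Lemma differentiable_expC (f : Y -> C) k y : differentiable f y ->
  differentiable (fun z => f z ^+ k) y.
Proof.
move=> fd; elim: k => [|k IH].
  rewrite (_ : (fun z => _) = (fun _ => 1)); first exact: differentiable_cstC.
  by apply/funext => z; rewrite expr0.
rewrite (_ : (fun z => _) = (fun z => f z * f z ^+ k)); first exact: differentiable_mulC.
by apply/funext => z; rewrite exprS.
Qed.

(** Positive and negative parts of the exponents turn the local factorization into a quotient of
    holomorphic functions. *)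
Lemma hasdiv_Mx W F (m : Y -> 'rV[int]_3 -> int) : open W -> invariant_on W F ->
  (forall y, W y -> hasdiv F (m y) y) -> Mx W F.
Proof.
move=> Wo Finv Fd; split=> // y Wy.
have [B [u [_ _ _ uu [B' B'P]]]] := Fd y Wy.
have : nbhs y (W `&` ([set z | differentiable u z /\ u z != 0] `&` [set z |
    (forall d, d \in B' -> hyp d z != 0) -> F z = u z * \prod_(d <- B) hyp d z ^ m y d])).
  by apply: filterI; [exact: open_nbhs_nbhs|exact: filterI].
rewrite nbhsE => -[U [Uo Uy] UP].
pose pos (k : int) : nat := if 0 <= k then `|k|%N else 0%N.
have posE (z : C) (k : int) : z != 0 -> z ^ k = z ^+ pos k / z ^+ pos (- k).
  move=> z0; rewrite /pos; case: (ltrgt0P k) => [k0|k0|->].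
  - by rewrite oppr_ge0 leNgt k0 /= expr0 divr1 -{1}(gtz0_abs k0).
  - by rewrite oppr_ge0 ltW //= expr0 div1r abszN -{1}(opprK k) -(ltz0_abs k0) exprnN.
  - by rewrite oppr0 lexx /= expr0 invr1 mulr1.
(* The common factor makes [Q z != 0] imply that [z] is off all hyperplanes. *)
pose X z := \prod_(d <- B ++ B') hyp d z.
pose P z := u z * \prod_(d <- B) hyp d z ^+ pos (m y d) * X z.
pose Q z := \prod_(d <- B) hyp d z ^+ pos (- m y d) * X z.
have Xd z : differentiable X z by apply: differentiable_prod => d; exact: differentiable_hyp.
have powd (e : 'rV[int]_3 -> nat) z : differentiable (fun z => \prod_(d <- B) hyp d z ^+ e d) z.
  by apply: differentiable_prod => d; apply: differentiable_expC; exact: differentiable_hyp.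
have X0 z : (forall d, d \in B ++ B' -> hyp d z != 0) -> X z != 0.
  by move=> zB; rewrite prodf_seq_neq0; apply/allP => d /zB.
have pow0 (e : 'rV[int]_3 -> nat) z : (forall d, d \in B ++ B' -> hyp d z != 0) ->
    \prod_(d <- B) hyp d z ^+ e d != 0.
  move=> zB; rewrite prodf_seq_neq0; apply/allP => d dB.
  by rewrite expf_neq0 // zB // mem_cat dB.
exists U, P, Q; split; split.
- exact: Uo.
- exact: Uy.
- by move=> z /UP[].
- move=> z /UP[_ [[ud _] _]]; apply: differentiable_mulC; last exact: Xd.
  exact: differentiable_mulC (ud) (powd _ _).
- by move=> z _; apply: differentiable_mulC; [exact: powd|exact: Xd].
- move=> U1 U1o U1U U10; have [U2 [_ U2U1 [z U2z] U2B]] := nonvanishing_dense (B ++ B') U1o U10.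
  exists z; first exact: U2U1.
  have [_ [[_ u0] _]] := UP z (U1U _ (U2U1 _ U2z)).
  by rewrite !mulf_neq0 ?pow0 ?X0 //; exact: U2B.
- move=> U1 U1o U1U U10; have [U2 [_ U2U1 [z U2z] U2B]] := nonvanishing_dense (B ++ B') U1o U10.
  exists z; first exact: U2U1.
  by rewrite mulf_neq0 ?pow0 ?X0 //; exact: U2B.
- move=> z /UP[_ [_ zP]]; rewrite mulf_eq0 negb_or => /andP[_ Xz].
  have zB d : d \in B ++ B' -> hyp d z != 0.
    by move=> dB; move: Xz; rewrite prodf_seq_neq0 => /allP/(_ d dB).
  rewrite zP => [|d dB']; last by apply: zB; rewrite mem_cat dB' orbT.
  rewrite /P /Q -mulf_div divff // mulr1 -mulrA; congr (_ * _).
  rewrite -prodf_div; apply: eq_big_seq => d dB.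
  by rewrite posE // zB // mem_cat dB.
Qed.

(** [t] acts on hyperplanes by preimage under [f], so multiplicities are transported by its
    inverse. *)
Lemma hasdiv_pullback (f : Y -> Y) (t t' : 'rV[int]_3 -> 'rV[int]_3) F m y :
  (forall z, differentiable f z) -> cancel t t' -> cancel t' t ->
  (forall d z, hyp (t d) z = hyp d (f z)) ->
  hasdiv F m (f y) -> hasdiv (F \o f) (m \o t') y.
Proof.
move=> fd tK t'K thyp [B [u [Bu B0 Bm uu uF]]].
exists [seq t d | d <- B], (u \o f); split.
- by rewrite map_inj_uniq //; exact: can_inj tK.
- by move=> d' /mapP[d dB ->]; rewrite thyp B0.
- move=> d'; rewrite -{1}(t'K d') thyp => d0 dB /=; rewrite Bm //.
  by apply: contra dB => dB; apply/mapP; exists (t' d').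
- exact: germ_unit_pullback.
- have hypf d : exists d', forall z, hyp d' z != 0 -> hyp d (f z) != 0.
    by exists (t d) => z; rewrite thyp.
  apply: gnearS (gnear_pullback (fd y) hypf uF) => z /= ->.
  by rewrite big_map; congr (_ * _); apply: eq_bigr => d _; rewrite thyp tK.
Qed.

End Extension.

(** * Divisors of the gamma and theta factors *)

Section GammaDivisor.
Context {R : realType}.
Local Notation C := R[i].
Local Notation Y := (C * 'cV[C]_3)%type.
Implicit Types (d g : 'rV[int]_3) (y z : Y).

(** The denominator of [Gamma a b] is [gnum b a], because the direction changes sign under the swap;
    one analysis serves both products. *)
Definition gnum (a b : Lprim) y : C :=
  infprod (Cpm (sval a) (sval b)) (Gamma_num_factor (sval a) (sval b) y.1 y.2).

Lemma lip_summable_num (a b : Lprim) y : V a y -> V b y -> sval a != sval b ->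
  lip_summable (Cpm (sval a) (sval b))
    (fun K z => Gamma_num_factor (sval a) (sval b) z.1 z.2 K) y.
Proof.
move=> Va Vb ab; split.
  by have [e e0 [M Ms MP]] := lipn_num_factor Va Vb ab; exists e => //; exists M.
move=> K _; apply: differentiable_num_factor.
exact: (direction_neq0 (V_independent Va Vb ab) Va).
Qed.

Definition pos (a : Lprim) d : int := if 0 < ev d (sval a) then 1 else 0.

Lemma hasdiv_gnum (a b : Lprim) y0 : V a y0 -> V b y0 -> sval a != sval b ->
  hasdiv (gnum a b) (ind [set d | 0 < ev d (sval a) /\ ev d (sval b) <= 0]) y0.
Proof.
move=> Va Vb neq; have ab := V_independent Va Vb neq.
set g := direction (sval a) (sval b).
have g0 : evZ g y0.2 != 0 := direction_neq0 ab Va.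
apply: (@hasdiv_infprod _ _ _ (fun K z => Gamma_num_factor (sval a) (sval b) z.1 z.2 K)
  (fun K => ind K)).
- by apply: filterS2 (near_V Va) (near_V Vb) => y Vay Vby; exact: lip_summable_num.
- move=> K KC; have [_ _ _ KE] := CpmP ab KC.
  by rewrite {2}KE; exact: hasdiv_1_sub_e2piN.
move=> A A0 d d0; rewrite /ind; case: ifPn => [/set_mem[da db]|dab]; last first.
  rewrite big1 // => K /set_mem KC; case: ifPn => // /set_mem Kd.
  by case/negP: dab; apply/mem_set; exact: Zorbit_subl ab KC Kd.
(* Classes are orbits, so [d] lies in this one alone. Its factor vanishes at [y0], which forces the
   class into [A]. *)
pose K0 := Zorbit g d.
have K0C : Cpm (sval a) (sval b) K0 by exists d.
have K0d : K0 d by exists 0 => //; rewrite scale0r addr0.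
have [_ _ _ K0E] := CpmP ab K0C.
have K0A : K0 \in A.
  apply: contrapT => /negP K0A; have := A0 _ K0C K0A.
  rewrite /Gamma_num_factor -/g; move: K0d; rewrite {1}K0E => -[k _ kd].
  move: d0; rewrite -kd hypD_Z => /eqP; rewrite subr_eq0 => /eqP dk.
  have -> : evZ (xget 0 K0) y0.2 - y0.1 = - hyp (xget 0 K0) y0 by rewrite opprB.
  rewrite dk mulNr opprK mulfK //.
  by rewrite e2pi_int subrr eqxx.
rewrite big_mkcond (big_fsetD1 K0) //= (mem_set K0C) mem_set // big_seq big1 ?addr0 // => K.
rewrite !inE => /andP[KK0 _]; case: ifPn => // /set_mem KC; case: ifPn => // /set_mem Kd.
case/eqP: KK0; have [_ _ _ KE] := CpmP ab KC.
have [k _ kd] : Zorbit g (xget 0 K) d by rewrite -KE.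
rewrite [LHS]KE /K0; apply/esym; exact: (@Zorbit_eq _ _ _ k (esym kd)).
Qed.

Lemma Cmp_swap (a b : 'cV[int]_3) : independent a b -> Cmp a b = Cpm b a.
Proof.
move=> ab; rewrite /Cmp /Cpm /Zquotient setIC (direction_swap ab).
by apply: eq_imagel => d _; rewrite Zorbit_opp.
Qed.

Lemma den_factor_swap (a b : 'cV[int]_3) (w : C) (x : 'cV[C]_3) : independent a b ->
  Gamma_den_factor a b w x = Gamma_num_factor b a w x.
Proof.
move=> ab; apply/funext => K; rewrite /Gamma_den_factor /Gamma_num_factor (direction_swap ab).
by rewrite evZN invrN mulrN opprK.
Qed.

Lemma GammaE (a b : Lprim) y : V a y -> V b y -> sval a != sval b ->
  Gamma a b y = gnum a b y / gnum b a y.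
Proof.
move=> Va Vb ab; rewrite /Gamma (negbTE ab).
by rewrite Cmp_swap ?den_factor_swap //; exact: V_independent Va Vb ab.
Qed.

Lemma hasdiv_Gamma (a b : Lprim) y0 : V a y0 -> V b y0 ->
  hasdiv (Gamma a b) (fun d => pos a d - pos b d) y0.
Proof.
move=> Va Vb; have [ab|ab] := eqVneq (sval a) (sval b).
  apply: hasdiv_eq_mult (hasdiv_eq_gnear _ (hasdiv_unit (germ_unit1 y0))).
    by move=> d _; rewrite /pos ab subrr.
  by apply: gnearW; apply: nearT => y; rewrite /Gamma ab eqxx.
have ba : sval b != sval a by rewrite eq_sym.
apply: hasdiv_eq_mult (hasdiv_eq_gnear _ (hasdivM (hasdiv_gnum Va Vb ab)
  (hasdivV (hasdiv_gnum Vb Va ba)))).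
  (* With p and q the indicators of d(a) > 0 and d(b) > 0, this is p(1 - q) - q(1 - p) = p - q. *)
  move=> d _; rewrite /ind /pos.
  have memE (a' b' : Lprim) : (d \in [set d | 0 < ev d (sval a') /\ ev d (sval b') <= 0]) =
      (0 < ev d (sval a')) && (ev d (sval b') <= 0).
    by apply/idP/andP => [/set_mem|?]; [|apply/mem_set].
  by rewrite !memE !leNgt; case: (0 < ev d (sval a)); case: (0 < ev d (sval b)).
apply: gnearW; apply: filterS2 (near_V Va) (near_V Vb) => y Vay Vby.
by rewrite GammaE.
Qed.

Lemma Gamma_inv (a b : Lprim) y : V a y -> V b y -> Gamma b a y = (Gamma a b y)^-1.
Proof.
move=> Va Vb; have [ab|ab] := eqVneq (sval a) (sval b).
  by rewrite /Gamma ab eqxx invr1.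
have ba : sval b != sval a by rewrite eq_sym.
by rewrite !GammaE // invfM invrK mulrC.
Qed.

End GammaDivisor.

(** * Summability of the theta factors *)

Section Theta.
Context {R : realType}.
Local Notation C := R[i].
Local Notation Y := (C * 'cV[C]_3)%type.
Implicit Types (d g : 'rV[int]_3) (y : Y).

Lemma lip_summable_theta0 (z tau : Y -> C) y0 : differentiable z y0 -> differentiable tau y0 ->
  0 < complex.Im (tau y0) ->
  lip_summable [set: nat] (fun k y => theta0_factor (z y) (tau y) k) y0.
Proof.
move=> zd taud tau0.
pose q y := e2pi (tau y).
pose A y := e2pi (tau y - z y); pose B y := e2pi (z y).
have qd : differentiable q y0 by exact: differentiable_e2pi.
have Ad : differentiable A y0 by apply: differentiable_e2pi; exact: differentiable_subC.
have Bd : differentiable B y0 by exact: differentiable_e2pi.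
have facE k y : theta0_factor (z y) (tau y) k = (1 - A y * q y ^+ k) * (1 - B y * q y ^+ k).
  rewrite /theta0_factor /A /B /q /=.
  have -> : k.+1%:R * tau y - z y = (tau y - z y) + k%:R * tau y by rewrite -natr1; ring.
  by rewrite [k%:R * _ + _]addrC (e2piD (tau y - z y)) (e2piD (z y)) !e2piMn.
have factor_d (F : Y -> C) k : differentiable F y0 ->
    differentiable (fun y => 1 - F y * q y ^+ k) y0.
  move=> Fd; apply: differentiable_subC; first exact: differentiable_cstC.
  exact: differentiable_mulC Fd (differentiable_expC _ qd).
split; last first.
  move=> k _; rewrite (_ : (fun y => _) = (fun y => (1 - A y * q y ^+ k) * (1 - B y * q y ^+ k))).
    exact: differentiable_mulC (factor_d _ _ Ad) (factor_d _ _ Bd).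
  by apply/funext => y; exact: facE.
have q1 : nrm (q y0) < 1 by exact: nrm_e2pi_lt1.
have [rho rho1 qrho] : exists2 rho : R, rho < 1 & nrm (q y0) < rho.
  by exists ((nrm (q y0) + 1) / 2); move: q1; move: (nrm _) => t *; lra.
have rho0 : 0 <= rho by apply: le_trans (ltW qrho); exact: nrm_ge0.
have [eq eq0 eqP] := lipn_small qd qrho.
have [ea ea0 eaP] := lipn_small (c := nrm (A y0) + 1) Ad (ltr_pwDr ltr01 (lexx _)).
have [eb eb0 ebP] := lipn_small (c := nrm (B y0) + 1) Bd (ltr_pwDr ltr01 (lexx _)).
have cA0 : 0 <= nrm (A y0) + 1 by rewrite addr_ge0 ?nrm_ge0.
have cB0 : 0 <= nrm (B y0) + 1 by rewrite addr_ge0 ?nrm_ge0.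
move: (nrm (A y0) + 1) (nrm (B y0) + 1) cA0 cB0 eaP ebP => cA cB cA0 cB0 eaP ebP.
pose e := Num.min eq (Num.min ea eb).
have e0 : 0 < e by rewrite !lt_min eq0 ea0.
have [eeq [eea eeb]] : e <= eq /\ (e <= ea /\ e <= eb).
  by rewrite /e !ge_min !lexx !orbT.
(* (1 - Aq^k)(1 - Bq^k) - 1 = ABq^(2k) - (A + B)q^k, and rho^(2k) <= rho^k. *)
exists e => //; exists (fun k => (cA * cB + (cA + cB)) * rho ^+ k).
  apply: sumbZ; first by rewrite !addr_ge0 ?mulr_ge0.
  by apply: (@sumb_geometric _ _ _ id); rewrite ?rho0.
move=> k _.
have Lq := lipnX e0 k (eqP _ e0 eeq).
have LA := lipnM e0 (eaP _ e0 eea) Lq; have LB := lipnM e0 (ebP _ e0 eeb) Lq.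
have -> : (fun y => theta0_factor (z y) (tau y) k - 1) =
    fun y => A y * q y ^+ k * (B y * q y ^+ k) + - (A y * q y ^+ k + B y * q y ^+ k).
  by apply/funext => y; rewrite facE; ring.
apply: lipn_mono (lipnD e0 (lipnM e0 LA LB) (lipnN (lipnD e0 LA LB))).
have r0 : 0 <= rho ^+ k by rewrite exprn_ge0.
have r1 : rho ^+ k <= 1 by rewrite exprn_ile1 // ltW.
have AB0 : 0 <= cA * cB by rewrite mulr_ge0.
have : cA * cB * (rho ^+ k * rho ^+ k) <= cA * cB * (rho ^+ k * 1).
  by rewrite ler_wpM2l // ler_wpM2l.
by move: (rho ^+ k) => r *; lra.
Qed.

End Theta.

(** * The divisor of Delta *)

Section DeltaDivisor.
Context {R : realType}.
Local Notation C := R[i].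
Local Notation Y := (C * 'cV[C]_3)%type.
Implicit Types (d mu : 'rV[int]_3) (y : Y).

Lemma evD d e (a : 'cV[int]_3) : ev (d + e) a = ev d a + ev e a.
Proof. by rewrite /ev mulmxDl mxE. Qed.

Lemma evZl (k : int) d (a : 'cV[int]_3) : ev (k *: d) a = k * ev d a.
Proof. by rewrite /ev -scalemxAl mxE. Qed.

Section OrientedBasis.
Variables (a : Lprim) (M : 'M[int]_3).
Hypotheses (Mu : M \in unitmx) (Mdet : 0 < \det M) (M0 : ev (row 0 M) (sval a) = 1)
  (M1 : ev (row 1 M) (sval a) = 0) (M2 : ev (row 2 M) (sval a) = 0).

Lemma basis_expand d : exists n1 n2 : int,
  d = ev d (sval a) *: row 0 M + n1 *: row 1 M + n2 *: row 2 M.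
Proof.
pose c := d *m invmx M.
have dE : d = c 0 0 *: row 0 M + c 0 1 *: row 1 M + c 0 2 *: row 2 M.
  rewrite -[LHS](mulmxKV Mu) -/c; apply/matrixP => i j; rewrite ord1 mxE sum3 !mxE.
  by [].
exists (c 0 1), (c 0 2); rewrite {1}dE; congr (_ *: _ + _ + _).
by rewrite dE !evD !evZl M0 M1 M2 mulr1 !mulr0 !addr0.
Qed.

(** A unimodular matrix with positive determinant has determinant 1, so alpha_2 x alpha_3 is [a]
    itself and the imaginary part is a positive multiple of its height. *)
Lemma Im_basis_div y : V a y -> 0 < complex.Im (evZ (row 1 M) y.2 / evZ (row 2 M) y.2).
Proof.
move=> /VP ha.
have detM : \det M = 1.
  have Du := Mu; rewrite unitmxE in Du.
  have /orP[/eqP //|/eqP D1] : (\det M == 1) || (\det M == -1) := Du.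
  by move: Mdet; rewrite D1.
have rowE i : row i M 0 = M i by apply/funext => j; rewrite mxE.
have crsE i : crs (M 1) (M 2) i = sval a i 0.
  have o1 : dot (M 1) ((sval a)^~ 0) = 0 by rewrite -M1 evE rowE.
  have o2 : dot (M 2) ((sval a)^~ 0) = 0 by rewrite -M2 evE rowE.
  have o0 : dot (M 0) ((sval a)^~ 0) = 1 by rewrite -M0 evE rowE.
  have H := crs_orthogonal _ o1 o2.
  have d1 : dot (M 0) (crs (M 1) (M 2)) = 1 by rewrite -det3.
  have [j aj] : exists j, sval a j 0 != 0.
    apply: contrapT => /forallNP a0; have /eqP := o0; rewrite /dot.
    have a0' j : sval a j 0 = 0 by apply/eqP/negP => /negP; exact: a0.
    by rewrite !a0' !mulr0 !addr0.
  have aa0 := @dot_self_gt0 _ ((sval a)^~ 0) j aj.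
  (* Pair the proportionality [H] with the first row, which takes the value 1 on [a] and on the
     cross product. *)
  have E : dot ((sval a)^~ 0) ((sval a)^~ 0) = dot ((sval a)^~ 0) (crs (M 1) (M 2)).
    move: H o0 d1; move: (dot ((sval a)^~ 0) ((sval a)^~ 0)) => A1.
    move: (dot ((sval a)^~ 0) (crs _ _)) => A2; move: (crs _ _) => c H.
    rewrite /dot => o0 d1.
    have : M 0 0 * (A1 * c 0) + M 0 1 * (A1 * c 1) + M 0 2 * (A1 * c 2) = A1.
      by rewrite -[RHS]mulr1 -d1; ring.
    by rewrite !H => <-; rewrite -[RHS]mulr1 -o0; ring.
  apply: (mulfI (lt0r_neq0 aa0)); rewrite H -E; ring.
have E : complex.Im (evZ (row 1 M) y.2 * conjc (evZ (row 2 M) y.2)) = height (rl ((sval a)^~ 0)) y.2.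
  rewrite Im_evZ_conj !rowE; congr height; apply/funext => i; rewrite /rl; congr (_%:~R).
  exact: crsE.
have g0 : evZ (row 2 M) y.2 != 0.
  apply/eqP => g0; move: E; rewrite g0 conjc0 mulr0 /= => h0.
  by move: ha; rewrite -h0 ltxx.
by rewrite Im_div E divr_gt0 // exprn_gt0 // nrm_gt0.
Qed.

Lemma basis_neq0 y : V a y -> evZ (row 2 M) y.2 != 0.
Proof.
by move=> /Im_basis_div; apply: contraTneq => ->; rewrite invr0 mulr0 ltxx.
Qed.

(** For d = -j alpha_1 + n1 alpha_2 + n2 alpha_3, the first half of the k-th theta factor vanishes
    on n1 = k + 1 and the second on n1 = -k, so each integer n1 occurs once; alpha_3 plays the part
    of the direction. *)
Lemma hasdiv_theta0 (j : int) y0 : V a y0 ->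
  hasdiv (fun y : Y => theta0 ((y.1 + j%:~R * evZ (row 0 M) y.2) / evZ (row 2 M) y.2)
                          (evZ (row 1 M) y.2 / evZ (row 2 M) y.2))
    (ind [set d | ev d (sval a) = - j]) y0.
Proof.
move=> Va; have g0 := basis_neq0 Va.
pose z y := (y.1 + j%:~R * evZ (row 0 M) y.2) / evZ (row 2 M) y.2.
pose tau y := evZ (row 1 M) y.2 / evZ (row 2 M) y.2.
pose d1 (k : nat) : 'rV[int]_3 := k.+1%:Z *: row 1 M - j *: row 0 M.
pose d2 (k : nat) : 'rV[int]_3 := - (j *: row 0 M + k%:Z *: row 1 M).
have evd y : evZ (row 2 M) y.2 != 0 -> differentiable z y.
  move=> gy; apply: differentiable_div; [|exact: differentiable_evZ|exact: gy].
  apply: differentiable_addC; first exact: differentiable_fst.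
  exact: differentiable_mulC (differentiable_cstC _ _) (differentiable_evZ _ _).
have taud y : evZ (row 2 M) y.2 != 0 -> differentiable tau y.
  by move=> gy; exact: differentiable_div (differentiable_evZ _ _) (differentiable_evZ _ _) gy.
pose F1 k y := 1 - e2pi ((evZ (d1 k) y.2 - y.1) / evZ (row 2 M) y.2).
pose F2 k y := 1 - e2pi (- ((evZ (d2 k) y.2 - y.1) / evZ (row 2 M) y.2)).
have FE k y : theta0_factor (z y) (tau y) k = F1 k y * F2 k y.
  rewrite /theta0_factor /F1 /F2 /d1 /d2 evZB evZN evZD !evZZ /z /tau.
  congr ((1 - e2pi _) * (1 - e2pi _)); ring.
pose D k d := ind (Zorbit (row 2 M) (d1 k)) d + ind (Zorbit (row 2 M) (d2 k)) d.
have comb (n0 n1 n2 m0 m1 m2 : int) :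
    n0 *: row 0 M + n1 *: row 1 M + n2 *: row 2 M = m0 *: row 0 M + m1 *: row 1 M + m2 *: row 2 M ->
    n1 = m1.
  move=> E; pose c : 'rV[int]_3 := \row_i nth 0 [:: n0 - m0; n1 - m1; n2 - m2] i.
  have : c *m M = 0.
    apply/matrixP => r s; rewrite mxE sum3 !mxE /=.
    by have /matrixP/(_ 0 s) := E; rewrite !mxE => /eqP; rewrite -subr_eq0 => /eqP <-; ring.
  move=> /(canRL (mulmxK Mu)); rewrite mul0mx => /matrixP/(_ 0 1); rewrite /c !mxE /= => /eqP.
  by rewrite subr_eq0 => /eqP.
have evd1 k : ev (d1 k) (sval a) = - j.
  by rewrite evD -scaleNr !evZl M0 M1; ring.
have evd2 k : ev (d2 k) (sval a) = - j.
  by rewrite /d2 -scaleN1r evZl evD !evZl M0 M1; ring.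
have ev_orbit e d : ev e (sval a) = - j -> Zorbit (row 2 M) e d -> ev d (sval a) = - j.
  by move=> ej [k _ <-]; rewrite evD evZl M2 mulr0 addr0.
apply: (@hasdiv_infprod _ _ _ (fun k y => theta0_factor (z y) (tau y) k) D).
- apply: filterS (near_V Va) => y Vay; have gy := basis_neq0 Vay.
  apply: lip_summable_theta0; [exact: evd|exact: taud|exact: Im_basis_div].
- move=> k _; apply: hasdiv_eq_gnear (hasdivM (hasdiv_1_sub_e2pi (d1 k) g0)
    (hasdiv_1_sub_e2piN (d2 k) g0)).
  by apply: gnearW; apply: nearT => y; rewrite FE.
move=> A A0 d d0; have [dj|dj] := eqVneq (ev d (sval a)) (- j); last first.
  rewrite /ind ifN; last by apply/negP => /set_mem /= dj'; case/eqP: dj.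
  rewrite big1 // => k _; rewrite /D /ind !ifN //; apply/negP => /set_mem.
    by move/(ev_orbit _ _ (evd2 k)) => dj'; case/eqP: dj.
  by move/(ev_orbit _ _ (evd1 k)) => dj'; case/eqP: dj.
rewrite /ind mem_set //.
have [n1 [n2 dE]] := basis_expand d; rewrite dj in dE.
have in1 k : (d \in Zorbit (row 2 M) (d1 k)) = (n1 == k.+1%:Z).
  apply/idP/eqP => [/set_mem[l _]|n1k].
    rewrite dE /d1 [k.+1%:Z *: _ - _]addrC -scaleNr => /comb <-; done.
  apply/mem_set; exists n2 => //; rewrite dE n1k /d1 [k.+1%:Z *: _ - _]addrC -scaleNr; done.
have in2 k : (d \in Zorbit (row 2 M) (d2 k)) = (n1 == - k%:Z).
  apply/idP/eqP => [/set_mem[l _]|n1k].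
    rewrite dE /d2 opprD -!scaleNr => /comb <-; done.
  apply/mem_set; exists n2 => //; rewrite dE n1k /d2 opprD -!scaleNr; done.
(* The index of the theta factor that vanishes on [hyp d]. *)
pose k0 : nat := if 0 < n1 then `|n1 - 1|%N else `|n1|%N.
have DE k : D k d = if k == k0 then 1 else 0.
  rewrite /D /ind in1 in2 /k0; move: (k) (n1); clear=> k n.
  by case: (ltrP 0 n) => n0; case: (n =P k.+1%:Z) => ?; case: (n =P - k%:Z) => ?; case: (k =P _) => ?; lia.
have k0A : k0 \in A.
  apply: contrapT => /negP k0A; have := A0 k0 I k0A; rewrite FE mulf_eq0 negb_or => /andP[].
  have hypE e y : evZ e y.2 - y.1 = - hyp e y by rewrite opprB.
  have [|] : (d \in Zorbit (row 2 M) (d1 k0)) \/ (d \in Zorbit (row 2 M) (d2 k0)).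
  - rewrite in1 in2 /k0; move: (n1); clear=> n.
    by case: ifP => n0; [left|right]; apply/eqP; lia.
  - move=> /set_mem[k _ kd]; move: d0; rewrite -kd hypD_Z => /eqP; rewrite subr_eq0 => /eqP dk.
    by rewrite /F1 hypE dk mulNr mulfK // -rmorphN e2pi_int subrr eqxx.
  - move=> /set_mem[k _ kd]; move: d0; rewrite -kd hypD_Z => /eqP; rewrite subr_eq0 => /eqP dk _.
    by rewrite /F2 hypE dk mulNr opprK mulfK // e2pi_int subrr eqxx.
rewrite big_mkcond (big_fsetD1 k0) //= in_setT DE eqxx big_seq big1 ?addr0 // => k.
by rewrite !inE => /andP[kk0 _]; rewrite DE (negbTE kk0) if_same.
Qed.

End OrientedBasis.

(** At most one j contributes, and it exists exactly when e <= 0 < e + n. *)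
Lemma sum_ind_window (n : nat) (e : int) :
  \sum_(j < n) (if e == - j%:Z then 1 else 0 : int) =
  (if 0 < e + n%:Z then 1 else 0) - (if 0 < e then 1 else 0).
Proof.
elim: n => [|n IH]; first by rewrite big_ord0 addr0 subrr.
by rewrite big_ord_recr /= IH; case: (e =P _) => ?; do 3![case: ifP => ?]; lia.
Qed.

Lemma sum_ind_window_neg (n : nat) (e : int) :
  \sum_(j < n) (if e == j.+1%:Z then 1 else 0 : int) =
  (if 0 < e then 1 else 0) - (if 0 < e - n%:Z then 1 else 0).
Proof.
elim: n => [|n IH]; first by rewrite big_ord0 subr0 subrr.
by rewrite big_ord_recr /= IH; case: (e =P _) => ?; do 3![case: ifP => ?]; lia.
Qed.

Lemma hasdiv_Delta_dual (f : Lprim -> 'M[int]_3) (a : Lprim) (mu : 'rV[int]_3) y0 :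
  framing f -> V a y0 ->
  hasdiv (Delta_dual f a mu) (fun d => pos a (d + mu) - pos a d) y0.
Proof.
move=> /(_ a)[Mu Mdet M0 M1 M2] Va; rewrite /Delta_dual.
pose th (j : int) (y : Y) := theta0 ((y.1 + j%:~R * evZ (row 0 (f a)) y.2) / evZ (row 2 (f a)) y.2)
                          (evZ (row 1 (f a)) y.2 / evZ (row 2 (f a)) y.2).
have thd j : hasdiv (th j) (ind [set d | ev d (sval a) = - j]) y0.
  exact: hasdiv_theta0.
have indE j d : ind [set d | ev d (sval a) = - j] d = if ev d (sval a) == - j then 1 else 0.
  by rewrite /ind; congr (if _ then _ else _); apply/idP/eqP => [/set_mem|?]; last exact/mem_set.
case muE : (ev mu (sval a)) => [n|n].
  have := @hasdiv_prod R _ (index_enum 'I_n) xpredT (fun j => th j%:Z) _ y0 (fun j _ => thd j%:Z).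
  apply: hasdiv_eq_mult => d _.
  under eq_bigr do rewrite indE; rewrite sum_ind_window /pos evD muE; done.
(* [Negz n] is -(n + 1), so the inverted product runs over the indices -1, ..., -(n + 1). *)
have := hasdivV (@hasdiv_prod R _ (index_enum 'I_n.+1) xpredT (fun j => th (- j.+1%:Z)) _ y0
  (fun j _ => thd (- j.+1%:Z))).
apply: hasdiv_eq_mult => d _.
under eq_bigr do rewrite indE opprK; rewrite sum_ind_window_neg opprB /pos evD muE NegzE; done.
Qed.

Lemma hasdiv_Delta (f : Lprim -> 'M[int]_3) (a : Lprim) (g : ISL3) y0 : framing f -> V a y0 ->
  hasdiv (Delta f a g) (fun d => pos a (d + tra g *m invmx (lin g)) - pos a d) y0.
Proof. exact: hasdiv_Delta_dual. Qed.

End DeltaDivisor.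

(** * The elliptic gamma function *)

Section EllipticGamma.
Context {R : realType}.
Local Notation C := R[i].
Local Notation Y := (C * 'cV[C]_3)%type.
Implicit Types (d g : 'rV[int]_3) (y : Y).

(** A finite set of indices in [J] that contains the image of [A] has the same partial product as
    its preimage joined with [A]. *)
Lemma infprod_reindex (I J : choiceType) (S : set I) (T : set J) (h : I -> J)
    (F : I -> C) (G : J -> C) :
  (forall i, S i -> T (h i)) -> (forall i i', S i -> S i' -> h i = h i' -> i = i') ->
  (forall j, T j -> exists2 i, S i & h i = j) -> (forall i, S i -> G (h i) = F i) ->
  infprod_cvg S F -> infprod T G = infprod S F.
Proof.
move=> hT hinj hsurj GF /infprodP cF; apply: infprodE; apply/cvg_nrmP => r r0.
have /totallyP[A AP] : \forall B \near summability.totally, nrm (finprod S F B - infprod S F) <= r.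
  by move/cvg_nrmP: cF; exact.
(* The inverse is partial, with [None] off [T]. *)
have [hinv hinvP] : {hinv : J -> option I & forall j,
    (T j -> exists2 i, hinv j = Some i & S i /\ h i = j) /\
    (forall i, hinv j = Some i -> h i = j)}.
  apply: (@choice _ _ (fun j oi => (T j -> exists2 i, oi = Some i & S i /\ h i = j) /\
    (forall i, oi = Some i -> h i = j))) => j.
  have [/hsurj[i Si hi]|nT] := pselect (T j); last by exists None.
  by exists (Some i); split=> [_|i' [<-] //]; exists i.
apply: (@near_totally _ _ [fset h i | i in A]%fset) => B' AB'.
(* [A] is joined because it may contain indices outside [S]; they do not change the product. *)
pose B := (A `|` [fset i in pmap hinv (enum_fset B')])%fset.
suff E : finprod T G B' = finprod S F B by rewrite /= E; apply: AP; exact: fsubsetUl.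
rewrite /finprod -big_filter -[RHS]big_filter.
have -> : \prod_(i <- [seq i <- B | i \in S]) F i =
    \prod_(j <- [seq h i | i <- enum_fset B & i \in S]) G j.
  by rewrite big_map; apply: eq_big_seq => i; rewrite mem_filter => /andP[/set_mem Si _]; rewrite GF.
apply: perm_big; apply: uniq_perm.
- by rewrite filter_uniq ?fset_uniq.
- rewrite map_inj_in_uniq ?filter_uniq ?fset_uniq // => i i'.
  by rewrite !mem_filter => /andP[/set_mem Si _] /andP[/set_mem Si' _]; exact: hinj.
move=> j; rewrite mem_filter; apply/andP/idP => [[/set_mem Tj jB']|].
  have [i ij [Si hi]] := (hinvP j).1 Tj.
  rewrite -hi map_f // mem_filter mem_set //= in_fsetU in_fset; apply/orP; right.
  by rewrite /= mem_pmap -ij map_f.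
have imP (s : seq I) : j \in [seq h i | i <- s] -> exists2 i, i \in s & j = h i.
  by elim: s => // i s IH; rewrite inE => /predU1P[->|/IH[i' i's ->]];
    [exists i; rewrite ?mem_head|exists i'; rewrite // inE i's orbT].
move=> /imP[k]; rewrite mem_filter => /andP[/set_mem Sk kB] ->.
split; first exact/mem_set/hT.
move: kB; rewrite in_fsetU in_fset => /orP[kA|].
  by apply: (fsubsetP AB'); apply/imfsetP; exists k.
rewrite /= mem_pmap.
have omP (s : seq J) : Some k \in [seq hinv j | j <- s] -> exists2 j, j \in s & Some k = hinv j.
  elim: s => // j' s IH; rewrite inE => /predU1P[->|/IH[j'' j''s ->]];
    [by exists j'; rewrite ?mem_head|by exists j''; rewrite // inE j''s orbT].
move=> /omP[j' j'B' ij'].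
by rewrite ((hinvP j').2 _ (esym ij')).
Qed.

(** If some [d i] vanishes, both sides are 0 by the convention [x / 0 = 0]: on the left in one
    factor, on the right for the whole product. *)
Lemma infprod_quotient (I : choiceType) (S : set I) (c d : I -> C) :
  sumb S (fun i => nrm (c i - 1)) -> sumb S (fun i => nrm (d i - 1)) ->
  infprod_cvg S (fun i => c i / d i) /\
  infprod S (fun i => c i / d i) = infprod S c / infprod S d.
Proof.
move=> cs ds; have [d0|] := pselect (forall i, S i -> d i != 0).
  have [dc dE] := infprodV (sumb_infprod_cvg ds) (infprod_neq0 ds d0).
  by have [H1 H2] := infprodM (sumb_infprod_cvg cs) dc; rewrite -dE.
move=> /existsNP[i /not_implyP[Si /negP]]; rewrite negbK => /eqP di0.
have [_ ->] := infprod_eq0 Si di0; rewrite invr0 mulr0.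
by apply: infprod_eq0 Si _; rewrite di0 invr0 mulr0.
Qed.

Lemma sumb_lattice (c t s : C) : 0 < complex.Im t -> 0 < complex.Im s ->
  sumb [set: nat * nat] (fun jk => nrm (1 - c * (e2pi t ^+ jk.1 * e2pi s ^+ jk.2) - 1)).
Proof.
move=> t0 s0.
have t1 : 0 <= nrm (e2pi t) < 1 by rewrite nrm_ge0 nrm_e2pi_lt1.
have s1 : 0 <= nrm (e2pi s) < 1 by rewrite nrm_ge0 nrm_e2pi_lt1.
have H := @sumb_geometric2 _ _ [set: nat * nat] id _ _ t1 s1 (fun i j _ _ e => e).
apply: sumb_le (sumbZ (nrm_ge0 c) H) => -[j k] _ /=.
by rewrite addrAC subrr add0r -mulN1r !nrmM !nrmX nrmN nrm1 mul1r.
Qed.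

Lemma egamma_factorE (z t s : C) jk : egamma_factor z t s jk =
  (1 - e2pi (t + s - z) * (e2pi t ^+ jk.1 * e2pi s ^+ jk.2)) /
  (1 - e2pi z * (e2pi t ^+ jk.1 * e2pi s ^+ jk.2)).
Proof.
case: jk => j k; rewrite /egamma_factor /=.
have -> : j.+1%:R * t + k.+1%:R * s - z = (t + s - z) + (j%:R * t + k%:R * s).
  by rewrite -!natr1; ring.
by rewrite [_ + z]addrC (e2piD (t + s - z)) (e2piD z) (e2piD (j%:R * t)) !e2piMn.
Qed.

Lemma egamma_factor_cvg (z t s : C) : 0 < complex.Im t -> 0 < complex.Im s ->
  infprod_cvg [set: nat * nat] (egamma_factor z t s) /\
  egamma_pos z t s =
    infprod [set: nat * nat] (fun jk => 1 - e2pi (t + s - z) * (e2pi t ^+ jk.1 * e2pi s ^+ jk.2)) /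
    infprod [set: nat * nat] (fun jk => 1 - e2pi z * (e2pi t ^+ jk.1 * e2pi s ^+ jk.2)).
Proof.
move=> t0 s0; rewrite /egamma_pos (funext (egamma_factorE z t s)).
by apply: infprod_quotient; exact: sumb_lattice.
Qed.

Lemma theta0_factor_cvg (z t : C) : 0 < complex.Im t -> infprod_cvg [set: nat] (theta0_factor z t).
Proof.
move=> t0.
have := @lip_summable_theta0 R (fun _ => z) (fun _ => t) (0, 0)
  (differentiable_cstC _ _) (differentiable_cstC _ _) t0.
exact: lip_summable_cvg.
Qed.

(** [dl] picks one form for each pair of values on [a] and [b]. Another representative of its class
    changes the exponent by an integer only. *)
Lemma gnum_reindex (a b : Lprim) y (dl : nat * nat -> 'rV[int]_3) (F : nat * nat -> C) :
  V a y -> V b y -> sval a != sval b ->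
  (forall jk, 0 < ev (dl jk) (sval a) /\ ev (dl jk) (sval b) <= 0) ->
  (forall jk jk', ev (dl jk) (sval a) = ev (dl jk') (sval a) ->
     ev (dl jk) (sval b) = ev (dl jk') (sval b) -> jk = jk') ->
  (forall d, 0 < ev d (sval a) -> ev d (sval b) <= 0 -> exists jk,
     ev (dl jk) (sval a) = ev d (sval a) /\ ev (dl jk) (sval b) = ev d (sval b)) ->
  (forall jk, F jk =
     1 - e2pi (- ((evZ (dl jk) y.2 - y.1) / evZ (direction (sval a) (sval b)) y.2))) ->
  infprod_cvg [set: nat * nat] F -> gnum a b y = infprod [set: nat * nat] F.
Proof.
move=> Va Vb neq dlC dl_inj dl_surj FE Fc.
have ab := V_independent Va Vb neq.
set g := direction _ _ in FE.
have g0 : evZ g y.2 != 0 := direction_neq0 ab Va.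
have ev0a : ev g (sval a) = 0 := ev_direction_l ab.
have ev0b : ev g (sval b) = 0 := ev_direction_r ab.
have memo d : Zorbit g d d by exists 0 => //; rewrite scale0r addr0.
apply: (@infprod_reindex _ _ _ _ (fun jk => Zorbit g (dl jk)) F); last exact: Fc.
- by move=> jk _; exists (dl jk) => //; exact: dlC.
- move=> jk jk' _ _ E; have : Zorbit g (dl jk) (dl jk') by rewrite E.
  by move=> [k _ kE]; apply: dl_inj; rewrite -kE evD evZl ?ev0a ?ev0b mulr0 addr0.
- move=> K KC; have [_ da db KE] := CpmP ab KC.
  have [jk [ja jb]] := dl_surj _ da db; exists jk => //.
  have KC' : Cpm (sval a) (sval b) (Zorbit g (dl jk)) by exists (dl jk) => //; exact: dlC.
  apply: (Cpm_inj ab KC' KC).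
    have [[k _ kE] _ _ _] := CpmP ab KC'.
    by rewrite -kE evD evZl ev0a mulr0 addr0.
  have [[k _ kE] _ _ _] := CpmP ab KC'.
  by rewrite -kE evD evZl ev0b mulr0 addr0.
- move=> jk _; rewrite FE /Gamma_num_factor -/g.
  have KC : Cpm (sval a) (sval b) (Zorbit g (dl jk)) by exists (dl jk) => //; exact: dlC.
  have [[k _ <-] _ _ _] := CpmP ab KC; rewrite evZD evZZ addrAC mulrDl mulfK //.
  by rewrite opprD -rmorphN e2piD e2pi_int mulr1.
Qed.

End EllipticGamma.

Section CoordinatePlanes.
Context {R : realType}.
Local Notation C := R[i].
Local Notation Y := (C * 'cV[C]_3)%type.
Implicit Types (d g : 'rV[int]_3) (y : Y).

Lemma ev_e1 d : ev d (sval e1) = d 0 0.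
Proof. by rewrite evE /dot /= !mxE /= mulr1 !mulr0 !addr0. Qed.

Lemma ev_e2 d : ev d (sval e2) = d 0 1.
Proof. by rewrite evE /dot /= !mxE /= mulr1 !mulr0 addr0 add0r. Qed.

Lemma crs_e12 i : crs ((sval e1)^~ 0) ((sval e2)^~ 0) i = (i == 2)%:R.
Proof. by move: i; apply: ord3P; rewrite /crs /= !mxE /=. Qed.

Lemma independent_e12 : independent (sval e1) (sval e2).
Proof. by exists 2; rewrite crs_e12. Qed.

Lemma direction_e12 : direction (sval e1) (sval e2) = delta_mx 0 2.
Proof.
have [gP [s s0 sP]] := directionP independent_e12.
have g0 : direction (sval e1) (sval e2) 0 0 = 0.
  by apply: (mulfI (lt0r_neq0 s0)); rewrite -sP crs_e12 mulr0.
have g1 : direction (sval e1) (sval e2) 0 1 = 0.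
  by apply: (mulfI (lt0r_neq0 s0)); rewrite -sP crs_e12 mulr0.
have g2 : direction (sval e1) (sval e2) 0 2 = 1.
  by have := sP 2; rewrite crs_e12 /=; move: (direction _ _ _ _) s0 => *; nia.
by apply/matrixP => i j; rewrite ord1 mxE eqxx; move: j; apply: ord3P.
Qed.

Lemma evZ_delta j (x : 'cV[C]_3) : evZ (delta_mx 0 j) x = x j 0.
Proof.
rewrite /evZ /ev mxE (bigD1 j) //= !mxE !eqxx mul1r big1 ?addr0 // => k kj.
by rewrite !mxE (negbTE kj) andbF mul0r.
Qed.

(** The direction is the third coordinate form, and Im(x1/x3) < 0 < Im(x2/x3) on this domain. Hence
    [egamma] is the inverse of a product with parameter -x1/x3, whose denominator is the numerator
    of [Gamma]. *)
Lemma Gamma_e12 y : V e1 y -> V e2 y ->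
  Gamma e1 e2 y = egamma (y.1 / y.2 2 0) (y.2 0 0 / y.2 2 0) (y.2 1 0 / y.2 2 0).
Proof.
move=> V1 V2; have ab := independent_e12.
have neq12 : sval e1 != sval e2.
  by apply/eqP => /matrixP/(_ 0 0); rewrite !mxE.
have neq21 : sval e2 != sval e1 by rewrite eq_sym.
have g0 := direction_neq0 ab V1; rewrite direction_e12 evZ_delta in g0.
have crs_delta (c : 'I_3 -> int) : (\row_i crs c ((delta_mx 0 2 : 'rV[int]_3) 0) i) =
    c 1 *: delta_mx 0 0 - c 0 *: delta_mx 0 1.
  by apply/matrixP => i j; rewrite ord1 !mxE; move: j; apply: ord3P; rewrite /crs /= !mxE /=; ring.
have Imt : complex.Im (y.2 0 0 / y.2 2 0) < 0.
  have := Im_edge_div ab (or_intror erefl) ((VP e2 y).1 V2).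
  by rewrite direction_e12 crs_delta evZ_delta /= !mxE /= scale1r scale0r subr0 evZ_delta.
have Ims : 0 < complex.Im (y.2 1 0 / y.2 2 0).
  have := Im_edge_div ab (or_introl erefl) ((VP e1 y).1 V1).
  rewrite direction_e12 crs_delta evZ_delta /= !mxE /= scale1r scale0r sub0r evZN evZ_delta mulNr.
  by case: (_ / _) => ? ? /=; rewrite oppr_lt0.
set z := y.1 / _; set t := y.2 0 0 / _ in Imt *; set s := y.2 1 0 / _ in Ims *.
have ImNt : 0 < complex.Im (- t) by move: Imt; case: (t) => ? ? /=; rewrite oppr_gt0.
rewrite /egamma ltNge (ltW Imt) /= Ims.
have [_ ->] := egamma_factor_cvg (z - t) ImNt Ims.
rewrite invfM invrK mulrC GammaE //; congr (_ / _).
- apply: (@gnum_reindex _ e1 e2 y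
    (fun jk => jk.1.+1%:Z *: delta_mx 0 0 - jk.2%:Z *: delta_mx 0 1)) => //.
  + by move=> [j k]; rewrite ev_e1 ev_e2 !mxE /= mulr1 mulr0 mulr1 mulr0; split; lia.
  + move=> [j k] [j' k']; rewrite !ev_e1 !ev_e2 !mxE /= !mulr1 !mulr0 => *.
    by congr (_, _); lia.
  + move=> d; rewrite ev_e1 ev_e2 => d0 d1.
    exists (`|d 0%R 0%R|.-1, `|d 0%R 1%R|%N); rewrite !ev_e1 !ev_e2 !mxE /= !mulr1 !mulr0.
    by split; lia.
  + move=> [j k] /=; rewrite direction_e12 evZ_delta evZB !evZZ !evZ_delta.
    rewrite -!e2piMn -!e2piD; congr (1 - e2pi _).
    by rewrite /z /t /s -!pmulrn -natr1; field.
  + exact: sumb_infprod_cvg (sumb_lattice _ ImNt Ims).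
- apply: (@gnum_reindex _ e2 e1 y
    (fun jk => jk.2.+1%:Z *: delta_mx 0 1 - jk.1%:Z *: delta_mx 0 0)) => //.
  + by move=> [j k]; rewrite ev_e1 ev_e2 !mxE /= mulr1 mulr0 mulr1 mulr0; split; lia.
  + move=> [j k] [j' k']; rewrite !ev_e1 !ev_e2 !mxE /= !mulr1 !mulr0 => *.
    by congr (_, _); lia.
  + move=> d; rewrite ev_e1 ev_e2 => d0 d1.
    exists (`|d 0%R 0%R|%N, `|d 0%R 1%R|.-1); rewrite !ev_e1 !ev_e2 !mxE /= !mulr1 !mulr0.
    by split; lia.
  + move=> [j k] /=; rewrite (direction_swap ab) evZN direction_e12 evZ_delta evZB !evZZ !evZ_delta.
    rewrite -!e2piMn -!e2piD; congr (1 - e2pi _).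
    by rewrite /z /t /s -!pmulrn -natr1; field.
  + exact: sumb_infprod_cvg (sumb_lattice _ ImNt Ims).
Qed.

End CoordinatePlanes.

(** * The double complex *)

Section Cochains.
Context {R : realType}.
Local Notation C := R[i].
Local Notation Y := (C * 'cV[C]_3)%type.
Implicit Types (d : 'rV[int]_3) (y z : Y) (g h : ISL3) (a b : Lprim).

Lemma Lprim_inj a b : sval a = sval b -> a = b.
Proof.
case: a b => [a pa] [b pb] /= ab; move: pa pb; rewrite ab => pa pb.
by congr exist; exact: Prop_irrelevance.
Qed.

Lemma act_primM g h a : act_prim (g * h)%g a = act_prim g (act_prim h a).
Proof. by apply: Lprim_inj; rewrite /= mulmxA. Qed.

Lemma V_actV g a y : V (act_prim g^-1%g a) (act_pt g^-1%g y) <-> V a y.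
Proof. exact: V_act. Qed.

Lemma open_Vs q (aa : q.+1.-tuple Lprim) : open (Vs aa : set Y).
Proof.
rewrite openE => y yV.
exact: (@filter_forall Y 'I_q.+1 (fun i => V (tnth aa i)) (nbhs y) _ (fun i => near_V (yV i))).
Qed.

Lemma height_scale (l : C) (c : 'I_3 -> R) (x : 'cV[C]_3) :
  height c (l *: x) = nrm l ^+ 2 * height c x.
Proof.
rewrite nrm_sqr /height /dot /crs /rex /imx !mxE.
by case: l (x 0 0) (x 1 0) (x 2 0) => [l m] [x0 y0] [x1 y1] [x2 y2] /=; ring.
Qed.

Lemma V_scale (l : C) a y : l != 0 -> V a y -> V a (scale_pt l y).
Proof.
by move=> l0 /VP h; apply/VP; rewrite /= height_scale mulr_gt0 // exprn_gt0 // nrm_gt0.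
Qed.

Lemma cone_Vs q (aa : q.+1.-tuple Lprim) : cone (Vs aa : set Y).
Proof. by split; [exact: open_Vs|move=> l y l0 yV i; exact: V_scale]. Qed.

Lemma differentiable_act_pt g y : differentiable (act_pt g : Y -> Y) y.
Proof.
have lin_fst : differentiable (fun y : Y => y.1 - evZ (tra g) y.2) y.
  exact: differentiable_subC (differentiable_fst _) (differentiable_evZ _ _).
pose M : 'M[C]_3 := map_mx intr (lin g).
have lin_snd : differentiable (fun y : Y => M *m y.2) y.
  have -> : (fun y : Y => M *m y.2) =
      (fun y => y.2 0 0 *: col 0 M) \+ (fun y => y.2 1 0 *: col 1 M) \+ (fun y => y.2 2 0 *: col 2 M).
    apply/funext => z; apply/matrixP => i j.
    by rewrite !mxE sum3 ord1 !mxE; ring.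
  have cd k : differentiable (fun y : Y => y.2 k 0 *: col k M) y.
    exact: differentiableZl (differentiable_coord_snd k y).
  exact: differentiableD (differentiableD (cd 0) (cd 1)) (cd 2).
exact: differentiable_pair lin_fst lin_snd.
Qed.

(** The action on hyperplanes by preimage: the inverse of g carries the hyperplane of d to that of
    [tau g d]. Composition is reversed, so this is a right action. *)
Definition tau g d := d *m lin g + tra g.

Lemma tauM g h d : tau h (tau g d) = tau (g * h)%g d.
Proof. by rewrite /tau mulmxDl -addrA -mulmxA. Qed.

Lemma tau1 d : tau 1%g d = d.
Proof. by rewrite /tau mulmx1 addr0. Qed.

Lemma hyp_act g d y : hyp (tau g d) y = hyp d (act_pt g y).
Proof.
rewrite /hyp evZD (_ : evZ (d *m lin g) y.2 = evZ d (act_pt g y).2) /=; first by ring.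
by rewrite /evZ /ev map_mxM mulmxA.
Qed.

Lemma hasdiv_act g (F : Y -> C) (m : 'rV[int]_3 -> int) y : hasdiv F m (act_pt g^-1%g y) ->
  hasdiv (fun z => F (act_pt g^-1%g z)) (fun d => m (tau g d)) y.
Proof.
apply: (@hasdiv_pullback _ (act_pt g^-1%g) (tau g^-1%g) (tau g)).
- exact: differentiable_act_pt.
- by move=> d; rewrite tauM mulVg tau1.
- by move=> d; rewrite tauM mulgV tau1.
- exact: hyp_act.
Qed.

Lemma gnear_act g y (P : Y -> Prop) : gnear (act_pt g y) P -> gnear y (fun z => P (act_pt g z)).
Proof.
apply: gnear_pullback; first exact: differentiable_act_pt.
by move=> d; exists (tau g d) => z; rewrite hyp_act.
Qed.

Lemma gnear_forall n y (P : 'I_n -> Y -> Prop) : (forall i, gnear y (P i)) ->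
  gnear y (fun z => forall i, P i z).
Proof.
move=> H; have gnear_seq (r : seq 'I_n) : gnear y (fun z => forall i, i \in r -> P i z).
  elim: r => [|k r IH]; first by apply: gnearW; apply: nearT.
  apply: gnearS (gnearI (H k) IH) => z [Pk Pr] i; rewrite inE => /orP[/eqP -> //|]; exact: Pr.
by apply: gnearS (gnear_seq (enum 'I_n)) => z Pz i; apply: Pz; rewrite mem_enum.
Qed.

Lemma Vs_lift q (aa : q.+2.-tuple Lprim) (i : 'I_q.+2) y : Vs aa y ->
  Vs [tuple tnth aa (lift i j) | j < q.+1] y.
Proof. by move=> yV j; rewrite tnth_mktuple. Qed.

Lemma Vs_act q (aa : q.+1.-tuple Lprim) g y : Vs aa y ->
  Vs (map_tuple (act_prim g^-1%g) aa) (act_pt g^-1%g y).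
Proof. by move=> yV j; rewrite tnth_map; apply/V_actV. Qed.

(** This property and [gen_eq] are stable under both coboundaries. For the extension of Ds they make
    its coboundary holomorphic and generically equal to D(Ds). *)
Definition unit_cochain p q (c : cochain p q : Type) :=
  forall gg aa y, Vs aa y -> germ_unit (c gg aa : Y -> C) y.

Definition gen_eq p q (c c' : @cochain R p q) :=
  forall gg aa y, Vs aa y -> gnear y (fun z => c gg aa z = c' gg aa z).

Lemma germ_unit_sgnpow n (u : Y -> C) y : germ_unit u y -> germ_unit (fun z => sgnpow n (u z)) y.
Proof. by rewrite /sgnpow; case: odd => // uu; exact: germ_unitV. Qed.

Lemma germ_unit_prod (I : Type) (r : seq I) (u : I -> Y -> C) y :
  (forall j, germ_unit (u j) y) -> germ_unit (fun z => \prod_(j <- r) u j z) y.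
Proof.
move=> uu; elim: r => [|j r IH].
  rewrite (_ : (fun z => _) = (fun _ => 1)); first exact: germ_unit1.
  by apply/funext => z; rewrite big_nil.
rewrite (_ : (fun z => _) = (fun z => u j z * \prod_(k <- r) u k z)); first exact: germ_unitM.
by apply/funext => z; rewrite big_cons.
Qed.

Lemma unit_group_cob p q (c : @cochain R p q) : unit_cochain c -> unit_cochain (group_cob c).
Proof.
move=> cu gg aa y yV; rewrite /group_cob.
apply: germ_unitM; last exact: cu.
apply: germ_unitM; last by apply: germ_unit_prod => j; apply: germ_unit_sgnpow; exact: cu.
apply: germ_unit_sgnpow.
exact: (germ_unit_pullback (differentiable_act_pt _) (cu _ _ _ (Vs_act _ yV))).
Qed.

Lemma unit_cech_cob p q (c : @cochain R p q) : unit_cochain c -> unit_cochain (cech_cob c).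
Proof.
move=> cu gg aa y yV; rewrite /cech_cob.
by apply: germ_unit_prod => j; apply: germ_unit_sgnpow; apply: cu; exact: Vs_lift.
Qed.

Lemma unit_one p q : unit_cochain (@one_cochain R p q).
Proof. by move=> gg aa y _; exact: germ_unit1. Qed.

Lemma unit_Dtot (c : total_cochain R) : (forall p q, unit_cochain (c p q)) ->
  forall p q, unit_cochain (@Dtot R c p q).
Proof.
move=> cu p q gg aa y yV; rewrite /Dtot; apply: germ_unitM.
  by case: p gg => [|p] gg; [exact: unit_one|exact: unit_group_cob].
apply: germ_unit_sgnpow.
by case: q aa yV => [|q] aa yV; [exact: unit_one|exact: unit_cech_cob].
Qed.

Lemma gen_eq_group_cob p q (c c' : @cochain R p q) : gen_eq c c' ->
  gen_eq (group_cob c) (group_cob c').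
Proof.
move=> cc' gg aa y yV.
have H1 := gnear_act (cc' (behead_tuple gg) _ _ (Vs_act (thead gg) yV)).
have H2 := gnear_forall (fun j : 'I_p => cc' (merge_at j gg) aa y yV).
have H3 := cc' [tuple tnth gg (widen_ord (leqnSn p) i) | i < p] aa y yV.
apply: gnearS (gnearI H1 (gnearI H2 H3)) => z [E1 [E2 E3]].
rewrite /group_cob E1 E3; congr (_ * _ * _).
by apply: eq_bigr => j _; rewrite E2.
Qed.

Lemma gen_eq_cech_cob p q (c c' : @cochain R p q) : gen_eq c c' ->
  gen_eq (cech_cob c) (cech_cob c').
Proof.
move=> cc' gg aa y yV.
have := gnear_forall (fun i : 'I_q.+2 => cc' gg _ y (Vs_lift i yV)).
by apply: gnearS => z E; rewrite /cech_cob; apply: eq_bigr => i _; rewrite E.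
Qed.

Lemma gen_eq_refl p q (c : @cochain R p q) : gen_eq c c.
Proof. by move=> gg aa y _; apply: gnearW; apply: nearT. Qed.

Lemma gen_eq_Dtot (c c' : total_cochain R) : (forall p q, gen_eq (c p q) (c' p q)) ->
  forall p q, gen_eq (@Dtot R c p q) (@Dtot R c' p q).
Proof.
move=> cc' p q gg aa y yV; rewrite /Dtot.
have H1 : gnear y (fun z =>
    match p return cochain p q with 0 => @one_cochain R 0 q | p'.+1 => group_cob (c p' q) end gg aa z =
    match p return cochain p q with 0 => @one_cochain R 0 q | p'.+1 => group_cob (c' p' q) end gg aa z).
  by case: p gg => [|p] gg; [exact: gen_eq_refl|exact: gen_eq_group_cob].
have H2 : gnear y (fun z =>
    match q return cochain p q with 0 => @one_cochain R p 0 | q'.+1 => cech_cob (c p q') end gg aa z =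
    match q return cochain p q with 0 => @one_cochain R p 0 | q'.+1 => cech_cob (c' p q') end gg aa z).
  by case: q aa yV {H1} => [|q] aa yV; [exact: gen_eq_refl|exact: gen_eq_cech_cob].
by apply: gnearS (gnearI H1 H2) => z [-> ->].
Qed.

Lemma group_cob_one p q : group_cob (@one_cochain R p q) = @one_cochain R p.+1 q.
Proof.
apply/funext => gg; apply/funext => aa; apply/funext => z.
rewrite /group_cob /one_cochain /sgnpow big1 ?mulr1 => [|j _]; last by case: odd; rewrite ?invr1.
by case: odd; rewrite ?invr1.
Qed.

Lemma cech_cob_one p q : cech_cob (@one_cochain R p q) = @one_cochain R p q.+1.
Proof.
apply/funext => gg; apply/funext => aa; apply/funext => z.
by rewrite /cech_cob /one_cochain /sgnpow big1 // => j _; case: odd; rewrite ?invr1.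
Qed.

Definition concentrated n (c : total_cochain R) :=
  forall p q, (p + q)%N != n -> c p q = @one_cochain R p q.

Lemma concentrated_Dtot n (c : total_cochain R) : concentrated n c -> concentrated n.+1 (Dtot c).
Proof.
move=> cn p q pq; apply/funext => gg; apply/funext => aa; apply/funext => z; rewrite /Dtot.
have -> : match p return cochain p q with 0 => @one_cochain R 0 q
    | p'.+1 => group_cob (c p' q) end = @one_cochain R p q.
  by case: p pq {gg} => // p; rewrite addSn eqSS => pq; rewrite cn ?group_cob_one.
have -> : match q return cochain p q with 0 => @one_cochain R p 0
    | q'.+1 => cech_cob (c p q') end = @one_cochain R p q.
  by case: q pq {aa} => // q; rewrite addnS eqSS => pq; rewrite cn ?cech_cob_one.
by rewrite /one_cochain /sgnpow; case: odd; rewrite ?invr1 mulr1.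
Qed.

End Cochains.

(** * The identity D(Ds) = 1 in each bidegree *)

Section PairCochain.
Context {R : realType}.
Local Notation C := R[i].
Local Notation Y := (C * 'cV[C]_3)%type.
Implicit Types (y z : Y) (g h : ISL3) (a b c : Lprim).
Variables (Ga : Lprim -> Lprim -> Y -> C) (De : Lprim -> ISL3 -> Y -> C).

Lemma Dtot0S (c : total_cochain R) q gg (aa : q.+2.-tuple Lprim) z :
  @Dtot R c 0 q.+1 gg aa z = cech_cob (c 0 q) gg aa z.
Proof. by rewrite /Dtot /one_cochain mul1r. Qed.

Lemma DtotS0 (c : total_cochain R) p (gg : p.+1.-tuple ISL3) (aa : 1.-tuple Lprim) z :
  @Dtot R c p.+1 0 gg aa z = group_cob (c p 0) gg aa z.
Proof. by rewrite /Dtot /one_cochain /sgnpow invr1 if_same mulr1. Qed.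

Lemma DtotSS (c : total_cochain R) p q (gg : p.+1.-tuple ISL3) (aa : q.+2.-tuple Lprim) z :
  @Dtot R c p.+1 q.+1 gg aa z =
  group_cob (c p q.+1) gg aa z * sgnpow p.+1 (cech_cob (c p.+1 q) gg aa z).
Proof. by []. Qed.

Let s : total_cochain R := pair_cochain Ga De.
Local Notation "g \^ a" := (act_prim g^-1%g a) (at level 30, right associativity).
Local Notation "g \> z" := (act_pt g^-1%g z) (at level 30, right associativity).

Lemma Dtot_pair02 gg (aa : 3.-tuple Lprim) z : @Dtot R s 0 2 gg aa z =
  Ga (tnth aa 1) (tnth aa 2) z * (Ga (tnth aa 0) (tnth aa 2) z)^-1
  * Ga (tnth aa 0) (tnth aa 1) z.
Proof.
rewrite /Dtot /cech_cob /sgnpow /= !big_ord_recl big_ord0 /= !tnth_mktuple mulr1 /one_cochain mul1r mulrA.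
by congr (Ga (tnth aa _) (tnth aa _) _ * (Ga (tnth aa _) (tnth aa _) _)^-1
  * Ga (tnth aa _) (tnth aa _) _); exact: val_inj.
Qed.

Lemma Dtot_pair11 (gg : 1.-tuple ISL3) (aa : 2.-tuple Lprim) z (g := tnth gg 0) : @Dtot R s 1 1 gg aa z =
  (Ga (g \^ tnth aa 0) (g \^ tnth aa 1) (g \> z))^-1 * Ga (tnth aa 0) (tnth aa 1) z
  * (De (tnth aa 1) g z * (De (tnth aa 0) g z)^-1)^-1.
Proof.
rewrite /Dtot /group_cob /cech_cob /sgnpow /= !big_ord_recl !big_ord0 /= !mulr1 /thead !tnth_mktuple !tnth_map.
by congr (_ * (De (tnth aa _) _ _ * (De (tnth aa _) _ _)^-1)^-1); exact: val_inj.
Qed.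

Lemma Dtot_pair20 (gg : 2.-tuple ISL3) (aa : 1.-tuple Lprim) z
    (g := tnth gg 0) (h := tnth gg 1) (a := tnth aa 0) : @Dtot R s 2 0 gg aa z =
  De (g \^ a) h (g \> z) * (De a (g * h)%g z)^-1 * De a g z.
Proof.
rewrite /Dtot /group_cob /sgnpow /= !big_ord_recl !big_ord0 /= !mulr1 /thead !tnth_mktuple !tnth_map /=.
have -> : tnth (behead_tuple gg) ord0 = h by rewrite tnth_behead; congr tnth; apply: val_inj; rewrite /= inordK.
have -> : lift ord0 (0 : 'I_1) = 1 by exact: val_inj.
have -> : widen_ord (leqnSn 1) 0 = 0 by exact: val_inj.
by [].
Qed.

(** The cancellations below divide by these values, so D(Ds) = 1 is obtained generically. *)
Hypothesis Ga_neq0 : forall a b y, V a y -> V b y -> gnear y (fun z => Ga a b z != 0).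
Hypothesis De_neq0 : forall a g y, V a y -> gnear y (fun z => De a g z != 0).

Let Ga_act_neq0 g a b y : V a y -> V b y ->
  gnear y (fun z => Ga (g \^ a) (g \^ b) (g \> z) != 0).
Proof.
by move=> ya yb; apply: (gnear_act (Ga_neq0 _ _)); apply/V_actV.
Qed.

Let De_act_neq0 g a h y : V a y -> gnear y (fun z => De (g \^ a) h (g \> z) != 0).
Proof. by move=> ya; apply: (gnear_act (De_neq0 _ _)); apply/V_actV. Qed.

(** Each edge of the tetrahedron lies on two faces and enters them with opposite exponents. The
    final 1 is an empty product. *)
Local Fact tetrahedron_identity (K : fieldType) (x01 x02 x03 x12 x13 x23 : K) :
  [/\ x01 != 0, x02 != 0 & x03 != 0] -> [/\ x12 != 0, x13 != 0 & x23 != 0] ->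
  (x23 / x13 * x12) * ((x23 / x03 * x02)^-1 * ((x13 / x03 * x01) * ((x12 / x02 * x01)^-1 * 1))) = 1.
Proof. by move=> [h1 h2 h3] [h4 h5 h6]; field; rewrite h1 h2 h3 h4 h5 h6. Qed.

Local Fact triangle_identity (K : fieldType) (x01 x02 x12 y01 y02 y12 d0 d1 d2 : K) :
  [/\ x01 != 0, x02 != 0 & x12 != 0] -> [/\ y01 != 0, y02 != 0 & y12 != 0] ->
  [/\ d0 != 0, d1 != 0 & d2 != 0] ->
  (y12 / y02 * y01)^-1 * 1 * (x12 / x02 * x01) *
  ((y12^-1 * x12 * (d2 / d1)^-1) * ((y02^-1 * x02 * (d2 / d0)^-1)^-1 *
    ((y01^-1 * x01 * (d1 / d0)^-1) * 1)))^-1 = 1.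
Proof.
by move=> [h1 h2 h3] [h4 h5 h6] [h7 h8 h9]; field; rewrite h1 h2 h3 h4 h5 h6 h7 h8 h9.
Qed.

(** [u'] is the value at (gh)^-1 y and [u] the same value reached through h^-1 (g^-1 y). *)
Local Fact pair_identity (K : fieldType) (x y u u' da db ea eb fa fb : K) : u' = u ->
  [/\ x != 0, y != 0 & u != 0] -> [/\ da != 0, ea != 0 & fa != 0] ->
  [/\ db != 0, eb != 0 & fb != 0] ->
  (u^-1 * y * (eb / ea)^-1) * ((u'^-1 * x * (fb / fa)^-1)^-1 * 1) * (y^-1 * x * (db / da)^-1) *
  ((eb / fb * db) * ((ea / fa * da)^-1 * 1)) = 1.
Proof.
by move=> -> [h1 h2 h3] [h4 h5 h6] [h7 h8 h9]; field; rewrite h1 h2 h3 h4 h5 h6 h7 h8 h9.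
Qed.

(** The primed variables are second spellings, through (gh)^-1 = h^-1 g^-1 and through
    associativity. *)
Local Fact vertex_identity (K : fieldType) (e1 e1' e2 e3 d1 d2 d3 d3' : K) : e1' = e1 -> d3' = d3 ->
  [/\ e1 != 0, e2 != 0 & e3 != 0] -> [/\ d1 != 0, d2 != 0 & d3 != 0] ->
  (e1 / e2 * e3)^-1 * ((e1' / d3' * d2) * ((e2 / d3 * d1)^-1 * 1)) * (e3 / d2 * d1) = 1.
Proof. by move=> -> -> [h1 h2 h3] [h4 h5 h6]; field; rewrite h1 h2 h3 h4 h5 h6. Qed.

Lemma Dtot2_pair03 gg (aa : 4.-tuple Lprim) y : Vs aa y ->
  gnear y (fun z => @Dtot R (Dtot s) 0 3 gg aa z = 1).
Proof.
case/tupleP: aa => a aa; case/tupleP: aa => b aa; case/tupleP: aa => c aa.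
case/tupleP: aa => d aa; rewrite (tuple0 aa) => yV.
have [ya yb yc yd] : [/\ V a y, V b y, V c y & V d y].
  by split; [exact: (yV 0)|exact: (yV 1)|exact: (yV 2)|exact: (yV ord_max)].
have nz1 := gnearI (Ga_neq0 ya yb) (gnearI (Ga_neq0 ya yc) (Ga_neq0 ya yd)).
have nz2 := gnearI (Ga_neq0 yb yc) (gnearI (Ga_neq0 yb yd) (Ga_neq0 yc yd)).
apply: gnearS (gnearI nz1 nz2) => z [[? [? ?]] [? [? ?]]].
rewrite Dtot0S /cech_cob !big_ord_recl big_ord0 !Dtot_pair02 !tnth_mktuple /sgnpow.
exact: tetrahedron_identity.
Qed.

Lemma Dtot2_pair12 (gg : 1.-tuple ISL3) (aa : 3.-tuple Lprim) y : Vs aa y ->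
  gnear y (fun z => @Dtot R (Dtot s) 1 2 gg aa z = 1).
Proof.
case/tupleP: gg => g gg; rewrite (tuple0 gg).
case/tupleP: aa => a aa; case/tupleP: aa => b aa; case/tupleP: aa => c aa.
rewrite (tuple0 aa) => yV.
have [ya yb yc] : [/\ V a y, V b y & V c y].
  by split; [exact: (yV 0)|exact: (yV 1)|exact: (yV 2)].
have nz1 := gnearI (Ga_neq0 ya yb) (gnearI (Ga_neq0 ya yc) (Ga_neq0 yb yc)).
have nz2 := gnearI (Ga_act_neq0 g ya yb) (gnearI (Ga_act_neq0 g ya yc) (Ga_act_neq0 g yb yc)).
have nz3 := gnearI (De_neq0 g ya) (gnearI (De_neq0 g yb) (De_neq0 g yc)).
apply: gnearS (gnearI nz1 (gnearI nz2 nz3)) => z [[? [? ?]] [[? [? ?]] [? [? ?]]]].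
rewrite DtotSS /cech_cob /group_cob !big_ord_recl !big_ord0 !Dtot_pair02 !Dtot_pair11 !tnth_mktuple /sgnpow.
exact: triangle_identity.
Qed.

Lemma Dtot2_pair21 (gg : 2.-tuple ISL3) (aa : 2.-tuple Lprim) y : Vs aa y ->
  gnear y (fun z => @Dtot R (Dtot s) 2 1 gg aa z = 1).
Proof.
case/tupleP: gg => g gg; case/tupleP: gg => h gg; rewrite (tuple0 gg).
case/tupleP: aa => a aa; case/tupleP: aa => b aa; rewrite (tuple0 aa) => yV.
have [ya yb] : V a y /\ V b y by split; [exact: (yV 0)|exact: (yV 1)].
have nz1 := gnearI (Ga_neq0 ya yb) (gnearI (Ga_act_neq0 g ya yb) (Ga_act_neq0 (g * h)%g ya yb)).
have nz2 := gnearI (De_neq0 g ya) (gnearI (De_act_neq0 g h ya) (De_neq0 (g * h)%g ya)).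
have nz3 := gnearI (De_neq0 g yb) (gnearI (De_act_neq0 g h yb) (De_neq0 (g * h)%g yb)).
apply: gnearS (gnearI nz1 (gnearI nz2 nz3)) => z [[? [? nu]] [[? [? ?]] [? [? ?]]]].
have uE : Ga ((g * h)%g \^ a) ((g * h)%g \^ b) ((g * h)%g \> z) =
    Ga (h \^ g \^ a) (h \^ g \^ b) (h \> g \> z) by rewrite invgM !act_primM act_ptM.
rewrite uE in nu.
rewrite DtotSS /cech_cob /group_cob !big_ord_recl !big_ord0 !Dtot_pair11 !Dtot_pair20 /merge_at
  !tnth_mktuple /sgnpow.
by apply: pair_identity => //; exact: uE.
Qed.

Lemma Dtot2_pair30 (gg : 3.-tuple ISL3) (aa : 1.-tuple Lprim) y : Vs aa y ->
  gnear y (fun z => @Dtot R (Dtot s) 3 0 gg aa z = 1).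
Proof.
case/tupleP: gg => g gg; case/tupleP: gg => h gg; case/tupleP: gg => k gg; rewrite (tuple0 gg).
case/tupleP: aa => a aa; rewrite (tuple0 aa) => yV.
have ya : V a y by exact: (yV 0).
have nz1 := gnearI (De_act_neq0 (g * h)%g k ya) (gnearI (De_act_neq0 g (h * k)%g ya) (De_act_neq0 g h ya)).
have nz2 := gnearI (De_neq0 g ya) (gnearI (De_neq0 (g * h)%g ya) (De_neq0 (g * (h * k))%g ya)).
apply: gnearS (gnearI nz1 nz2) => z [[nu [? ?]] [? [? ?]]].
have uE : De ((g * h)%g \^ a) k ((g * h)%g \> z) = De (h \^ g \^ a) k (h \> g \> z).
  by rewrite invgM !act_primM act_ptM.
rewrite uE in nu.
rewrite DtotS0 /group_cob !big_ord_recl !big_ord0 !Dtot_pair20 /merge_at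
  !tnth_mktuple /sgnpow.
have dE : De a ((g * h) * k)%g z = De a (g * (h * k))%g z by rewrite mulgA.
by apply: vertex_identity.
Qed.

End PairCochain.

(** * The gerbe of the section *)

Section Gerbe.
Context {R : realType}.
Local Notation C := R[i].
Local Notation Y := (C * 'cV[C]_3)%type.
Implicit Types (y z : Y) (g h : ISL3) (a b c : Lprim).
Local Notation "g \^ a" := (act_prim g^-1%g a) (at level 30, right associativity).
Local Notation "g \> z" := (act_pt g^-1%g z) (at level 30, right associativity).

Lemma evZ_scale d (l : C) (x : 'cV[C]_3) : evZ d (l *: x) = l * evZ d x.
Proof. by rewrite /evZ /ev -scalemxAr mxE. Qed.

Lemma divC_scale (l u v : C) : l != 0 -> (l * u) / (l * v) = u / v.
Proof. by move=> l0; rewrite invfM mulrACA divff ?mul1r. Qed.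

Lemma Gamma_scale a b (l : C) y : l != 0 -> Gamma a b (scale_pt l y) = Gamma a b y.
Proof.
move=> l0; rewrite /Gamma.
have -> : Gamma_num_factor (sval a) (sval b) (scale_pt l y).1 (scale_pt l y).2 =
    Gamma_num_factor (sval a) (sval b) y.1 y.2.
  by apply/funext => K; rewrite /Gamma_num_factor !evZ_scale -mulrBr divC_scale.
have -> : Gamma_den_factor (sval a) (sval b) (scale_pt l y).1 (scale_pt l y).2 =
    Gamma_den_factor (sval a) (sval b) y.1 y.2.
  by apply/funext => K; rewrite /Gamma_den_factor !evZ_scale -mulrBr divC_scale.
by [].
Qed.

Lemma Delta_scale f a g (l : C) y : l != 0 -> Delta f a g (scale_pt l y) = Delta f a g y.
Proof.
move=> l0; rewrite /Delta /Delta_dual !evZ_scale (divC_scale _ _ l0).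
set F := (X in prodz _ X); set F' := (X in _ = prodz _ X).
suff -> : F = F' by [].
by apply/funext => j; rewrite /F /F' mulrCA -mulrDr (divC_scale _ _ l0).
Qed.

Lemma act_pt_scale g (l : C) y : act_pt g (scale_pt l y) = scale_pt l (act_pt g y).
Proof. by rewrite /act_pt /scale_pt /= evZ_scale mulrBr -scalemxAr. Qed.

(** With mu the translation part of g, this is (d g + mu)(g^-1 a) = (d + mu g^-1)(a). It puts the
    order of Delta into the shape of a coboundary of [pos]. *)
Lemma pos_act g a d : pos (g \^ a) (tau g d) = pos a (d + tra g *m invmx (lin g)).
Proof.
rewrite /pos; congr (if 0 < _ then _ else _).
by rewrite /ev /tau /= /lin /= -/(lin g) mulmxA mulmxDl mulmxK ?unit_lin.
Qed.

Variables (f : Lprim -> 'M[int]_3) (hf : framing f).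
Let s : total_cochain R := pair_cochain (@Gamma R) (@Delta R f).

Let hasdiv_De a g y : V a y ->
  hasdiv (Delta f a g) (fun d => pos (g \^ a) (tau g d) - pos a d) y.
Proof.
move=> ya; apply: hasdiv_eq_mult (hasdiv_Delta g hf ya) => d _.
by rewrite pos_act.
Qed.

Lemma hasdiv_Dtot p q gg aa y : (p + q)%N = 2%N -> Vs aa y ->
  hasdiv (@Dtot R s p q gg aa) (fun _ => 0) y.
Proof.
case: p gg aa => [|[|[|p]]] gg aa; case: q aa => [|[|[|q]]] aa // _ yV.
- apply: (hasdiv_eq_gnear (gnearW (nearT _ (fun z => esym (Dtot_pair02 _ _ gg aa z))))).
  apply: hasdiv_eq_mult (hasdivM (hasdivM (hasdiv_Gamma (yV 1) (yV 2))
    (hasdivV (hasdiv_Gamma (yV 0) (yV 2)))) (hasdiv_Gamma (yV 0) (yV 1))) => d _.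
  by lia.
- apply: (hasdiv_eq_gnear (gnearW (nearT _ (fun z => esym (Dtot_pair11 _ _ gg aa z))))).
  have Ga_act := @hasdiv_act R (tnth gg 0) _ _ y
    (hasdiv_Gamma (proj2 (V_actV _ _ _) (yV 0)) (proj2 (V_actV _ _ _) (yV 1))).
  apply: hasdiv_eq_mult (hasdivM (hasdivM (hasdivV Ga_act) (hasdiv_Gamma (yV 0) (yV 1)))
    (hasdivV (hasdivM (hasdiv_De _ (yV 1)) (hasdivV (hasdiv_De _ (yV 0)))))) => d _.
  by lia.
- apply: (hasdiv_eq_gnear (gnearW (nearT _ (fun z => esym (Dtot_pair20 _ _ gg aa z))))).
  have De_act := @hasdiv_act R (tnth gg 0) _ _ y
    (hasdiv_De (tnth gg 1) (proj2 (V_actV _ _ _) (yV 0))).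
  apply: hasdiv_eq_mult (hasdivM (hasdivM De_act (hasdivV (hasdiv_De _ (yV 0))))
    (hasdiv_De _ (yV 0))) => d _.
  (* The pullbacks by g and h compose to the one by gh, so the intermediate terms cancel. *)
  rewrite /= tauM invgM act_primM; ring.
Qed.

Lemma Dtot_scale p q gg aa : (p + q)%N = 2%N -> invariant_on (Vs aa) (@Dtot R s p q gg aa).
Proof.
case: p gg aa => [|[|[|p]]] gg aa; case: q aa => [|[|[|q]]] aa pq l y l0 _; try by exfalso.
all: rewrite -[(_, _)]/(scale_pt l y).
- by rewrite !Dtot_pair02 !(Gamma_scale _ _ _ l0).
- by rewrite !Dtot_pair11 (act_pt_scale _ l) !(Gamma_scale _ _ _ l0) !(Delta_scale _ _ _ _ l0).
- by rewrite !Dtot_pair20 (act_pt_scale _ l) !(Delta_scale _ _ _ _ l0).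
Qed.

Definition gerbe_of_section : total_cochain R := fun p q =>
  if (p + q == 2)%N then (fun gg aa => holext (@Dtot R s p q gg aa)) else @one_cochain R p q.
Local Notation phi := (@gerbe_of_section).

Lemma concentrated_pair : concentrated 1 s.
Proof. by case=> [|[|p]] [|[|q]]. Qed.

Lemma gerbe_gnear p q gg aa y : (p + q)%N = 2%N -> Vs aa y ->
  gnear y (fun z => phi p q gg aa z = @Dtot R s p q gg aa z).
Proof.
move=> pq yV; rewrite /gerbe_of_section pq eqxx.
by apply: gnearS (gnear_holext (hasdiv_Dtot gg pq yV)) => z.
Qed.

Lemma gerbe_gen_eq p q : gen_eq (phi p q) (@Dtot R s p q).
Proof.
have [pq gg aa y yV|pq] := eqVneq (p + q)%N 2%N; first exact: gerbe_gnear.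
rewrite (concentrated_Dtot concentrated_pair) // /gerbe_of_section (negbTE pq); exact: gen_eq_refl.
Qed.

Lemma gerbe_in_degree : in_degree 2 Ox phi.
Proof.
move=> p q; rewrite /gerbe_of_section; case: eqP => // pq gg aa; apply: holext_Ox; first exact: cone_Vs.
- exact: Dtot_scale.
- by move=> y; exact: hasdiv_Dtot.
Qed.

Lemma unit_gerbe p q : unit_cochain (phi p q).
Proof.
move=> gg aa y yV; rewrite /gerbe_of_section; case: eqP => pq; last exact: germ_unit1.
exact: germ_unit_holext (hasdiv_Dtot _ pq yV).
Qed.

Lemma gerbe_cocycleP : gerbe_cocycle phi.
Proof.
split; first exact: gerbe_in_degree.
move=> p q gg aa y yV; have [pq|pq] := eqVneq (p + q)%N 3%N; last first.
  (* Outside total degree 3 the coboundary is identically 1, since phi is concentrated in degree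
     2. *)
  rewrite (@concentrated_Dtot _ 2) // => p' q' pq'.
  by rewrite /gerbe_of_section (negbTE pq').
apply: eq_germ.
- exact: (proj1 (germ_unit_at (unit_Dtot unit_gerbe gg yV))).
- exact: differentiable_cstC.
have Ga_neq0 a b z : V a z -> V b z -> gnear z (fun z => Gamma a b z != 0).
  by move=> za zb; exact: hasdiv_gnear_neq0 (hasdiv_Gamma za zb).
have De_neq0 a g z : V a z -> gnear z (fun z => Delta f a g z != 0).
  by move=> za; exact: hasdiv_gnear_neq0 (hasdiv_De g za).
have D2 : gnear y (fun z => @Dtot R (Dtot s) p q gg aa z = 1).
  case: p pq gg => [|[|[|[|p]]]]; case: q aa yV => [|[|[|[|q]]]] aa yV // _ gg.
  - exact: Dtot2_pair03.
  - exact: Dtot2_pair12.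
  - exact: Dtot2_pair21.
  - exact: Dtot2_pair30.
by apply: gnearS (gnearI (gen_eq_Dtot gerbe_gen_eq gg yV) D2) => z [-> ->].
Qed.

Lemma gerbe_sectionP : gerbe_section phi s.
Proof.
split=> [p q|p q gg aa].
  case: eqP => pq; last by apply: concentrated_pair; apply/eqP.
  case: p q pq => [|[|p]] [|[|q]] pq gg aa; try by exfalso.
  - apply: (hasdiv_Mx (m := fun _ d => pos (tnth aa 0) d - pos (tnth aa 1) d)).
    + exact: open_Vs.
    + by move=> l y l0 _; exact: (@Gamma_scale _ _ l).
    + by move=> y yV; exact: hasdiv_Gamma (yV 0) (yV 1).
  - apply: (hasdiv_Mx (m := fun _ d => pos (thead gg \^ thead aa) (tau (thead gg) d) - pos (thead aa) d)).
    + exact: open_Vs.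
    + by move=> l y l0 _; exact: (@Delta_scale _ _ _ l).
    + by move=> y yV; exact: hasdiv_De (yV 0).
apply: meq_gnear => y yV.
by apply: gnearS (gerbe_gen_eq gg yV) => z.
Qed.

End Gerbe.

Arguments gerbe_of_section {R} f p q.

(** The components of Ds have this shape in bidegrees (0,2) and (2,0); clearing the denominator
    gives the stated relations. *)
Local Fact divf_mul_mul (K : fieldType) (x y z : K) : y != 0 -> x / y * z * y = z * x.
Proof. by move=> y0; field. Qed.

Local Fact edge_identity (K : fieldType) (x x' d e : K) : x' != 0 -> d != 0 ->
  (x'^-1 * x * (d / e)^-1) * x' * d = e * x.
Proof. by move=> x0 d0; rewrite invf_div; field; rewrite x0 d0. Qed.

(** * The explicit relations for phi *)

Section Relations.
Context {R : realType}.
Local Notation C := R[i].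
Local Notation Y := (C * 'cV[C]_3)%type.
Implicit Types (y z : Y) (g h : ISL3) (a b c : Lprim).

Lemma Vs1 a : Vs [tuple a] = V a :> set Y.
Proof.
apply/seteqP; split=> y /= H; first exact: (H 0).
by move=> k; rewrite ord1.
Qed.

Lemma Vs2 a b : Vs [tuple a; b] = V a `&` V b :> set Y.
Proof.
apply/seteqP; split=> y /= H; first by split; [exact: (H 0)|exact: (H 1)].
by case: H => ya yb; case=> [[|[|k]] hk].
Qed.

Lemma Vs3 a b c : Vs [tuple a; b; c] = V a `&` V b `&` V c :> set Y.
Proof.
apply/seteqP; split=> y /= H; first by split; [split; [exact: (H 0)|exact: (H 1)]|exact: (H 2)].
by case: H => -[ya yb] yc; case=> [[|[|[|k]]] hk].
Qed.

Lemma Gamma_cvg a b y : sval a != sval b -> (V a `&` V b) y ->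
  infprod_cvg (Cpm (sval a) (sval b)) (Gamma_num_factor (sval a) (sval b) y.1 y.2) /\
  infprod_cvg (Cmp (sval a) (sval b)) (Gamma_den_factor (sval a) (sval b) y.1 y.2).
Proof.
move=> ab [ya yb]; have iab := V_independent ya yb ab.
split; first exact: lip_summable_cvg (lip_summable_num ya yb ab).
rewrite Cmp_swap // den_factor_swap //.
by apply: lip_summable_cvg (lip_summable_num yb ya _); rewrite eq_sym.
Qed.

Lemma meq_Gamma_swap a b : meq (V a `&` V b) (fun y => @Gamma R a b y * Gamma b a y) (fun _ => 1).
Proof.
apply: meq_gnear => y [ya yb].
have V_near := gnearI (gnearW (near_V ya)) (gnearW (near_V yb)).
apply: gnearS (gnearI V_near (hasdiv_gnear_neq0 (hasdiv_Gamma ya yb))) => z [[za zb] nz].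
by rewrite (Gamma_inv za zb) mulfV.
Qed.

Variables (f : Lprim -> 'M[int]_3) (hf : framing f).
Local Notation phi := (gerbe_of_section f).

Lemma meq_gerbe02 a b c : meq (V a `&` V b `&` V c)
  (fun y => phi 0%N 2%N [tuple] [tuple a; b; c] y * Gamma a c y)
  (fun y => Gamma a b y * Gamma b c y).
Proof.
apply: meq_gnear => y yV; rewrite -Vs3 in yV.
have nz := hasdiv_gnear_neq0 (hasdiv_Gamma (yV 0) (yV 2)).
apply: gnearS (gnearI (gerbe_gnear hf [tuple] (erefl : (0 + 2 = 2)%N) yV) nz) => z [-> {}nz].
rewrite Dtot_pair02; exact: divf_mul_mul nz.
Qed.

Lemma meq_gerbe11 a b g : meq (V a `&` V b)
  (fun y => phi 1%N 1%N [tuple g] [tuple a; b] y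
     * Gamma (act_prim g^-1%g a) (act_prim g^-1%g b) (act_pt g^-1%g y) * Delta f b g y)
  (fun y => Delta f a g y * Gamma a b y).
Proof.
apply: meq_gnear => y yV; rewrite -Vs2 in yV.
have nz1 := hasdiv_gnear_neq0 (hasdiv_act (hasdiv_Gamma
  (proj2 (V_actV g _ _) (yV 0)) (proj2 (V_actV g _ _) (yV 1)))).
have nz2 := hasdiv_gnear_neq0 (hasdiv_Delta g hf (yV 1)).
apply: gnearS (gnearI (gerbe_gnear hf [tuple g] (erefl : (1 + 1 = 2)%N) yV) (gnearI nz1 nz2)).
move=> z [-> [{}nz1 {}nz2]].
rewrite Dtot_pair11; exact: edge_identity nz1 nz2.
Qed.

Lemma meq_gerbe20 a g h : meq (V a)
  (fun y => phi 2%N 0%N [tuple g; h] [tuple a] y * Delta f a (g * h)%g y)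
  (fun y => Delta f a g y * Delta f (act_prim g^-1%g a) h (act_pt g^-1%g y)).
Proof.
apply: meq_gnear => y yV; rewrite -Vs1 in yV.
have nz := hasdiv_gnear_neq0 (hasdiv_Delta (g * h)%g hf (yV 0)).
apply: gnearS (gnearI (gerbe_gnear hf [tuple g; h] (erefl : (2 + 0 = 2)%N) yV) nz) => z [-> {}nz].
rewrite Dtot_pair20; exact: divf_mul_mul nz.
Qed.

End Relations.

Theorem theorem1p1 (R : realType) (f : Lprim -> 'M[int]_3) (hf : framing f) :
  let s : total_cochain R := pair_cochain (@Gamma R) (@Delta R f) in
  [/\ (* the infinite products converge *)
      (forall (a b : Lprim) (y : R[i] * 'cV[R[i]]_3),
         sval a != sval b -> (V a `&` V b) y ->
         infprod_cvg (Cpm (sval a) (sval b))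
           (Gamma_num_factor (sval a) (sval b) y.1 y.2) /\
         infprod_cvg (Cmp (sval a) (sval b))
           (Gamma_den_factor (sval a) (sval b) y.1 y.2)) /\
      (forall z tau : R[i], 0 < complex.Im tau ->
         infprod_cvg [set: nat] (theta0_factor z tau)) /\
      (forall z tau sigma : R[i], 0 < complex.Im tau -> 0 < complex.Im sigma ->
         infprod_cvg [set: nat * nat] (egamma_factor z tau sigma)),
      (forall a b : Lprim, Mx (V a `&` V b) (@Gamma R a b)) /\
      (forall (a : Lprim) (g : ISL3), Mx (V a) (@Delta R f a g)),
      (forall y : R[i] * 'cV[R[i]]_3, (V e1 `&` V e2) y ->
         Gamma e1 e2 y =
         egamma (y.1 / y.2 2 0) (y.2 0 0 / y.2 2 0) (y.2 1 0 / y.2 2 0))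
    & exists phi : total_cochain R,
      [/\ gerbe_cocycle phi, gerbe_section phi s
        & forall (a b c : Lprim) (g h : ISL3),
          let phi_abc := phi 0%N 2%N [tuple] [tuple a; b; c] in
          let phi_ab := phi 1%N 1%N [tuple g] [tuple a; b] in
          let phi_a := phi 2%N 0%N [tuple g; h] [tuple a] in
          [/\ [/\ Ox (V a `&` V b `&` V c) phi_abc, Ox (V a `&` V b) phi_ab
                & Ox (V a) phi_a],
              meq (V a `&` V b) (fun y => @Gamma R a b y * Gamma b a y)
                                (fun _ => 1),
              meq (V a `&` V b `&` V c)
                (fun y => phi_abc y * Gamma a c y)
                (fun y => Gamma a b y * Gamma b c y),
              meq (V a `&` V b)
                (fun y => phi_ab y
                   * Gamma (act_prim g^-1%g a) (act_prim g^-1%g b)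
                       (act_pt g^-1%g y)
                   * Delta f b g y)
                (fun y => Delta f a g y * Gamma a b y)
            & meq (V a)
                (fun y => phi_a y * Delta f a (g * h)%g y)
                (fun y => Delta f a g y
                   * Delta f (act_prim g^-1%g a) h (act_pt g^-1%g y))]]].
Proof.
move=> s; split.
- split; first exact: Gamma_cvg.
  by split=> [z t t0|z t r t0 r0]; [exact: theta0_factor_cvg|exact: (egamma_factor_cvg z t0 r0).1].
- have [Mx_s _] := @gerbe_sectionP R f hf.
  split=> [a b|a g].
    by rewrite -Vs2; exact: (Mx_s 0%N 1%N [tuple] [tuple a; b]).
  by rewrite -Vs1; exact: (Mx_s 1%N 0%N [tuple g] [tuple a]).
- by move=> y [y1 y2]; exact: Gamma_e12.
exists (gerbe_of_section f); split.
- exact: gerbe_cocycleP.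
- exact: gerbe_sectionP.
move=> a b c g h phi_abc phi_ab phi_a.
have Ox_phi := @gerbe_in_degree R f hf; split.
- split.
  + by rewrite -Vs3; exact: (Ox_phi 0%N 2%N).
  + by rewrite -Vs2; exact: (Ox_phi 1%N 1%N).
  + by rewrite -Vs1; exact: (Ox_phi 2%N 0%N).
- exact: meq_Gamma_swap.
- exact: meq_gerbe02.
- exact: meq_gerbe11.
- exact: meq_gerbe20.
Qed.
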